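(* Let $(X,\mathcal{O}_X)$ be a noetherian scheme with associated locally ringed poset $(\mathcal{C},\mathcal{O}_{\mathcal{C}})$. The essential image of the specialization functor $S:\mathcal{M}(\mathcal{O}_X)\to PSh(\mathcal{O}_{\mathcal{C}})$ is exactly the full subcategory of admissible presheaves in $PSh(\mathcal{O}_{\mathcal{C}})$.
   Context: Associated locally ringed poset. A locally ringed poset $(\mathcal{C},\mathcal{O}_{\mathcal{C}})$ is a poset $\mathcal{C}$, regarded as a small category with a unique morphism $x\to y$ whenever $x\le y$, together with a presheaf (contravariant functor) $\mathcal{O}_{\mathcal{C}}$ of (commutative) local rings on $\mathcal{C}$. For a noetherian scheme $(X,\mathcal{O}_X)$, the associated locally ringed poset has as $\mathcal{C}$ the set of points of $X$ with the specialization order $x\le y$ iff $y\in\overline{\{x\}}$, with $\mathcal{O}_{\mathcal{C}}(x):=\mathcal{O}_{X,x}$, and for $x\le y$ the map $\mathcal{O}_{\mathcal{C}}(x\to y):\mathcal{O}_{X,y}\to\mathcal{O}_{X,x}$ is the canonical localization homomorphism. Presheaves of modules. $PSh(\mathcal{O}_{\mathcal{C}})$ is the category of presheaves (contravariant functors) of modules over $\mathcal{O}_{\mathcal{C}}$: an object $G$ consists of an $\mathcal{O}_{\mathcal{C}}(x)$-module $G(x)$ for each $x\in\mathcal{C}$ and, functorially for $x\le y$, additive maps $G(y)\to G(x)$ that are linear over $\mathcal{O}_{\mathcal{C}}(y)\to\mathcal{O}_{\mathcal{C}}(x)$; morphisms are families of $\mathcal{O}_{\mathcal{C}}(x)$-linear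 maps compatible with these transition maps. Specialization functor. $\mathcal{M}(\mathcal{O}_X)$ is the category of coherent sheaves of $\mathcal{O}_X$-modules. $S:\mathcal{M}(\mathcal{O}_X)\to PSh(\mathcal{O}_{\mathcal{C}})$ sends a coherent sheaf $\mathcal{F}$ to the presheaf $x\mapsto\mathcal{F}_x$ (stalks), with transition maps for $x\le y$ the canonical localization maps $\mathcal{F}_y\to\mathcal{F}_x$, $s\mapsto s\otimes_{\mathcal{O}_{X,y}}1$; it sends a morphism of sheaves to the family of induced maps on stalks. Topology on a poset. A subposet is closed if its set of points is a finite union of upsets $\{y: y\ge x\}$ of single points $x$; it is open if its complement is closed. An open locally ringed subposet $\mathcal{C}'\subset\mathcal{C}$ carries the induced order and the restriction of $\mathcal{O}_{\mathcal{C}}$. For such $\mathcal{C}'$ put $R_{\mathcal{C}'}:=\varprojlim_{x\in\mathcal{C}'}\mathcal{O}_{\mathcal{C}}(x)$. Affine noetherian. A locally ringed poset $(\mathcal{C}',\mathcal{O}_{\mathcal{C}'})$ is affine noetherian if $R_{\mathcal{C}'}$ is a noetherian ring and $(\mathcal{C}',\mathcal{O}_{\mathcal{C}'})$ is the locally ringed poset associated to the scheme $\operatorname{Spec}R_{\mathcal{C}'}$, i.e. the one whose underlying poset is the set of points of $\operatorname{Spec}R_{\mathcal{C}'}$ with the specialization order $p\le q$ iff $q\in\overline{\{p\}}$, whose value at $p$ is the local ring $\mathcal{O}_{\operatorname{Spec}R_{\mathcal{C}'},p}=(R_{\mathcal{C}'})_p$, and whose transition map for $p\le q$ is the canonical localization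 homomorphism $(R_{\mathcal{C}'})_q\to(R_{\mathcal{C}'})_p$. The functor $T_{\mathcal{C}'}$. For $G\in PSh(\mathcal{O}_{\mathcal{C}})$ and an open locally ringed subposet $\mathcal{C}'$, the inverse limit $\varprojlim_{z\in\mathcal{C}'}G(z)$ is an $R_{\mathcal{C}'}$-module (acting componentwise), and $T_{\mathcal{C}'}G$ is the presheaf on $\mathcal{C}'$ obtained by localizing it at each point: $T_{\mathcal{C}'}G(x):=\bigl(\varprojlim_{z\in\mathcal{C}'}G(z)\bigr)\otimes_{R_{\mathcal{C}'}}\mathcal{O}_{\mathcal{C}}(x)$. The projections from the inverse limit induce a canonical morphism $T_{\mathcal{C}'}G(x)\to G(x)$ for each $x\in\mathcal{C}'$. Admissible. $G\in PSh(\mathcal{O}_{\mathcal{C}})$ is quasi-admissible if there is a covering of $\mathcal{C}$ by open locally ringed subposets $\mathcal{C}_i$ such that for all $i$ and all $x\in\mathcal{C}_i$ the canonical morphism $T_{\mathcal{C}_i}G(x)\to G(x)$ is an isomorphism. If in addition this covering consists of open affine noetherian locally ringed subposets and, for every $i$, $\varprojlim_{x\in\mathcal{C}_i}G(x)$ is a finitely generated $R_{\mathcal{C}_i}$-module, then $G$ is called admissible. *)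

(* Defs.v *)
From HB Require Import structures.
From mathcomp Require Import all_boot all_order all_algebra ring.
From mathcomp Require Import boolp classical_sets topology.

Set Implicit Arguments.
Unset Strict Implicit.
Unset Printing Implicit Defensive.

Import Order.TTheory GRing.Theory.

Local Open Scope classical_set_scope.
Local Open Scope ring_scope.
Local Open Scope quotient_scope.

(* All rings are commutative and may be zero, hence [comPzRingType]. *)

Section Ideals.
Variable A : comPzRingType.

(* The ideals of mathcomp's ring_quotient are proper ideals of nonzero rings. *)
Definition is_ideal (I : set A) : Prop :=
  [/\ I 0, (forall a b, I a -> I b -> I (a + b)) & forall a b, I b -> I (a * b)].

Definition is_prime_ideal (I : set A) : Prop :=
  [/\ is_ideal I, ~ I 1 & forall a b, I (a * b) -> I a \/ I b].

Definition is_maximal_ideal (I : set A) : Prop :=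
  [/\ is_ideal I, ~ I 1 &
      forall J, is_ideal J -> I `<=` J -> ~ J 1 -> J `<=` I].

Definition local_ring : Prop := exists! m : set A, is_maximal_ideal m.

Definition noetherian : Prop :=
  forall I : set A, is_ideal I ->
    exists n (g : 'I_n -> A),
      forall a, I a <-> exists c : 'I_n -> A, a = \sum_(i < n) c i * g i.

Definition finitely_generated (M : lmodType A) : Prop :=
  exists n (g : 'I_n -> M),
    forall m, exists c : 'I_n -> A, m = \sum_(i < n) c i *: g i.

End Ideals.

Definition dprod (I : Type) (A : I -> Type) : Type := forall i, A i.

HB.instance Definition _ I A := gen_eqMixin (@dprod I A).
HB.instance Definition _ I A := gen_choiceMixin (@dprod I A).

Section DProdZmod.
Variables (I : Type) (A : I -> zmodType).
Implicit Types f g h : dprod A.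

Definition dprod_zero : dprod A := fun=> 0.
Definition dprod_opp f : dprod A := fun i => - f i.
Definition dprod_add f g : dprod A := fun i => f i + g i.

Lemma dprod_addA : associative dprod_add.
Proof. by move=> f g h; apply: functional_extensionality_dep => i; apply: addrA. Qed.
Lemma dprod_addC : commutative dprod_add.
Proof. by move=> f g; apply: functional_extensionality_dep => i; apply: addrC. Qed.
Lemma dprod_add0 : left_id dprod_zero dprod_add.
Proof. by move=> f; apply: functional_extensionality_dep => i; apply: add0r. Qed.
Lemma dprod_addN : left_inverse dprod_zero dprod_opp dprod_add.
Proof. by move=> f; apply: functional_extensionality_dep => i; apply: addNr. Qed.

HB.instance Definition _ := GRing.isZmodule.Build (dprod A)
  dprod_addA dprod_addC dprod_add0 dprod_addN.
End DProdZmod.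

Section DProdRing.
Variables (I : Type) (A : I -> comPzRingType).
Implicit Types f g h : dprod A.

Definition dprod_one : dprod A := fun=> 1.
Definition dprod_mul f g : dprod A := fun i => f i * g i.

Lemma dprod_mulA : associative dprod_mul.
Proof. by move=> f g h; apply: functional_extensionality_dep => i; apply: mulrA. Qed.
Lemma dprod_mulC : commutative dprod_mul.
Proof. by move=> f g; apply: functional_extensionality_dep => i; apply: mulrC. Qed.
Lemma dprod_mul1 : left_id dprod_one dprod_mul.
Proof. by move=> f; apply: functional_extensionality_dep => i; apply: mul1r. Qed.
Lemma dprod_mulDl : left_distributive dprod_mul +%R.
Proof. by move=> f g h; apply: functional_extensionality_dep => i; apply: mulrDl. Qed.

HB.instance Definition _ := GRing.Zmodule_isComPzRing.Build (dprod A)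
  dprod_mulA dprod_mulC dprod_mul1 dprod_mulDl.
End DProdRing.

Record Spec (A : comPzRingType) :=
  PrimeIdeal { prime_set :> set A; primeP : is_prime_ideal prime_set }.

HB.instance Definition _ A := gen_eqMixin (Spec A).
HB.instance Definition _ A := gen_choiceMixin (Spec A).

Section Zariski.
Variable A : comPzRingType.

Definition vanishing (E : set A) : set (Spec A) := [set p | E `<=` p].

Definition zariski_open (U : set (Spec A)) : Prop :=
  exists E, U = ~` vanishing E.

Lemma zariski_openT : zariski_open setT.
Proof.
exists setT; apply/esym; rewrite -subTset => p _ /(_ 1 I).
by have [] := primeP p.
Qed.

Lemma zariski_openI : setI_closed zariski_open.
Proof.
move=> _ _ [E ->] [F ->]; exists [set c | exists2 a, E a & exists2 b, F b & c = a * b].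
rewrite -setCU; congr (~` _); apply/seteqP; split=> p /=.
  have [[_ _ pM] _ _] := primeP p.
  by case=> sub _ [a Ea [b Fb ->]]; [rewrite mulrC|]; apply: pM; apply: sub.
move=> sub; apply: contrapT => /not_orP[/existsNP[a /not_implyP[Ea npa]]].
move=> /existsNP[b /not_implyP[Fb npb]].
have [_ _ /(_ a b)] := primeP p.
by case=> //; apply: sub; exists a => //; exists b.
Qed.

Lemma zariski_open_bigU (I : Type) (f : I -> set (Spec A)) :
  (forall i, zariski_open (f i)) -> zariski_open (\bigcup_i f i).
Proof.
move=> /choice[E fE]; exists (\bigcup_i E i).
rewrite (_ : f = fun i => ~` vanishing (E i)); last by apply/funext.
rewrite -setC_bigcap; congr (~` _); apply/seteqP; split=> p /=.
  by move=> sub a [i _ Eia]; apply: (sub i).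
by move=> sub i _ a Eia; apply: sub; exists i.
Qed.

HB.instance Definition _ := isOpenTopological.Build (Spec A)
  zariski_openT zariski_openI zariski_open_bigU.

End Zariski.

Record denom (A : comPzRingType) (p : Spec A) :=
  Denom { dval : A; denomP : ~ prime_set p dval }.
Arguments denomP {A p} s _ : rename.

HB.instance Definition _ A (p : Spec A) := gen_eqMixin (denom p).
HB.instance Definition _ A (p : Spec A) := gen_choiceMixin (denom p).

Section Localization.
Variables (A : comPzRingType) (p : Spec A).
Local Notation denom := (denom p).

Definition ratio : Type := (A * denom)%type.
HB.instance Definition _ := Choice.on ratio.

Lemma denom1_subproof : ~ prime_set p 1.
Proof. by have [] := primeP p. Qed.
Definition denom1 : denom := Denom denom1_subproof.

Lemma denomM_subproof (s t : denom) : ~ prime_set p (dval s * dval t).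
Proof.
by move=> pst; have [_ _ /(_ _ _ pst)] := primeP p; case; apply: denomP.
Qed.
Definition denomM (s t : denom) : denom := Denom (@denomM_subproof s t).

Definition loc_equiv (x y : ratio) : bool :=
  `[< exists u : denom, dval u * (x.1 * dval y.2) = dval u * (y.1 * dval x.2) >].

Lemma loc_equiv_refl : reflexive loc_equiv.
Proof. by move=> x; apply/asboolP; exists denom1. Qed.
Lemma loc_equiv_sym : symmetric loc_equiv.
Proof. by move=> x y; apply/asboolP/asboolP => -[u e]; exists u. Qed.
Lemma loc_equiv_trans : transitive loc_equiv.
Proof.
move=> y x z /asboolP[u e] /asboolP[v f]; apply/asboolP.
exists (denomM y.2 (denomM u v)) => /=.
transitivity (dval v * dval z.2 * (dval u * (x.1 * dval y.2))); first by ring.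
by rewrite e; transitivity (dval u * dval x.2 * (dval v * (y.1 * dval z.2)));
  [ring | rewrite f; ring].
Qed.

Canonical loc_equivRel :=
  EquivRel loc_equiv loc_equiv_refl loc_equiv_sym loc_equiv_trans.

Definition loc : Type := {eq_quot loc_equiv}.
HB.instance Definition _ : EqQuotient _ loc_equiv loc := EqQuotient.on loc.
HB.instance Definition _ := Choice.on loc.

Definition frac (a : A) (s : denom) : loc := \pi_loc ((a, s) : ratio).

Lemma eq_frac a s b t :
  frac a s = frac b t <->
  exists u : denom, dval u * (a * dval t) = dval u * (b * dval s).
Proof.
split=> [/eqmodP/asboolP//|e]; by apply/eqmodP/asboolP.
Qed.

Variant frac_spec : loc -> Type := FracSpec a s : frac_spec (frac a s).

Lemma fracP x : frac_spec x.
Proof. by rewrite -[x]reprK; case: (repr x) => a s; constructor. Qed.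

Lemma frac_repr a s : exists u : denom,
  let x := repr (frac a s) in dval u * (x.1 * dval s) = dval u * (a * dval x.2).
Proof.
by apply/eq_frac; rewrite -[RHS]reprK /frac; case: (repr _).
Qed.

Definition loc_opp (x : loc) : loc := frac (- (repr x).1) (repr x).2.
Definition loc_add (x y : loc) : loc :=
  frac ((repr x).1 * dval (repr y).2 + (repr y).1 * dval (repr x).2)
       (denomM (repr x).2 (repr y).2).
Definition loc_mul (x y : loc) : loc :=
  frac ((repr x).1 * (repr y).1) (denomM (repr x).2 (repr y).2).

Lemma loc_oppE a s : loc_opp (frac a s) = frac (- a) s.
Proof.
have [u /= e] := frac_repr a s; apply/eq_frac; exists u.
by rewrite !mulNr !mulrN e.
Qed.

Lemma loc_addE a s b t :
  loc_add (frac a s) (frac b t) = frac (a * dval t + b * dval s) (denomM s t).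
Proof.
have [u /= e] := frac_repr a s; have [v /= f] := frac_repr b t.
apply/eq_frac; exists (denomM u v) => /=.
set x := repr (frac a s) in e *; set y := repr (frac b t) in f *.
transitivity (dval v * dval y.2 * dval t * (dval u * (x.1 * dval s)) +
              dval u * dval x.2 * dval s * (dval v * (y.1 * dval t))); first by ring.
by rewrite e f; ring.
Qed.

Lemma loc_mulE a s b t :
  loc_mul (frac a s) (frac b t) = frac (a * b) (denomM s t).
Proof.
have [u /= e] := frac_repr a s; have [v /= f] := frac_repr b t.
apply/eq_frac; exists (denomM u v) => /=.
set x := repr (frac a s) in e *; set y := repr (frac b t) in f *.
transitivity ((dval u * (x.1 * dval s)) * (dval v * (y.1 * dval t))); first by ring.
by rewrite e f; ring.
Qed.

Lemma loc_addA : associative loc_add.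
Proof.
move=> x y z; case: (fracP x) (fracP y) (fracP z) => a s [b t] [c r].
by rewrite !loc_addE; apply/eq_frac; exists denom1 => /=; ring.
Qed.
Lemma loc_addC : commutative loc_add.
Proof.
move=> x y; case: (fracP x) (fracP y) => a s [b t].
by rewrite !loc_addE; apply/eq_frac; exists denom1 => /=; ring.
Qed.
Lemma loc_add0 : left_id (frac 0 denom1) loc_add.
Proof.
move=> x; case: (fracP x) => a s.
by rewrite !loc_addE; apply/eq_frac; exists denom1 => /=; ring.
Qed.
Lemma loc_addN : left_inverse (frac 0 denom1) loc_opp loc_add.
Proof.
move=> x; case: (fracP x) => a s.
by rewrite loc_oppE !loc_addE; apply/eq_frac; exists denom1 => /=; ring.
Qed.

HB.instance Definition _ := GRing.isZmodule.Build loc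
  loc_addA loc_addC loc_add0 loc_addN.

Lemma fracD a s b t : frac a s + frac b t = frac (a * dval t + b * dval s) (denomM s t).
Proof. exact: loc_addE. Qed.

Lemma loc_mulA : associative loc_mul.
Proof.
move=> x y z; case: (fracP x) (fracP y) (fracP z) => a s [b t] [c r].
by rewrite !loc_mulE; apply/eq_frac; exists denom1 => /=; ring.
Qed.
Lemma loc_mulC : commutative loc_mul.
Proof.
move=> x y; case: (fracP x) (fracP y) => a s [b t].
by rewrite !loc_mulE; apply/eq_frac; exists denom1 => /=; ring.
Qed.
Lemma loc_mul1 : left_id (frac 1 denom1) loc_mul.
Proof.
move=> x; case: (fracP x) => a s.
by rewrite !loc_mulE; apply/eq_frac; exists denom1 => /=; ring.
Qed.
Lemma loc_mulDl : left_distributive loc_mul +%R.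
Proof.
move=> x y z; case: (fracP x) (fracP y) (fracP z) => a s [b t] [c r].
rewrite fracD !loc_mulE fracD.
by apply/eq_frac; exists denom1 => /=; ring.
Qed.

HB.instance Definition _ := GRing.Zmodule_isComPzRing.Build loc
  loc_mulA loc_mulC loc_mul1 loc_mulDl.

Lemma fracN a s : - frac a s = frac (- a) s.
Proof. exact: loc_oppE. Qed.
Lemma fracM a s b t : frac a s * frac b t = frac (a * b) (denomM s t).
Proof. exact: loc_mulE. Qed.
Lemma frac0 : 0 = frac 0 denom1. Proof. by []. Qed.
Lemma frac1 : 1 = frac 1 denom1. Proof. by []. Qed.

Lemma loc_local : local_ring loc.
Proof.
have [[p0 pD pM] p1 pP] := primeP p.
have inm a s : (exists2 b, prime_set p b & exists t, frac a s = frac b t) ->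
    prime_set p a.
  case=> b pb [t /eq_frac[u e]].
  have : prime_set p (dval u * dval t * a).
    rewrite (_ : _ * a = dval u * dval s * b); first exact: pM.
    by transitivity (dval u * (a * dval t)); [ring | rewrite e; ring].
  by case/pP=> // /pP[]/denomP.
pose m : set loc := [set x | exists2 b, prime_set p b & exists t, x = frac b t].
have mI : is_ideal m.
  split; first by exists 0 => //; exists denom1.
    move=> _ _ [a pa [s ->]] [b pb [t ->]].
    rewrite fracD; exists (a * dval t + b * dval s); last by exists (denomM s t).
    by apply: pD; rewrite mulrC; apply: pM.
  move=> x _ [b pb [t ->]]; case: (fracP x) => a s.
  by rewrite fracM; exists (a * b); [apply: pM | exists (denomM s t)].
have m1 : ~ m 1 by rewrite frac1 => /inm.
have sub J : is_ideal J -> ~ J 1 -> J `<=` m.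
  move=> [_ _ JM] J1 x; case: (fracP x) => a s Ja.
  exists a; last by exists s.
  apply: contrapT => npa; apply: J1.
  have -> : 1 = frac (dval s) (Denom npa) * frac a s; last exact: JM.
  by rewrite fracM frac1; apply/eq_frac; exists denom1 => /=; ring.
exists m; split; first by split=> // J JI _; apply: sub.
move=> J [JI J1 Jmax]; apply/seteqP; split; last exact: sub.
exact: (Jmax m mI (sub J JI J1) m1).
Qed.

End Localization.

(* The canonical localization map [A_q -> A_p], for [p] contained in [q]. *)
Section LocMap.
Variables (A : comPzRingType) (p q : Spec A) (pq : p `<=` q).

Lemma loc_map_subproof (s : denom q) : ~ prime_set p (dval s).
Proof. by move=> /pq; apply: denomP. Qed.

Definition loc_map (x : loc q) : loc p :=
  frac (repr x).1 (Denom (@loc_map_subproof (repr x).2)).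

Lemma loc_mapE a s : loc_map (frac a s) = frac a (Denom (@loc_map_subproof s)).
Proof.
have [u /= e] := frac_repr a s.
by apply/eq_frac; exists (Denom (@loc_map_subproof u)).
Qed.

Lemma loc_map_is_additive : zmod_morphism loc_map.
Proof.
move=> x y; case: (fracP x) (fracP y) => a s [b t].
rewrite fracN fracD !loc_mapE fracN fracD.
by apply/eq_frac; exists (denom1 _) => /=; ring.
Qed.
Lemma loc_map_is_multiplicative : monoid_morphism loc_map.
Proof.
split=> [|x y]; first by rewrite !frac1 loc_mapE; apply/eq_frac; exists (denom1 _).
case: (fracP x) (fracP y) => a s [b t].
rewrite fracM !loc_mapE fracM.
by apply/eq_frac; exists (denom1 _) => /=; ring.
Qed.

HB.instance Definition _ :=
  GRing.isZmodMorphism.Build (loc q) (loc p) loc_map loc_map_is_additive.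
HB.instance Definition _ :=
  GRing.isMonoidMorphism.Build (loc q) (loc p) loc_map loc_map_is_multiplicative.

End LocMap.

Record opens (X : topologicalType) :=
  Opens { opens_set :> set X; opensP : open opens_set }.

Definition opensI (X : topologicalType) (U V : opens X) : opens X :=
  Opens (openI (opensP U) (opensP V)).

Lemma opensIl (X : topologicalType) (U V : opens X) : opensI U V `<=` U.
Proof. by move=> x []. Qed.
Lemma opensIr (X : topologicalType) (U V : opens X) : opensI U V `<=` V.
Proof. by move=> x []. Qed.

Record ab_presheaf (X : topologicalType) := AbPresheaf {
  ab_sec :> opens X -> zmodType;
  ab_res : forall U V : opens X, U `<=` V -> {additive ab_sec V -> ab_sec U};
  ab_res_id : forall (U : opens X) (h : U `<=` U) s, ab_res h s = s;
  ab_res_comp : forall (U V W : opens X) (h : U `<=` V) (k : V `<=` W)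
    (l : U `<=` W) s, ab_res h (ab_res k s) = ab_res l s }.

Definition is_sheaf (X : topologicalType) (F : ab_presheaf X) : Prop :=
  forall (U : opens X) (I : Type) (V : I -> opens X) (VU : forall i, V i `<=` U),
    U `<=` \bigcup_i V i ->
  forall s : (forall i, F (V i)),
    (forall i j, ab_res F (@opensIl _ (V i) (V j)) (s i)
               = ab_res F (@opensIr _ (V i) (V j)) (s j)) ->
  exists! t : F U, forall i, ab_res F (VU i) t = s i.

Record ring_presheaf (X : topologicalType) := RingPresheaf {
  rp_sec :> opens X -> comPzRingType;
  rp_res : forall U V : opens X, U `<=` V -> {rmorphism rp_sec V -> rp_sec U};
  rp_res_id : forall (U : opens X) (h : U `<=` U) s, rp_res h s = s;
  rp_res_comp : forall (U V W : opens X) (h : U `<=` V) (k : V `<=` W)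
    (l : U `<=` W) s, rp_res h (rp_res k s) = rp_res l s }.

Definition ab_of_ring (X : topologicalType) (O : ring_presheaf X) : ab_presheaf X :=
  @AbPresheaf X (fun U => O U) (fun U V h => rp_res O h)
    (@rp_res_id X O) (@rp_res_comp X O).

Record mod_presheaf (X : topologicalType) (O : ring_presheaf X) := ModPresheaf {
  mp_sec :> forall U : opens X, lmodType (O U);
  mp_res : forall (U V : opens X) (h : U `<=` V),
    {linear mp_sec V -> mp_sec U | rp_res O h \; *:%R};
  mp_res_id : forall (U : opens X) (h : U `<=` U) s, mp_res h s = s;
  mp_res_comp : forall (U V W : opens X) (h : U `<=` V) (k : V `<=` W)
    (l : U `<=` W) s, mp_res h (mp_res k s) = mp_res l s }.

Definition ab_of_mod (X : topologicalType) (O : ring_presheaf X)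
    (F : mod_presheaf O) : ab_presheaf X :=
  @AbPresheaf X (fun U => F U) (fun U V h => mp_res F h)
    (@mp_res_id X O F) (@mp_res_comp X O F).

Section Stalk.
Variables (X : topologicalType) (F : ab_presheaf X) (x : X).

Record section_at := SectionAt {
  sec_dom : opens X; sec_dom_in : opens_set sec_dom x; sec_val : F sec_dom }.
HB.instance Definition _ := gen_eqMixin section_at.
HB.instance Definition _ := gen_choiceMixin section_at.

Definition germ_equiv (s t : section_at) : bool :=
  `[< exists (W : opens X) (Ws : W `<=` sec_dom s) (Wt : W `<=` sec_dom t),
        opens_set W x /\ ab_res F Ws (sec_val s) = ab_res F Wt (sec_val t) >].

Lemma germ_equiv_refl : reflexive germ_equiv.
Proof.
move=> s; apply/asboolP; exists (sec_dom s), (@subset_refl _ _), (@subset_refl _ _).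
by split=> //; apply: sec_dom_in.
Qed.
Lemma germ_equiv_sym : symmetric germ_equiv.
Proof.
by move=> s t; apply/asboolP/asboolP => -[W [h [k [Wx e]]]]; exists W, k, h.
Qed.
Lemma germ_equiv_trans : transitive germ_equiv.
Proof.
move=> t s r /asboolP[V [h [k [Vx e]]]] /asboolP[W [l [m [Wx f]]]].
apply/asboolP; pose VW := opensI V W.
have VWV : VW `<=` V by move=> ? [].
have VWW : VW `<=` W by move=> ? [].
exists VW, (subset_trans VWV h), (subset_trans VWW m); split=> //.
rewrite -(ab_res_comp VWV h) e -(ab_res_comp VWW m) -f.
by rewrite !(ab_res_comp _ _ (subset_trans VWV k)).
Qed.

Canonical germ_equivRel :=
  EquivRel germ_equiv germ_equiv_refl germ_equiv_sym germ_equiv_trans.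

Definition stalk : Type := {eq_quot germ_equiv}.
HB.instance Definition _ : EqQuotient _ germ_equiv stalk := EqQuotient.on stalk.
HB.instance Definition _ := Choice.on stalk.

Definition germ (U : opens X) (Ux : opens_set U x) (s : F U) : stalk :=
  \pi_stalk (SectionAt Ux s).

Lemma eq_germ (U V : opens X) (Ux : opens_set U x) (Vx : opens_set V x) s t :
  germ Ux s = germ Vx t <->
  exists (W : opens X) (WU : W `<=` U) (WV : W `<=` V),
    opens_set W x /\ ab_res F WU s = ab_res F WV t.
Proof.
split=> [/eqmodP/asboolP//|e]; by apply/eqmodP/asboolP.
Qed.

Lemma germ_res (U V : opens X) (VU : V `<=` U) (Ux : opens_set U x)
    (Vx : opens_set V x) s : germ Vx (ab_res F VU s) = germ Ux s.
Proof.
apply/eq_germ; exists V, (@subset_refl _ _), VU; split=> //.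
by rewrite ab_res_id.
Qed.

Lemma germ_repr (z : stalk) : germ (sec_dom_in (repr z)) (sec_val (repr z)) = z.
Proof. by rewrite -[RHS]reprK /germ; case: (repr z). Qed.

Variant germ_spec : stalk -> Type :=
  GermSpec (U : opens X) (Ux : opens_set U x) s : germ_spec (germ Ux s).

Lemma germP z : germ_spec z.
Proof. by rewrite -[z]germ_repr. Qed.

Variant germ2_spec : stalk -> stalk -> Type :=
  Germ2Spec (U : opens X) (Ux : opens_set U x) s t :
    germ2_spec (germ Ux s) (germ Ux t).

Lemma germ2P z w : germ2_spec z w.
Proof.
case: (germP z) (germP w) => U Ux s [V Vx t].
have WU := @opensIl _ U V; have WV := @opensIr _ U V.
have Wx : opens_set (opensI U V) x by split.
by rewrite -(germ_res WU Ux Wx) -(germ_res WV Vx Wx).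
Qed.

Variant germ3_spec : stalk -> stalk -> stalk -> Type :=
  Germ3Spec (U : opens X) (Ux : opens_set U x) s t r :
    germ3_spec (germ Ux s) (germ Ux t) (germ Ux r).

Lemma germ3P z w v : germ3_spec z w v.
Proof.
case: (germ2P z w) (germP v) => U Ux s t [V Vx r].
have WU := @opensIl _ U V; have WV := @opensIr _ U V.
have Wx : opens_set (opensI U V) x by split.
by rewrite -!(germ_res WU Ux Wx) -(germ_res WV Vx Wx).
Qed.

(* Operations on germs, computed on the intersection of two domains. *)
Definition germ_op2 (op : forall U, F U -> F U -> F U) (z w : stalk) : stalk :=
  @germ (opensI (sec_dom (repr z)) (sec_dom (repr w)))
    (conj (sec_dom_in (repr z)) (sec_dom_in (repr w)))
    (op _ (ab_res F (@opensIl _ _ _) (sec_val (repr z)))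
          (ab_res F (@opensIr _ _ _) (sec_val (repr w)))).

Lemma germ_op2E (op : forall U, F U -> F U -> F U)
    (opr : forall (U V : opens X) (h : U `<=` V) s t,
       ab_res F h (op V s t) = op U (ab_res F h s) (ab_res F h t))
    U (Ux : opens_set U x) s t :
  germ_op2 op (germ Ux s) (germ Ux t) = germ Ux (op U s t).
Proof.
rewrite /germ_op2; set z := repr _; set w := repr _.
have /eq_germ[V [Vz [VU [Vx ze]]]] := germ_repr (germ Ux s).
have /eq_germ[W [Ww [WU [Wx we]]]] := germ_repr (germ Ux t).
have VWV := @opensIl _ V W; have VWW := @opensIr _ V W.
have VWU := subset_trans VWV VU.
have VWzw : opensI V W `<=` opensI (sec_dom z) (sec_dom w).
  by move=> y [/Vz ? /Ww ?]; split.
apply/eq_germ; exists (opensI V W), VWzw, VWU; split; first by split.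
rewrite !opr; congr (op _ _ _).
  rewrite (ab_res_comp _ _ (subset_trans VWV Vz)) -(ab_res_comp VWV Vz).
  by rewrite ze (ab_res_comp _ _ VWU).
rewrite (ab_res_comp _ _ (subset_trans VWW Ww)) -(ab_res_comp VWW Ww).
by rewrite we (ab_res_comp _ _ VWU).
Qed.

Definition stalk_zero : stalk := @germ (Opens openT) I 0.
Definition stalk_opp (z : stalk) : stalk :=
  germ (sec_dom_in (repr z)) (- sec_val (repr z)).
Definition stalk_add : stalk -> stalk -> stalk := germ_op2 (fun U => +%R).

Lemma stalk_zeroE U (Ux : opens_set U x) : stalk_zero = germ Ux 0.
Proof.
apply/eq_germ; exists U, (@subsetT _ _), (@subset_refl _ _).
by split=> //; rewrite !raddf0.
Qed.
Lemma stalk_oppE U (Ux : opens_set U x) s : stalk_opp (germ Ux s) = germ Ux (- s).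
Proof.
rewrite /stalk_opp; have /eq_germ[V [Vz [VU [Vx ze]]]] := germ_repr (germ Ux s).
by apply/eq_germ; exists V, Vz, VU; split=> //; rewrite !raddfN ze.
Qed.
Lemma stalk_addE U (Ux : opens_set U x) s t :
  stalk_add (germ Ux s) (germ Ux t) = germ Ux (s + t).
Proof. by rewrite [LHS]germ_op2E // => *; rewrite raddfD. Qed.

Lemma stalk_addA : associative stalk_add.
Proof. by move=> z w v; case: (germ3P z w v) => *; rewrite !stalk_addE addrA. Qed.
Lemma stalk_addC : commutative stalk_add.
Proof. by move=> z w; case: (germ2P z w) => *; rewrite !stalk_addE addrC. Qed.
Lemma stalk_add0 : left_id stalk_zero stalk_add.
Proof.
by move=> z; case: (germP z) => U Ux s; rewrite (stalk_zeroE Ux) stalk_addE add0r.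
Qed.
Lemma stalk_addN : left_inverse stalk_zero stalk_opp stalk_add.
Proof.
move=> z; case: (germP z) => U Ux s.
by rewrite (stalk_zeroE Ux) stalk_oppE stalk_addE addNr.
Qed.

HB.instance Definition _ := GRing.isZmodule.Build stalk
  stalk_addA stalk_addC stalk_add0 stalk_addN.

Lemma germD U (Ux : opens_set U x) s t : germ Ux s + germ Ux t = germ Ux (s + t).
Proof. exact: stalk_addE. Qed.
Lemma germN U (Ux : opens_set U x) s : - germ Ux s = germ Ux (- s).
Proof. exact: stalk_oppE. Qed.
Lemma germ0 U (Ux : opens_set U x) : 0 = germ Ux 0.
Proof. exact: stalk_zeroE. Qed.

End Stalk.

Section RingStalk.
Variables (X : topologicalType) (O : ring_presheaf X) (x : X).

Definition ring_stalk : Type := stalk (ab_of_ring O) x.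
HB.instance Definition _ := GRing.Zmodule.on ring_stalk.

Definition rgerm (U : opens X) (Ux : opens_set U x) (s : O U) : ring_stalk :=
  @germ X (ab_of_ring O) x U Ux s.

Definition ring_stalk_one : ring_stalk := @rgerm (Opens openT) I 1.
Definition ring_stalk_mul : ring_stalk -> ring_stalk -> ring_stalk :=
  germ_op2 (F := ab_of_ring O) (fun U => ( *%R : O U -> O U -> O U)).

Lemma ring_stalk_oneE U (Ux : opens_set U x) : ring_stalk_one = rgerm Ux 1.
Proof.
apply/eq_germ; exists U, (@subsetT _ _), (@subset_refl _ _).
by split=> //=; rewrite !rmorph1.
Qed.
Lemma ring_stalk_mulE U (Ux : opens_set U x) s t :
  ring_stalk_mul (rgerm Ux s) (rgerm Ux t) = rgerm Ux (s * t).
Proof.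
apply: (@germ_op2E X (ab_of_ring O) x (fun U => ( *%R : O U -> O U -> O U))).
by move=> ? ? ? ? ?; rewrite /= rmorphM.
Qed.
Lemma rgermD U (Ux : opens_set U x) s t : rgerm Ux s + rgerm Ux t = rgerm Ux (s + t).
Proof. exact: stalk_addE. Qed.
Lemma rgermN U (Ux : opens_set U x) s : - rgerm Ux s = rgerm Ux (- s).
Proof. exact: stalk_oppE. Qed.

Variant rgerm_spec : ring_stalk -> Type :=
  RGermSpec (U : opens X) (Ux : opens_set U x) s : rgerm_spec (rgerm Ux s).
Lemma rgermP z : rgerm_spec z.
Proof. by case: (germP z). Qed.
Variant rgerm2_spec : ring_stalk -> ring_stalk -> Type :=
  RGerm2Spec (U : opens X) (Ux : opens_set U x) s t :
    rgerm2_spec (rgerm Ux s) (rgerm Ux t).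
Lemma rgerm2P z w : rgerm2_spec z w.
Proof. by case: (germ2P z w). Qed.
Variant rgerm3_spec : ring_stalk -> ring_stalk -> ring_stalk -> Type :=
  RGerm3Spec (U : opens X) (Ux : opens_set U x) s t r :
    rgerm3_spec (rgerm Ux s) (rgerm Ux t) (rgerm Ux r).
Lemma rgerm3P z w v : rgerm3_spec z w v.
Proof. by case: (germ3P z w v). Qed.

Lemma ring_stalk_mulA : associative ring_stalk_mul.
Proof. by move=> z w v; case: (rgerm3P z w v) => *; rewrite !ring_stalk_mulE mulrA. Qed.
Lemma ring_stalk_mulC : commutative ring_stalk_mul.
Proof. by move=> z w; case: (rgerm2P z w) => *; rewrite !ring_stalk_mulE mulrC. Qed.
Lemma ring_stalk_mul1 : left_id ring_stalk_one ring_stalk_mul.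
Proof.
move=> z; case: (rgermP z) => U Ux s.
by rewrite (ring_stalk_oneE Ux) ring_stalk_mulE mul1r.
Qed.
Lemma ring_stalk_mulDl : left_distributive ring_stalk_mul +%R.
Proof.
move=> z w v; case: (rgerm3P z w v) => *.
by rewrite rgermD !ring_stalk_mulE rgermD mulrDl.
Qed.

HB.instance Definition _ := GRing.Zmodule_isComPzRing.Build ring_stalk
  ring_stalk_mulA ring_stalk_mulC ring_stalk_mul1 ring_stalk_mulDl.

Lemma rgermM U (Ux : opens_set U x) s t : rgerm Ux s * rgerm Ux t = rgerm Ux (s * t).
Proof. exact: ring_stalk_mulE. Qed.
Lemma rgerm1 U (Ux : opens_set U x) : 1 = rgerm Ux 1.
Proof. exact: ring_stalk_oneE. Qed.

End RingStalk.

Section ModStalk.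
Variables (X : topologicalType) (O : ring_presheaf X) (F : mod_presheaf O) (x : X).

Definition mod_stalk : Type := stalk (ab_of_mod F) x.
HB.instance Definition _ := GRing.Zmodule.on mod_stalk.

Definition mgerm (U : opens X) (Ux : opens_set U x) (s : F U) : mod_stalk :=
  @germ X (ab_of_mod F) x U Ux s.

Definition mod_stalk_scale (a : ring_stalk O x) (z : mod_stalk) : mod_stalk :=
  @mgerm (opensI (sec_dom (repr a)) (sec_dom (repr z)))
    (conj (sec_dom_in (repr a)) (sec_dom_in (repr z)))
    (rp_res O (@opensIl _ _ _) (sec_val (repr a)) *:
     mp_res F (@opensIr _ _ _) (sec_val (repr z))).

Lemma mod_stalk_scaleE U (Ux : opens_set U x) a s :
  mod_stalk_scale (rgerm Ux a) (mgerm Ux s) = mgerm Ux (a *: s).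
Proof.
rewrite /mod_stalk_scale; set z := repr _; set w := repr _.
have /eq_germ[V [Vz [VU [Vx /= ze]]]] := germ_repr (rgerm Ux a).
have /eq_germ[W [Ww [WU [Wx /= we]]]] := germ_repr (mgerm Ux s).
have VWV := @opensIl _ V W; have VWW := @opensIr _ V W.
have VWU := subset_trans VWV VU.
have VWzw : opensI V W `<=` opensI (sec_dom z) (sec_dom w).
  by move=> y [/Vz ? /Ww ?]; split.
apply/eq_germ; exists (opensI V W), VWzw, VWU; split; first by split.
rewrite /= !linearZ /=; congr (_ *: _).
  rewrite (rp_res_comp _ _ (subset_trans VWV Vz)) -(rp_res_comp VWV Vz).
  by rewrite ze (rp_res_comp _ _ VWU).
rewrite (mp_res_comp _ _ (subset_trans VWW Ww)) -(mp_res_comp VWW Ww).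
by rewrite we (mp_res_comp _ _ VWU).
Qed.

Lemma mgermD U (Ux : opens_set U x) s t : mgerm Ux s + mgerm Ux t = mgerm Ux (s + t).
Proof. exact: stalk_addE. Qed.
Lemma mgermN U (Ux : opens_set U x) s : - mgerm Ux s = mgerm Ux (- s).
Proof. exact: stalk_oppE. Qed.

Lemma mgerm_res (U V : opens X) (VU : V `<=` U) (Ux : opens_set U x)
    (Vx : opens_set V x) s : mgerm Vx (mp_res F VU s) = mgerm Ux s.
Proof. exact: (@germ_res X (ab_of_mod F)). Qed.
Lemma rgerm_res (U V : opens X) (VU : V `<=` U) (Ux : opens_set U x)
    (Vx : opens_set V x) s : rgerm Vx (rp_res O VU s) = rgerm Ux s.
Proof. exact: (@germ_res X (ab_of_ring O)). Qed.

Variant mgerm_spec : mod_stalk -> Type :=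
  MGermSpec (U : opens X) (Ux : opens_set U x) s : mgerm_spec (mgerm Ux s).
Lemma mgermP z : mgerm_spec z.
Proof. by case: (germP z). Qed.
Variant mgerm2_spec : mod_stalk -> mod_stalk -> Type :=
  MGerm2Spec (U : opens X) (Ux : opens_set U x) s t :
    mgerm2_spec (mgerm Ux s) (mgerm Ux t).
Lemma mgerm2P z w : mgerm2_spec z w.
Proof. by case: (germ2P z w). Qed.

Variant rrmgerm_spec : ring_stalk O x -> ring_stalk O x -> mod_stalk -> Type :=
  RRMGermSpec (U : opens X) (Ux : opens_set U x) a b s :
    rrmgerm_spec (rgerm Ux a) (rgerm Ux b) (mgerm Ux s).
Lemma rrmgermP a b z : rrmgerm_spec a b z.
Proof.
case: (rgerm2P a b) => U Ux c d; case: (mgermP z) => V Vx s.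
have Wx : opens_set (opensI U V) x by split.
by rewrite -!(rgerm_res (@opensIl _ U V) Ux Wx) -(mgerm_res (@opensIr _ U V) Vx Wx).
Qed.

Variant rmmgerm_spec : ring_stalk O x -> mod_stalk -> mod_stalk -> Type :=
  RMMGermSpec (U : opens X) (Ux : opens_set U x) a s t :
    rmmgerm_spec (rgerm Ux a) (mgerm Ux s) (mgerm Ux t).
Lemma rmmgermP a z w : rmmgerm_spec a z w.
Proof.
case: (rgermP a) => U Ux c; case: (mgerm2P z w) => V Vx s t.
have Wx : opens_set (opensI U V) x by split.
by rewrite -(rgerm_res (@opensIl _ U V) Ux Wx) -!(mgerm_res (@opensIr _ U V) Vx Wx).
Qed.

Lemma mod_stalk_scaleA a b z :
  mod_stalk_scale a (mod_stalk_scale b z) = mod_stalk_scale (a * b) z.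
Proof.
case: (rrmgermP a b z) => U Ux c d s.
by rewrite rgermM !mod_stalk_scaleE scalerA.
Qed.
Lemma mod_stalk_scale1 : left_id 1 mod_stalk_scale.
Proof.
move=> z; case: (mgermP z) => U Ux s.
by rewrite (rgerm1 O Ux) mod_stalk_scaleE scale1r.
Qed.
Lemma mod_stalk_scaleDr : right_distributive mod_stalk_scale +%R.
Proof.
move=> a z w; case: (rmmgermP a z w) => U Ux c s t.
by rewrite mgermD !mod_stalk_scaleE mgermD scalerDr.
Qed.
Lemma mod_stalk_scaleDl z : {morph mod_stalk_scale^~ z : a b / a + b}.
Proof.
move=> a b; case: (rrmgermP a b z) => U Ux c d s.
by rewrite rgermD !mod_stalk_scaleE mgermD scalerDl.
Qed.

HB.instance Definition _ := GRing.Zmodule_isLmodule.Build (ring_stalk O x) mod_stalk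
  mod_stalk_scaleA mod_stalk_scale1 mod_stalk_scaleDr mod_stalk_scaleDl.

Lemma mgermZ U (Ux : opens_set U x) a s : rgerm Ux a *: mgerm Ux s = mgerm Ux (a *: s).
Proof. exact: mod_stalk_scaleE. Qed.

End ModStalk.

Section Specialization.
Variable X : topologicalType.

Definition specializes (x y : X) : Prop := closure [set x] y.

Lemma specializesP x y :
  specializes x y <-> forall U : opens X, opens_set U y -> opens_set U x.
Proof.
split=> [xy U Uy|xy B /=].
  have [_ [-> //]] := xy _ (open_nbhs_nbhs (conj (opensP U) Uy)).
rewrite nbhsE => -[U [Uo Uy] UB].
by exists x; split=> //; apply: UB; apply: (xy (Opens Uo)).
Qed.

Lemma specializes_refl x : specializes x x.
Proof. by apply/specializesP. Qed.
Lemma specializes_trans y x z : specializes x y -> specializes y z -> specializes x z.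
Proof.
by move=> /specializesP xy /specializesP yz; apply/specializesP => U /yz /xy.
Qed.

End Specialization.

Section StalkMap.
Variables (X : topologicalType) (O : ring_presheaf X) (F : mod_presheaf O).
Variables (x y : X) (xy : specializes x y).

Lemma specialize_in (U : opens X) : opens_set U y -> opens_set U x.
Proof. by move: U; apply/specializesP. Qed.

Definition ring_stalk_map (z : ring_stalk O y) : ring_stalk O x :=
  rgerm (specialize_in (sec_dom_in (repr z))) (sec_val (repr z)).

Definition mod_stalk_map (z : mod_stalk F y) : mod_stalk F x :=
  mgerm (specialize_in (sec_dom_in (repr z))) (sec_val (repr z)).

Lemma ring_stalk_mapE U (Uy : opens_set U y) (s : O U) :
  ring_stalk_map (rgerm Uy s) = rgerm (specialize_in Uy) s.
Proof.
have /eq_germ[V [Vz [VU [Vx ze]]]] := germ_repr (rgerm Uy s).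
by apply/eq_germ; exists V, Vz, VU; split=> //; apply: specialize_in.
Qed.

Lemma mod_stalk_mapE U (Uy : opens_set U y) (s : F U) :
  mod_stalk_map (mgerm Uy s) = mgerm (specialize_in Uy) s.
Proof.
have /eq_germ[V [Vz [VU [Vx ze]]]] := germ_repr (mgerm Uy s).
by apply/eq_germ; exists V, Vz, VU; split=> //; apply: specialize_in.
Qed.

Lemma ring_stalk_map_is_additive : zmod_morphism ring_stalk_map.
Proof.
move=> z w; case: (rgerm2P z w) => U Uy s t.
by rewrite rgermN rgermD !ring_stalk_mapE rgermN rgermD.
Qed.
Lemma ring_stalk_map_is_multiplicative : monoid_morphism ring_stalk_map.
Proof.
split=> [|z w].
  by rewrite (rgerm1 O (I : opens_set (Opens openT) y)) ring_stalk_mapE -rgerm1.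
by case: (rgerm2P z w) => U Uy s t; rewrite rgermM !ring_stalk_mapE rgermM.
Qed.
HB.instance Definition _ := GRing.isZmodMorphism.Build
  (ring_stalk O y) (ring_stalk O x) ring_stalk_map ring_stalk_map_is_additive.
HB.instance Definition _ := GRing.isMonoidMorphism.Build
  (ring_stalk O y) (ring_stalk O x) ring_stalk_map ring_stalk_map_is_multiplicative.

Lemma mod_stalk_map_is_linear : linear_for (ring_stalk_map \; *:%R) mod_stalk_map.
Proof.
move=> a z w; case: (rmmgermP a z w) => U Uy c s t /=.
by rewrite mgermZ mgermD !mod_stalk_mapE ring_stalk_mapE mgermZ mgermD.
Qed.
HB.instance Definition _ := GRing.isLinear.Build
  (ring_stalk O y) (mod_stalk F y) (mod_stalk F x) (ring_stalk_map \; *:%R)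
  mod_stalk_map mod_stalk_map_is_linear.

End StalkMap.

Section StructureSheaf.
Variable A : comPzRingType.
Implicit Types U V W : opens (Spec A).

(* Sections over [U] are the families of elements of the [A_p], for [p] in [U],
   that locally are given by a common fraction [a / b]. *)
Definition loc_fun U : Type := dprod (fun p : opens_set U => loc (val p)).

Definition locally_fraction U : set (loc_fun U) :=
  [set f | forall p : opens_set U, exists (V : opens (Spec A)) (a b : A),
     opens_set V (val p) /\
     forall q : opens_set U, opens_set V (val q) ->
       exists hb : ~ prime_set (val q) b, f q = frac a (Denom hb)].

Lemma locally_fraction_subring U : subring_closed (mem (@locally_fraction U)).
Proof.
have common (f g : loc_fun U) (op : forall p : Spec A, loc p -> loc p -> loc p)
    (num : A -> A -> A -> A -> A) :
    (forall (p : Spec A) (a b c d : A) (hb : ~ prime_set p b) (hd : ~ prime_set p d),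
       op p (frac a (Denom hb)) (frac c (Denom hd)) =
       frac (num a b c d) (denomM (Denom hb) (Denom hd))) ->
    locally_fraction f -> locally_fraction g ->
    @locally_fraction U (fun p => op _ (f p) (g p)).
  move=> opE ff gf p.
  have [V [a [b [Vp fE]]]] := ff p; have [W [c [d [Wp gE]]]] := gf p.
  exists (opensI V W), (num a b c d), (b * d); split=> // q [/fE[hb ->] /gE[hd ->]].
  exists (denomP (denomM (Denom hb) (Denom hd))).
  by rewrite opE; apply/eq_frac; exists (denom1 _).
split.
- rewrite inE => p; exists (Opens openT), 1, 1; split=> // q _.
  by exists (denomP (denom1 _)); apply/eq_frac; exists (denom1 _).
- move=> f g; rewrite !inE => ff gf.
  apply: (common f g (fun p x y => x - y) (fun a b c d => a * d - c * b)) => //.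
  move=> p a b c d hb hd; rewrite fracN fracD.
  by apply/eq_frac; exists (denom1 _) => /=; ring.
- move=> f g; rewrite !inE => ff gf.
  apply: (common f g (fun p x y => x * y) (fun a b c d => a * c)) => //.
  by move=> p a b c d hb hd; rewrite fracM.
Qed.

Definition spec_sec U : Type := @locally_fraction U.
HB.instance Definition _ U := SubChoice.on (spec_sec U).
HB.instance Definition _ U := GRing.SubChoice_isSubComPzRing.Build
  (loc_fun U) _ (spec_sec U) (@locally_fraction_subring U).

Section Restriction.
Variables (U V : opens (Spec A)) (UV : U `<=` V).

Lemma spec_incl_subproof (p : opens_set U) : val p \in opens_set V.
Proof. by rewrite inE; apply: UV; move: (valP p); rewrite inE. Qed.

Definition spec_incl (p : opens_set U) : opens_set V :=
  exist _ (val p) (spec_incl_subproof p).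

Lemma spec_res_subproof (f : spec_sec V) :
  (fun p => val f (spec_incl p)) \in @locally_fraction U.
Proof.
have := valP f; rewrite !inE => ff p.
have [W [a [b [Wp fE]]]] := ff (spec_incl p).
by exists W, a, b; split=> // q Wq; exact: (fE (spec_incl q) Wq).
Qed.

Definition spec_res (f : spec_sec V) : spec_sec U :=
  exist _ (fun p => val f (spec_incl p)) (spec_res_subproof f).

Lemma spec_res_is_additive : zmod_morphism spec_res.
Proof. by move=> f g; apply/val_inj. Qed.
Lemma spec_res_is_multiplicative : monoid_morphism spec_res.
Proof. by split=> [|f g]; apply/val_inj. Qed.
HB.instance Definition _ :=
  GRing.isZmodMorphism.Build (spec_sec V) (spec_sec U) spec_res spec_res_is_additive.
HB.instance Definition _ :=
  GRing.isMonoidMorphism.Build (spec_sec V) (spec_sec U) spec_res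
    spec_res_is_multiplicative.
End Restriction.

Lemma spec_res_id U (h : U `<=` U) s : spec_res h s = s.
Proof.
apply/val_inj; apply: functional_extensionality_dep => p /=.
by case: p => p pU; rewrite /spec_incl /=; congr (val s (exist _ _ _)); apply: bool_irrelevance.
Qed.
Lemma spec_res_comp U V W (h : U `<=` V) (k : V `<=` W) (l : U `<=` W) s :
  spec_res h (spec_res k s) = spec_res l s.
Proof.
apply/val_inj; apply: functional_extensionality_dep => p /=.
by congr (val s (exist _ _ _)); apply: bool_irrelevance.
Qed.

Definition spec_presheaf : ring_presheaf (Spec A) :=
  @RingPresheaf (Spec A) (fun U => spec_sec U) (fun U V h => spec_res h)
    spec_res_id spec_res_comp.

End StructureSheaf.

Definition opens_preimage (X Y : topologicalType) (f : X -> Y)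
    (fc : continuous f) (V : opens Y) : opens X :=
  Opens (open_comp (in1W fc) (opensP V)).

Lemma opens_preimageS (X Y : topologicalType) (f : X -> Y)
    (fc : continuous f) (U V : opens Y) :
  U `<=` V -> opens_preimage fc U `<=` opens_preimage fc V.
Proof. exact: preimage_subset. Qed.

(* An isomorphism of ringed spaces from some [Spec A] onto the open subspace
   [range aff_map] of [X]: a homeomorphism onto that subspace together with
   an isomorphism from the restriction of [O] to the direct image of the
   structure sheaf. *)
Record affine_open (X : topologicalType) (O : ring_presheaf X) := AffineOpen {
  aff_ring : comPzRingType;
  aff_map : Spec aff_ring -> X;
  aff_inj : injective aff_map;
  aff_continuous : continuous aff_map;
  aff_openmap : forall V, open V -> open (aff_map @` V);
  aff_iso : forall V : opens X, V `<=` range aff_map ->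
    {rmorphism O V -> spec_presheaf aff_ring (opens_preimage aff_continuous V)};
  aff_iso_bij : forall (V : opens X) (h : V `<=` range aff_map),
    bijective (aff_iso h);
  aff_iso_res : forall (U V : opens X) (UV : U `<=` V)
    (h : U `<=` range aff_map) (k : V `<=` range aff_map) (s : O V),
    aff_iso h (rp_res O UV s) =
    rp_res (spec_presheaf aff_ring) (opens_preimageS UV) (aff_iso k s) }.
Arguments aff_map {X O} a _ : rename.
Arguments aff_openmap {X O} a [V] _ : rename.
Arguments aff_iso {X O} a [V] _ : rename.

Record scheme := Scheme {
  sch_space :> topologicalType;
  sch_sheaf : ring_presheaf sch_space;
  sch_sheafP : is_sheaf (ab_of_ring sch_sheaf);
  sch_local : forall x, local_ring (ring_stalk sch_sheaf x);
  sch_affine : forall x : sch_space, exists W : affine_open sch_sheaf,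
    range (aff_map W) x }.

Definition noetherian_scheme (X : scheme) : Prop :=
  cover_compact [set: X] /\
  forall x : X, exists W : affine_open (sch_sheaf X),
    noetherian (aff_ring W) /\ range (aff_map W) x.

Section Coherent.
Variables (X : topologicalType) (O : ring_presheaf X) (F : mod_presheaf O).

(* Coherence is meant in the sense of an arbitrary ringed space: finite type,
   and finite type of the kernel of any morphism from a finite free module
   over an open subspace. *)

(* The morphism from [O_U^n] to the restriction of [F] to [U] given by [t] is
   an epimorphism of sheaves. *)
Definition generates (U : opens X) n (t : 'I_n -> F U) : Prop :=
  forall (V : opens X) (VU : V `<=` U) (s : F V) x, opens_set V x ->
  exists (W : opens X) (WV : W `<=` V), opens_set W x /\
  exists a : 'I_n -> O W,
    mp_res F WV s = \sum_(i < n) a i *: mp_res F (subset_trans WV VU) (t i).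

Definition finite_type : Prop :=
  forall x, exists (U : opens X) n (t : 'I_n -> F U), opens_set U x /\ generates t.

Definition is_relation (U : opens X) n (s : 'I_n -> F U)
    (V : opens X) (VU : V `<=` U) (c : 'I_n -> O V) : Prop :=
  \sum_(i < n) c i *: mp_res F VU (s i) = 0.

(* The kernel of the morphism from [O_U^n] to the restriction of [F] to [U]
   given by [s] is of finite type: near each point of [U] it is generated by
   finitely many of its sections [r]. *)
Definition kernel_finite_type (U : opens X) n (s : 'I_n -> F U) : Prop :=
  forall x, opens_set U x ->
  exists (V : opens X) (VU : V `<=` U) m (r : 'I_m -> 'I_n -> O V),
    [/\ opens_set V x, (forall j, is_relation s VU (r j)) &
     forall (W : opens X) (WV : W `<=` V) (c : 'I_n -> O W) y,
       is_relation s (subset_trans WV VU) c -> opens_set W y ->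
     exists (W' : opens X) (W'W : W' `<=` W), opens_set W' y /\
     exists a : 'I_m -> O W', forall i,
       rp_res O W'W (c i) =
       \sum_(j < m) a j * rp_res O (subset_trans W'W WV) (r j i)].

Definition coherent : Prop :=
  finite_type /\ forall (U : opens X) n (s : 'I_n -> F U), kernel_finite_type s.

End Coherent.

Record coherent_sheaf (X : scheme) := CoherentSheaf {
  coh_mod :> mod_presheaf (sch_sheaf X);
  coh_sheafP : is_sheaf (ab_of_mod coh_mod);
  coh_coherent : coherent coh_mod }.

Record lrposet := LRPoset {
  lr_disp : Order.disp_t;
  lr_point :> porderType lr_disp;
  lr_ring : lr_point -> comPzRingType;
  lr_map : forall x y : lr_point, (x <= y)%O -> {rmorphism lr_ring y -> lr_ring x};
  lr_map_id : forall (x : lr_point) (h : (x <= x)%O) a, lr_map h a = a;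
  lr_map_comp : forall (x y z : lr_point) (h : (x <= y)%O) (k : (y <= z)%O)
    (l : (x <= z)%O) a, lr_map h (lr_map k a) = lr_map l a;
  lr_local : forall x, local_ring (lr_ring x) }.

Record lr_iso (P Q : lrposet) := LRIso {
  lri_map :> P -> Q;
  lri_bij : bijective lri_map;
  lri_mono : {mono lri_map : x y / (x <= y)%O};
  lri_ring : forall x, {rmorphism lr_ring (lri_map x) -> lr_ring x};
  lri_ring_bij : forall x, bijective (lri_ring x);
  lri_natural : forall (x y : P) (h : (x <= y)%O) (k : (lri_map x <= lri_map y)%O) a,
    lri_ring x (lr_map k a) = lr_map h (lri_ring y a) }.

Definition specialization_display : Order.disp_t.
Proof. by constructor. Qed.

Definition sch_point (X : scheme) : Type := X.
HB.instance Definition _ X := Choice.on (sch_point X).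

Section SchemePoset.
Variable X : scheme.

(* [x <= y] when [y] belongs to the closure of [x]. *)
Definition sch_le (x y : sch_point X) : bool := `[< specializes (x : X) y >].

Lemma sch_le_refl : reflexive sch_le.
Proof. by move=> x; apply/asboolP/specializes_refl. Qed.
Lemma sch_le_trans : transitive sch_le.
Proof.
move=> y x z /asboolP xy /asboolP yz.
by apply/asboolP; apply: specializes_trans yz.
Qed.

Lemma spec_specializes (A : comPzRingType) (p q : Spec A) :
  specializes p q <-> p `<=` q.
Proof.
split=> [/specializesP pq a pa|pq].
  apply: contrapT => nqa; have Uo : open (~` vanishing [set a]) by exists [set a].
  have /= := pq (Opens Uo); apply; last by move=> _ ->.
  by move=> /(_ a erefl).
apply/specializesP => -[U [E UE]] /=; rewrite UE => nEq Ep; apply: nEq.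
exact: subset_trans pq.
Qed.

Lemma spec_le_anti (A : comPzRingType) (p q : Spec A) :
  specializes p q -> specializes q p -> p = q.
Proof.
move=> /spec_specializes pq /spec_specializes qp.
have e : prime_set p = prime_set q by apply/seteqP.
by case: p q e {pq qp} => p hp [q hq] /= e; subst q; congr PrimeIdeal; apply: Prop_irrelevance.
Qed.

Lemma sch_le_anti : antisymmetric sch_le.
Proof.
move=> x y /andP[/asboolP/specializesP xy /asboolP/specializesP yx].
have [W [p _ px]] := sch_affine x.
have Wo : open (range (aff_map W)) by apply/aff_openmap/openT.
have [q _ qy] : range (aff_map W) y by apply: (yx (Opens Wo)); exists p.
suff e : p = q by rewrite -px -qy e.
have sub (r r' : Spec (aff_ring W)) :
    (forall U : opens X, opens_set U (aff_map W r') -> opens_set U (aff_map W r)) ->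
    specializes r r'.
  move=> rr'; apply/specializesP => U Ur'.
  have /= [|r0 Ur0 /aff_inj <-//] := rr' (Opens (aff_openmap W (opensP U))).
  by exists r'.
by apply: spec_le_anti; apply: sub; rewrite px qy.
Qed.

HB.instance Definition _ := Order.Le_isPOrder.Build specialization_display
  (sch_point X) sch_le_refl sch_le_anti sch_le_trans.

Lemma sch_leP (x y : sch_point X) : (x <= y)%O -> specializes (x : X) y.
Proof. by move/asboolP. Qed.

Lemma sch_map_id (x : sch_point X) (h : (x <= x)%O) a :
  ring_stalk_map (O := sch_sheaf X) (sch_leP h) a = a.
Proof. by case: (rgermP a) => U Ux s; rewrite ring_stalk_mapE; congr rgerm; apply: Prop_irrelevance. Qed.

Lemma sch_map_comp (x y z : sch_point X) (h : (x <= y)%O) (k : (y <= z)%O)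
    (l : (x <= z)%O) a :
  ring_stalk_map (O := sch_sheaf X) (sch_leP h) (ring_stalk_map (sch_leP k) a) =
  ring_stalk_map (sch_leP l) a.
Proof.
by case: (rgermP a) => U Ux s; rewrite !ring_stalk_mapE; congr rgerm; apply: Prop_irrelevance.
Qed.

Definition sch_lrposet : lrposet :=
  @LRPoset specialization_display (sch_point X)
    (fun x => ring_stalk (sch_sheaf X) x) (fun x y h => ring_stalk_map (sch_leP h))
    sch_map_id sch_map_comp (@sch_local X).

End SchemePoset.

Section SpecPoset.
Variable A : comPzRingType.

Definition spec_le (p q : Spec A) : bool := `[< specializes p q >].

Lemma spec_le_refl : reflexive spec_le.
Proof. by move=> x; apply/asboolP/specializes_refl. Qed.
Lemma spec_le_trans : transitive spec_le.
Proof.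
move=> y x z /asboolP xy /asboolP yz.
by apply/asboolP; apply: specializes_trans yz.
Qed.
Lemma spec_le_antisym : antisymmetric spec_le.
Proof. by move=> p q /andP[/asboolP pq /asboolP qp]; apply: spec_le_anti. Qed.

HB.instance Definition _ := Order.Le_isPOrder.Build specialization_display
  (Spec A) spec_le_refl spec_le_antisym spec_le_trans.

Lemma spec_leP (p q : Spec A) : (p <= q)%O -> p `<=` q.
Proof. by move/asboolP/spec_specializes. Qed.

Lemma spec_map_id (p : Spec A) (h : (p <= p)%O) a : loc_map (spec_leP h) a = a.
Proof.
by case: (fracP a) => {}a s; rewrite loc_mapE; apply/eq_frac; exists (denom1 _).
Qed.

Lemma spec_map_comp (p q r : Spec A) (h : (p <= q)%O) (k : (q <= r)%O)
    (l : (p <= r)%O) a :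
  loc_map (spec_leP h) (loc_map (spec_leP k) a) = loc_map (spec_leP l) a.
Proof.
by case: (fracP a) => {}a s; rewrite !loc_mapE; apply/eq_frac; exists (denom1 _).
Qed.

Definition spec_lrposet : lrposet :=
  @LRPoset specialization_display (Spec A) (fun p => loc p)
    (fun p q h => loc_map (spec_leP h)) spec_map_id spec_map_comp (@loc_local A).

End SpecPoset.

Definition poset_closed (P : lrposet) (Z : set P) : Prop :=
  exists s : seq P, Z = [set y | exists2 x, x \in s & (x <= y)%O].

Definition poset_open (P : lrposet) (U : set P) : Prop := poset_closed (~` U).

Section SubPoset.
Variables (P : lrposet) (U : set P).

Definition sub_point : Type := U.
HB.instance Definition _ := Choice.on sub_point.

Definition sub_le (x y : sub_point) : bool := (val x <= val y)%O.
Lemma sub_le_refl : reflexive sub_le.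
Proof. by move=> x; apply: lexx. Qed.
Lemma sub_le_trans : transitive sub_le.
Proof. by move=> x y z; apply: le_trans. Qed.
Lemma sub_le_anti : antisymmetric sub_le.
Proof. by move=> x y /le_anti/val_inj. Qed.
HB.instance Definition _ := Order.Le_isPOrder.Build (lr_disp P) sub_point
  sub_le_refl sub_le_anti sub_le_trans.

Lemma sub_leP (x y : sub_point) : (x <= y)%O -> (val x <= val y)%O.
Proof. by []. Qed.

Definition sub_lrposet : lrposet :=
  @LRPoset (lr_disp P) sub_point (fun x => lr_ring (val x))
    (fun x y h => lr_map (sub_leP h)) (fun x h => lr_map_id _)
    (fun x y z h k l => lr_map_comp _ _ _) (fun x => lr_local (val x)).

End SubPoset.

Record psh (P : lrposet) := Psh {
  psh_at :> forall x : P, lmodType (lr_ring x);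
  psh_map : forall (x y : P) (h : (x <= y)%O),
    {linear psh_at y -> psh_at x | lr_map h \; *:%R};
  psh_map_id : forall (x : P) (h : (x <= x)%O) m, psh_map h m = m;
  psh_map_comp : forall (x y z : P) (h : (x <= y)%O) (k : (y <= z)%O)
    (l : (x <= z)%O) m, psh_map h (psh_map k m) = psh_map l m }.

Record psh_mor (P : lrposet) (G H : psh P) := PshMor {
  mor_at :> forall x : P, {linear G x -> H x};
  mor_natural : forall (x y : P) (h : (x <= y)%O) m,
    mor_at x (psh_map G h m) = psh_map H h (mor_at y m) }.

Definition psh_isomorphic (P : lrposet) (G H : psh P) : Prop :=
  exists (f : psh_mor G H) (g : psh_mor H G),
    (forall x, cancel (f x) (g x)) /\ (forall x, cancel (g x) (f x)).

Definition psh_restrict (P : lrposet) (U : set P) (G : psh P) : psh (sub_lrposet U) :=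
  @Psh (sub_lrposet U) (fun x => G (val x))
    (fun x y h => psh_map G (sub_leP h)) (fun x h => psh_map_id _)
    (fun x y z h k l => psh_map_comp _ _ _).

Section SpecializationFunctor.
Variables (X : scheme) (F : mod_presheaf (sch_sheaf X)).

Lemma stalks_map_id (x : sch_point X) (h : (x <= x)%O) m :
  mod_stalk_map (F := F) (sch_leP h) m = m.
Proof. by case: (mgermP m) => U Ux s; rewrite mod_stalk_mapE; congr mgerm; apply: Prop_irrelevance. Qed.

Lemma stalks_map_comp (x y z : sch_point X) (h : (x <= y)%O) (k : (y <= z)%O)
    (l : (x <= z)%O) m :
  mod_stalk_map (F := F) (sch_leP h) (mod_stalk_map (sch_leP k) m) =
  mod_stalk_map (sch_leP l) m.
Proof.
by case: (mgermP m) => U Ux s; rewrite !mod_stalk_mapE; congr mgerm; apply: Prop_irrelevance.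
Qed.

Definition specialization : psh (sch_lrposet X) :=
  @Psh (sch_lrposet X) (fun x => mod_stalk F x)
    (fun x y h => mod_stalk_map (F := F) (sch_leP h)) stalks_map_id stalks_map_comp.

End SpecializationFunctor.

Section LimRing.
Variable P : lrposet.

Definition compatible_ring : set (dprod (@lr_ring P)) :=
  [set s | forall (x y : P) (h : (x <= y)%O), lr_map h (s y) = s x].

Lemma compatible_ring_subring : subring_closed (mem compatible_ring).
Proof.
split; first by rewrite inE => x y h; rewrite [LHS]rmorph1.
  by move=> s t; rewrite !inE => sP tP x y h; rewrite [LHS]rmorphB sP tP.
by move=> s t; rewrite !inE => sP tP x y h; rewrite [LHS]rmorphM sP tP.
Qed.

Definition lim_ring : Type := compatible_ring.
HB.instance Definition _ := SubChoice.on lim_ring.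
HB.instance Definition _ := GRing.SubChoice_isSubComPzRing.Build
  (dprod (@lr_ring P)) _ lim_ring compatible_ring_subring.

Definition lim_ring_proj (x : P) (s : lim_ring) : lr_ring x := val s x.
Lemma lim_ring_proj_is_additive x : zmod_morphism (lim_ring_proj x).
Proof. by []. Qed.
Lemma lim_ring_proj_is_multiplicative x : monoid_morphism (lim_ring_proj x).
Proof. by []. Qed.
HB.instance Definition _ x := GRing.isZmodMorphism.Build lim_ring (lr_ring x)
  (lim_ring_proj x) (lim_ring_proj_is_additive x).
HB.instance Definition _ x := GRing.isMonoidMorphism.Build lim_ring (lr_ring x)
  (lim_ring_proj x) (lim_ring_proj_is_multiplicative x).

End LimRing.

Section LimModule.
Variables (P : lrposet) (G : psh P).

Definition compatible_mod : set (dprod (psh_at G)) :=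
  [set m | forall (x y : P) (h : (x <= y)%O), psh_map G h (m y) = m x].

Lemma compatible_mod_zmod : zmod_closed (mem compatible_mod).
Proof.
split; first by rewrite inE => x y h; rewrite [LHS]raddf0.
move=> s t; rewrite !inE => sP tP x y h.
by transitivity (psh_map G h (s y) - psh_map G h (t y)); [apply: raddfB | rewrite sP tP].
Qed.

Definition lim_mod : Type := compatible_mod.
HB.instance Definition _ := SubChoice.on lim_mod.
HB.instance Definition _ := GRing.SubChoice_isSubZmodule.Build
  (dprod (psh_at G)) _ lim_mod compatible_mod_zmod.

Lemma lim_scale_subproof (a : lim_ring P) (m : lim_mod) :
  (fun x => val a x *: val m x) \in compatible_mod.
Proof.
have := valP m; have := valP a; rewrite !inE => aP mP x y h.
by rewrite linearZ /= aP mP.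
Qed.
Definition lim_scale (a : lim_ring P) (m : lim_mod) : lim_mod :=
  exist _ (fun x => val a x *: val m x) (lim_scale_subproof a m).

Lemma lim_scaleA a b m : lim_scale a (lim_scale b m) = lim_scale (a * b) m.
Proof.
by apply/val_inj; apply: functional_extensionality_dep => x; apply: scalerA.
Qed.
Lemma lim_scale1 : left_id 1 lim_scale.
Proof.
by move=> m; apply/val_inj; apply: functional_extensionality_dep => x; apply: scale1r.
Qed.
Lemma lim_scaleDr : right_distributive lim_scale +%R.
Proof.
by move=> a m n; apply/val_inj; apply: functional_extensionality_dep => x; apply: scalerDr.
Qed.
Lemma lim_scaleDl m : {morph lim_scale^~ m : a b / a + b}.
Proof.
by move=> a b; apply/val_inj; apply: functional_extensionality_dep => x; apply: scalerDl.
Qed.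
HB.instance Definition _ := GRing.Zmodule_isLmodule.Build (lim_ring P) lim_mod
  lim_scaleA lim_scale1 lim_scaleDr lim_scaleDl.

Definition lim_proj (x : P) (m : lim_mod) : G x := val m x.
Lemma lim_proj_is_linear x : linear_for (lim_ring_proj x \; *:%R) (lim_proj x).
Proof. by []. Qed.
HB.instance Definition _ x := GRing.isLinear.Build (lim_ring P) lim_mod (G x)
  (lim_ring_proj x \; *:%R) (lim_proj x) (lim_proj_is_linear x).

End LimModule.

Section Tensor.
Variables (R S : comPzRingType) (f : {rmorphism R -> S}) (M : lmodType R).

(* A sequence of pairs stands for the sum of the corresponding pure tensors;
   [tensor] is the base change of [M] along [f], its additive group being the
   quotient of the formal sums by the smallest congruence making pure tensors
   biadditive and balanced over [R]. *)
Definition tsum : Type := seq (M * S).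
HB.instance Definition _ := Choice.on tsum.

Inductive tensor_rel : tsum -> tsum -> Prop :=
| TRefl u : tensor_rel u u
| TSym u v : tensor_rel u v -> tensor_rel v u
| TTrans u v w : tensor_rel u v -> tensor_rel v w -> tensor_rel u w
| TCat u u' v v' : tensor_rel u u' -> tensor_rel v v' ->
    tensor_rel (u ++ v) (u' ++ v')
| TComm u v : tensor_rel (u ++ v) (v ++ u)
| TZero s : tensor_rel [:: (0, s)] [::]
| TAddl m n s : tensor_rel [:: (m + n, s)] [:: (m, s); (n, s)]
| TAddr m s t : tensor_rel [:: (m, s + t)] [:: (m, s); (m, t)]
| TScale r m s : tensor_rel [:: (r *: m, s)] [:: (m, f r * s)].

Definition tensor_equiv (u v : tsum) : bool := `[< tensor_rel u v >].

Lemma tensor_equiv_refl : reflexive tensor_equiv.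
Proof. by move=> u; apply/asboolP/TRefl. Qed.
Lemma tensor_equiv_sym : symmetric tensor_equiv.
Proof. by move=> u v; apply/asboolP/asboolP; apply: TSym. Qed.
Lemma tensor_equiv_trans : transitive tensor_equiv.
Proof.
by move=> v u w /asboolP uv /asboolP vw; apply/asboolP; apply: TTrans vw.
Qed.

Canonical tensor_equivRel :=
  EquivRel tensor_equiv tensor_equiv_refl tensor_equiv_sym tensor_equiv_trans.

Definition tensor : Type := {eq_quot tensor_equiv}.
HB.instance Definition _ : EqQuotient _ tensor_equiv tensor := EqQuotient.on tensor.
HB.instance Definition _ := Choice.on tensor.

Definition tclass (u : tsum) : tensor := \pi_tensor u.

Lemma eq_tclass u v : tclass u = tclass v <-> tensor_rel u v.
Proof. by split=> [/eqmodP/asboolP//|e]; apply/eqmodP/asboolP. Qed.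

Lemma tclass_repr (z : tensor) : tclass (repr z) = z.
Proof. exact: reprK. Qed.
Lemma repr_tclass u : tensor_rel (repr (tclass u)) u.
Proof. by apply/eq_tclass; rewrite tclass_repr. Qed.

Definition topp (u : tsum) : tsum := [seq (- p.1, p.2) | p <- u].
Definition tscale (a : S) (u : tsum) : tsum := [seq (p.1, a * p.2) | p <- u].

Lemma tensor_rel_topp u v : tensor_rel u v -> tensor_rel (topp u) (topp v).
Proof.
elim=> {u v}; rewrite /topp.
- by move=> u; apply: TRefl.
- by move=> u v _; apply: TSym.
- by move=> u v w _ uv _ vw; apply: TTrans vw.
- by move=> u u' v v' _ uu' _ vv'; rewrite !map_cat; apply: TCat.
- by move=> u v; rewrite !map_cat; apply: TComm.
- by move=> s; rewrite /= oppr0; apply: TZero.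
- by move=> m n s; rewrite /= opprD; apply: TAddl.
- by move=> m s t; apply: TAddr.
- by move=> r m s; rewrite /= -scalerN; apply: TScale.
Qed.

Lemma tensor_rel_tscale a u v : tensor_rel u v -> tensor_rel (tscale a u) (tscale a v).
Proof.
elim=> {u v}; rewrite /tscale.
- by move=> u; apply: TRefl.
- by move=> u v _; apply: TSym.
- by move=> u v w _ uv _ vw; apply: TTrans vw.
- by move=> u u' v v' _ uu' _ vv'; rewrite !map_cat; apply: TCat.
- by move=> u v; rewrite !map_cat; apply: TComm.
- by move=> s; apply: TZero.
- by move=> m n s; apply: TAddl.
- by move=> m s t; rewrite /= mulrDr; apply: TAddr.
- by move=> r m s; rewrite /= mulrCA; apply: TScale.
Qed.

Definition tensor_zero : tensor := tclass [::].
Definition tensor_opp (z : tensor) : tensor := tclass (topp (repr z)).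
Definition tensor_add (z w : tensor) : tensor := tclass (repr z ++ repr w).
Definition tensor_scale (a : S) (z : tensor) : tensor := tclass (tscale a (repr z)).

Lemma tensor_oppE u : tensor_opp (tclass u) = tclass (topp u).
Proof. exact/eq_tclass/tensor_rel_topp/repr_tclass. Qed.
Lemma tensor_addE u v : tensor_add (tclass u) (tclass v) = tclass (u ++ v).
Proof. by apply/eq_tclass/TCat; apply: repr_tclass. Qed.
Lemma tensor_scaleE a u : tensor_scale a (tclass u) = tclass (tscale a u).
Proof. exact/eq_tclass/tensor_rel_tscale/repr_tclass. Qed.

Lemma tensor_addA : associative tensor_add.
Proof.
move=> x y z; rewrite -(tclass_repr x) -(tclass_repr y) -(tclass_repr z).
by rewrite !tensor_addE catA.
Qed.
Lemma tensor_addC : commutative tensor_add.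
Proof. by move=> x y; apply/eq_tclass/TComm. Qed.
Lemma tensor_add0 : left_id tensor_zero tensor_add.
Proof. by move=> x; rewrite -(tclass_repr x) tensor_addE. Qed.
Lemma tensor_addN : left_inverse tensor_zero tensor_opp tensor_add.
Proof.
move=> x; rewrite -(tclass_repr x) tensor_oppE tensor_addE; apply/eq_tclass.
elim: (repr x) => [|[m s] u IH]; first exact: TRefl.
apply: (@TTrans _ ([:: (- m, s); (m, s)] ++ (topp u ++ u))); last first.
  apply: (@TTrans _ ([::] ++ [::]) [::]); last exact: TRefl.
  by apply: TCat IH; apply: TTrans (TZero s); rewrite -(addNr m); exact/TSym/TAddl.
change (tensor_rel ([:: (- m, s)] ++ (topp u ++ ([:: (m, s)] ++ u)))
                   ([:: (- m, s)] ++ ([:: (m, s)] ++ (topp u ++ u)))).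
apply: TCat; first exact: TRefl.
by rewrite !catA; apply: TCat; [apply: TComm | apply: TRefl].
Qed.

HB.instance Definition _ := GRing.isZmodule.Build tensor
  tensor_addA tensor_addC tensor_add0 tensor_addN.

Lemma tclassD u v : tclass u + tclass v = tclass (u ++ v).
Proof. exact: tensor_addE. Qed.

Lemma tensor_scaleA a b z : tensor_scale a (tensor_scale b z) = tensor_scale (a * b) z.
Proof.
rewrite -(tclass_repr z) !tensor_scaleE /tscale -map_comp.
by congr tclass; apply: eq_map => p /=; rewrite mulrA.
Qed.
Lemma tensor_scale1 : left_id 1 tensor_scale.
Proof.
move=> z; rewrite -(tclass_repr z) tensor_scaleE /tscale.
by congr tclass; rewrite -[RHS]map_id; apply: eq_map => -[m s] /=; rewrite mul1r.
Qed.
Lemma tensor_scaleDr : right_distributive tensor_scale +%R.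
Proof.
move=> a z w; rewrite -(tclass_repr z) -(tclass_repr w).
by rewrite tclassD !tensor_scaleE tclassD /tscale map_cat.
Qed.
Lemma tensor_scaleDl z : {morph tensor_scale^~ z : a b / a + b}.
Proof.
move=> a b /=; rewrite -(tclass_repr z) !tensor_scaleE tclassD; apply/eq_tclass.
elim: (repr z) => [|[m s] u IH]; first exact: TRefl.
apply: (@TTrans _ ([:: (m, a * s); (m, b * s)] ++ (tscale a u ++ tscale b u))).
  rewrite -[tscale _ _]/([:: (m, (a + b) * s)] ++ tscale (a + b) u).
  by apply: TCat IH; rewrite mulrDl; apply: TAddr.
change (tensor_rel ([:: (m, a * s)] ++ ([:: (m, b * s)] ++ (tscale a u ++ tscale b u)))
                   ([:: (m, a * s)] ++ (tscale a u ++ ([:: (m, b * s)] ++ tscale b u)))).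
apply: TCat; first exact: TRefl.
by rewrite !catA; apply: TCat; [apply: TComm | apply: TRefl].
Qed.
HB.instance Definition _ := GRing.Zmodule_isLmodule.Build S tensor
  tensor_scaleA tensor_scale1 tensor_scaleDr tensor_scaleDl.

(* The [S]-linear map sending a pure tensor [(m, s)] to [s *: g m], for an
   [f]-semilinear [g]. *)
Section Lift.
Variables (N : lmodType S) (g : {linear M -> N | f \; *:%R}).

Definition tsum_lift (u : tsum) : N := \sum_(p <- u) p.2 *: g p.1.
Definition tensor_lift (z : tensor) : N := tsum_lift (repr z).

Lemma tsum_lift_rel u v : tensor_rel u v -> tsum_lift u = tsum_lift v.
Proof.
rewrite /tsum_lift; elim=> {u v} //.
- by move=> u v w _ -> _ ->.
- by move=> u u' v v' _ uu' _ vv'; rewrite !big_cat uu' vv'.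
- by move=> u v; rewrite !big_cat /= addrC.
- by move=> s; rewrite big_seq1 big_nil /= raddf0 scaler0.
- by move=> m n s; rewrite [RHS]big_cons !big_seq1 /= raddfD scalerDr.
- by move=> m s t; rewrite [RHS]big_cons !big_seq1 /= scalerDl.
- by move=> r m s; rewrite !big_seq1 /= linearZ /= scalerA mulrC.
Qed.

Lemma tensor_liftE u : tensor_lift (tclass u) = tsum_lift u.
Proof. exact/tsum_lift_rel/repr_tclass. Qed.

Lemma tensor_lift_is_linear : linear tensor_lift.
Proof.
move=> a z w; rewrite -(tclass_repr z) -(tclass_repr w).
rewrite [a *: _]tensor_scaleE tclassD !tensor_liftE /tsum_lift big_cat big_map.
by rewrite scaler_sumr; congr (_ + _); apply: eq_bigr => p _; rewrite scalerA.
Qed.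
HB.instance Definition _ := GRing.isLinear.Build S tensor N *:%R
  tensor_lift tensor_lift_is_linear.

End Lift.
End Tensor.

Section T.
Variables (P : lrposet) (G : psh P) (x : P).

(* [x |-> T_at G x] is the base change to the local rings of the limit of [G]
   over the whole of [P]; for an open subposet [U], it is applied to the
   restriction of [G] to [U]. *)
Definition T_at : lmodType (lr_ring x) := tensor (@lim_ring_proj P x) (lim_mod G).

Definition T_can : T_at -> G x := tensor_lift (@lim_proj P G x).

End T.
Arguments T_can {P} G x _.

Section Admissible.
Variables (P : lrposet) (G : psh P).

Definition open_covering (I : Type) (U : I -> set P) : Prop :=
  (forall i, poset_open (U i)) /\ forall x, exists i, U i x.

Definition T_can_iso (U : set P) : Prop :=
  forall x : sub_lrposet U, bijective (T_can (psh_restrict U G) x).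

Definition quasi_admissible : Prop :=
  exists (I : Type) (U : I -> set P),
    open_covering U /\ forall i, T_can_iso (U i).

(* The isomorphism is one of locally ringed posets; no compatibility with the
   projections of the limit ring is imposed. *)
Definition affine_noetherian (Q : lrposet) : Prop :=
  noetherian (lim_ring Q) /\ inhabited (lr_iso Q (spec_lrposet (lim_ring Q))).

Definition admissible : Prop :=
  exists (I : Type) (U : I -> set P),
    [/\ open_covering U, (forall i, T_can_iso (U i)),
        (forall i, affine_noetherian (sub_lrposet (U i))) &
        forall i, finitely_generated (lim_mod (psh_restrict (U i) G))].

End Admissible.

(* Main.v *)
From HB Require Import structures.
From mathcomp Require Import all_boot all_order all_algebra ring.
From mathcomp Require Import boolp classical_sets topology.
Require Import Defs.

Set Implicit Arguments.
Unset Strict Implicit.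
Unset Printing Implicit Defensive.

Import Order.TTheory GRing.Theory.

Local Open Scope classical_set_scope.
Local Open Scope ring_scope.

(** Coherent sheaves and admissible presheaves are compared through a local property of a
    presheaf of modules [G] on the points of [X] ([locally_presented]): near every point
    there is a chart with noetherian ring [A] on which [G] consists of the localizations
    of a module [M = A^n / K].

    A coherent sheaf has this property because its definition can be read on germs
    ([coherent_presented]). An admissible presheaf has it because the limit over a member
    of the covering, being finitely generated over a noetherian ring, has a finite
    presentation, and base change to the stalks is right exact ([tensor_relations],
    [limit_presented]).

    The converse implications rest on one fact. A compatible family of elements of the
    localizations of [M] is only constrained along specializations, and yet if it vanishes
    at [p] then it vanishes near [p] ([vanish_near]). Indeed [M] has a filtration with
    quotients [A / P_i], for finitely many primes [P_i], and an element of a localization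
    of [M] is zero as soon as it is zero at those [P_i] at which it can be localized
    further ([prime_detection]). The family vanishes at the [P_i] contained in [p], and
    a suitable neighbourhood of [p] avoids the closures of the others.

    It follows that the compatible families on the basic open set of [f] are the elements
    of [M_f] ([family_frac]), and those of local rings the elements of [A_f]. Hence this
    basic open set is affine noetherian, the limit of [G] over it is finitely generated,
    and this limit localizes to [G]; such open sets make [G] admissible
    ([presented_admissible]).

    It also follows that a compatible family is determined near a point by its value at
    that point. The compatible families over the open sets form a sheaf, because open sets
    are stable under generization ([fam_is_sheaf]); its stalks are therefore the modules
    of [G] ([stalk_val_bij]), and it is coherent because [A] is noetherian
    ([fam_finite_type], [fam_kernel_finite_type]). *)

(** * Noetherian modules and prime filtrations *)

Section Submodules.
Variables (A : comPzRingType) (M : lmodType A).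
Implicit Types N K : set M.

Definition is_submod N : Prop :=
  [/\ N 0, forall u v, N u -> N v -> N (u + v) & forall a u, N u -> N (a *: u)].

Definition fg_submod N : Prop :=
  exists n (g : 'I_n -> M), (forall i, N (g i)) /\
    forall v, N v -> exists c : 'I_n -> A, v = \sum_(i < n) c i *: g i.

Definition noeth_mod : Prop := forall N, is_submod N -> fg_submod N.

Lemma submod_sum N (I : finType) (F : I -> M) :
  is_submod N -> (forall i, N (F i)) -> N (\sum_i F i).
Proof. by move=> [N0 ND _] NF; elim/big_ind: _. Qed.

Lemma submodB N u v : is_submod N -> N u -> N v -> N (u - v).
Proof. by move=> [_ ND NZ] Nu Nv; apply: ND => //; rewrite -scaleN1r; apply: NZ. Qed.

Lemma submod0 : is_submod [set 0].
Proof.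
by split=> //= [u v -> ->|a u ->]; rewrite ?addr0 ?scaler0.
Qed.

Lemma span_submod n (g : 'I_n -> M) :
  is_submod [set v | exists c : 'I_n -> A, v = \sum_i c i *: g i].
Proof.
split=> /= [|_ _ [c ->] [d ->]|a _ [c ->]].
- by exists (fun=> 0); rewrite big1 // => i _; rewrite scale0r.
- exists (fun i => c i + d i); rewrite -big_split; apply: eq_bigr => i _.
  by rewrite scalerDl.
- exists (fun i => a * c i); rewrite scaler_sumr; apply: eq_bigr => i _.
  by rewrite scalerA.
Qed.

Lemma span_mem n (g : 'I_n -> M) j : exists c : 'I_n -> A, g j = \sum_i c i *: g i.
Proof.
exists (fun i => (i == j)%:R); rewrite (bigD1 j) //= eqxx scale1r big1 ?addr0 //.
by move=> i /negbTE ->; rewrite scale0r.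
Qed.

Hypothesis noethM : noeth_mod.

(** Otherwise there is a strictly increasing chain in [F]; its union is finitely
    generated, hence reached at a finite stage. *)
Lemma max_submod (F : set (set M)) :
  (forall N, F N -> is_submod N) -> (exists N, F N) ->
  exists2 N, F N & forall N', F N' -> N `<=` N' -> N' `<=` N.
Proof.
move=> Fsub [N0 FN0]; apply: contrapT => noMax.
have grow (N : {N | F N}) : {N' : {N | F N} |
    sval N `<=` sval N' /\ ~ sval N' `<=` sval N}.
  case: N => N FN; apply/cid; apply: contrapT => no; apply: noMax; exists N => // N' FN' sNN'.
  by apply: contrapT => nN'N; apply: no; exists (exist _ N' FN').
pose next (N : {N | F N}) : {N | F N} := sval (grow N).
pose chain k : {N | F N} := iter k next (exist _ N0 FN0).
have mono i j : (i <= j)%N -> sval (chain i) `<=` sval (chain j).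
  elim: j => [|j IH]; first by rewrite leqn0 => /eqP ->.
  rewrite leq_eqVlt => /predU1P[-> //|/IH sub] v /sub.
  by have [/(_ v)] := svalP (grow (chain j)).
pose U := [set v | exists k, sval (chain k) v].
have chS k : is_submod (sval (chain k)) by apply: Fsub; apply: svalP.
have Usub : is_submod U.
  split=> [|u v [i iu] [j jv]|a u [i iu]].
  - by exists 0; have [] := chS 0.
  - exists (maxn i j); have [_ + _] := chS (maxn i j).
    by apply; [apply: (mono i) | apply: (mono j)] => //; rewrite ?leq_maxl ?leq_maxr.
  - by exists i; have [_ _ +] := chS i; apply.
have [n [g [/choice[h gh] gen]]] := noethM Usub.
pose k := (\max_(i < n) h i)%N.
have [_] := svalP (grow (chain k)); apply => v kv.
have [c ->] : exists c : 'I_n -> A, v = \sum_i c i *: g i by apply: gen; exists k.+1.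
apply: submod_sum => // i; have [_ _ +] := chS k; apply.
by apply: (mono (h i)); [apply: leq_bigmax | apply: gh].
Qed.

End Submodules.

Section Noetherian.
Variable A : comPzRingType.
Hypothesis noethA : noetherian A.

Lemma ideal_fg (I : set A) : is_ideal I ->
  exists n (g : 'I_n -> A), (forall i, I (g i)) /\
    forall a, I a -> exists c : 'I_n -> A, a = \sum_(i < n) c i * g i.
Proof.
move=> /noethA[n [g gP]]; exists n, g; split=> [i|a /gP//].
by apply/gP; have := @span_mem A A^o n g i.
Qed.

Lemma noeth_reg : noeth_mod A^o.
Proof. by move=> N [N0 ND NZ]; apply: (@ideal_fg N); split. Qed.

(** The leading coordinates of the vectors of a submodule form an ideal, and those
    with zero leading coordinate a submodule of a smaller free module. *)
Lemma noeth_row n : noeth_mod 'rV[A]_n.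
Proof.
elim: n => [|n IH] N NS; have [N0 ND NZ] := NS.
  exists 0, (fun=> 0); split=> // v _; exists (fun=> 0).
  by rewrite big_ord0; apply/rowP; case.
pose I : set A := [set a | exists2 v : 'rV[A]_n.+1, N v & v ord0 ord0 = a].
have II : is_ideal I.
  split=> [|_ _ [u Nu <-] [v Nv <-]|a _ [u Nu <-]].
  - by exists 0; rewrite ?mxE.
  - by exists (u + v); [apply: ND | rewrite mxE].
  - by exists (a *: u); [apply: NZ | rewrite mxE].
have [k [g [Ig gen]]] := ideal_fg II.
have /choice[u uP] : forall i, exists v : 'rV[A]_n.+1, N v /\ v ord0 ord0 = g i.
  by move=> i; have [v] := Ig i; exists v.
have Nu i : N (u i) by have [] := uP i.
have ug i : u i ord0 ord0 = g i by have [] := uP i.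
pose N' : set 'rV[A]_n := [set w | N (row_mx (0 : 'rV_1) w)].
have N'S : is_submod N'.
  split=> [|v w Nv Nw|a w Nw]; rewrite /N' /=.
  - by rewrite row_mx0.
  - by rewrite -[0](addr0 0) -add_row_mx; apply: ND.
  - by rewrite -(scaler0 _ a) -scale_row_mx; apply: NZ.
have [l [h [Nh genh]]] := IH _ N'S.
pose G (i : 'I_(k + l)) : 'rV[A]_n.+1 :=
  match split i with inl i => u i | inr j => row_mx (0 : 'rV_1) (h j) end.
exists (k + l)%N, G; split=> [i|v Nv].
  by rewrite /G; case: split => j; [apply: Nu | apply: Nh].
have [c cE] : exists c : 'I_k -> A, v ord0 ord0 = \sum_i c i * g i.
  by apply: gen; exists v.
pose w : 'rV[A]_(1 + n) := v - \sum_i c i *: u i.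
have Nw : N w.
  rewrite /w -scaleN1r; apply: ND => //; apply: (NZ).
  by apply: submod_sum => // i; apply: NZ.
have wE : w = row_mx 0 (rsubmx w).
  rewrite -[LHS]hsubmxK; congr row_mx; apply/rowP => i; rewrite ord1 !mxE.
  have -> : lshift n (ord0 : 'I_1) = ord0 by apply/val_inj.
  rewrite cE summxE -sumrB big1 // => j _.
  by rewrite mxE ug subrr.
have [d dE] : exists d : 'I_l -> A, rsubmx w = \sum_i d i *: h i.
  by apply: genh; rewrite /N' /= -wE.
exists (fun i => match split i with inl i => c i | inr j => d j end).
rewrite big_split_ord /=.
have -> : v = \sum_i c i *: u i + w by rewrite /w addrC subrK.
congr (_ + _); first by apply: eq_bigr => i _; rewrite /G; case: split_ordP => j /eqP;
  rewrite ?eq_lshift ?eq_lrshift // => /eqP ->.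
rewrite wE dE; transitivity (\sum_i d i *: row_mx (0 : 'rV[A]_1) (h i)).
  elim/big_rec2: _ => [|i y z _ <-]; first by rewrite row_mx0.
  by rewrite scale_row_mx scaler0 add_row_mx addr0.
by apply: eq_bigr => i _; rewrite /G; case: split_ordP => j /eqP;
  rewrite ?eq_rshift ?eq_rlshift // => /eqP ->.
Qed.

Section Filtration.
Variables (M : lmodType A) (noethM : noeth_mod M) (K : set M).
Hypothesis subK : is_submod K.

(** A chain of submodules from [K] up to the given one, each step being cyclic modulo
    the previous one with annihilator a prime [P], hence isomorphic to [A / P]; the
    primes are listed from the top. *)
Inductive prime_filt : set M -> seq (Spec A) -> Prop :=
| PFnil : prime_filt K [::]
| PFcons N x (P : Spec A) s : prime_filt N s ->
    (forall a, prime_set P a <-> N (a *: x)) ->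
    prime_filt [set y | exists a, N (y - a *: x)] (P :: s).

Lemma prime_filt_submod N s : prime_filt N s -> is_submod N /\ K `<=` N.
Proof.
elim=> {N s} [|N x P s _ [[N0 ND NZ] KN] _]; first by split.
split; last by move=> y /KN Ny; exists 0; rewrite scale0r subr0.
split=> [|u v [a au] [b bv]|c u [a au]] /=.
- by exists 0; rewrite scale0r subr0.
- by exists (a + b); rewrite scalerDl opprD addrACA; apply: ND.
- by exists (c * a); rewrite -scalerA -scalerBr; apply: NZ.
Qed.

(** A maximal filtered submodule is everything: otherwise a maximal annihilator in
    the quotient is prime and extends the filtration. *)
Lemma prime_filt_ex : exists s, prime_filt setT s.
Proof.
have [N [s fN] Nmax] : exists2 N, (exists s, prime_filt N s) &
    forall N', (exists s, prime_filt N' s) -> N `<=` N' -> N' `<=` N.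
  apply: (max_submod noethM); last by exists K, [::]; apply: PFnil.
  by move=> N [s /prime_filt_submod[]].
have [NS _] := prime_filt_submod fN; have [N0 ND NZ] := NS.
suff NT : N = setT by exists s; rewrite -NT.
apply/seteqP; split=> // x _; apply: contrapT => nNx.
pose ann (y : M) : set A^o := [set a : A | N (a *: y)].
have [_ [y nNy ->] ymax] : exists2 J, (exists2 y, ~ N y & J = ann y) &
    forall J', (exists2 y, ~ N y & J' = ann y) -> J `<=` J' -> J' `<=` J.
  apply: (max_submod noeth_reg); last by exists (ann x), x.
  move=> _ [y _ ->]; rewrite /ann; split=> [|a b|a b] /=.
  - by rewrite scale0r.
  - by rewrite scalerDl; apply: ND.
  - by rewrite -[a *: b]/(a * b) -scalerA; apply: NZ.
have primeY : is_prime_ideal (ann y : set A).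
  split; first split.
  - by rewrite /ann /= scale0r.
  - by move=> a b; rewrite /ann /= scalerDl; apply: ND.
  - by move=> a b; rewrite /ann /= -scalerA; apply: NZ.
  - by rewrite /ann /= scale1r.
  move=> a b; rewrite /ann /= => Nab; have [Nb|nNb] := pselect (N (b *: y)); [by right|left].
  apply: (ymax (ann (b *: y))); first by exists (b *: y).
    by move=> c; rewrite /ann /= scalerA mulrC -scalerA; apply: NZ.
  by rewrite /ann /= scalerA.
have sub : [set z | exists a, N (z - a *: y)] `<=` N.
  apply: Nmax; last by move=> z Nz; exists 0; rewrite scale0r subr0.
  by exists (PrimeIdeal primeY :: s); apply: PFcons.
by apply: nNy; apply: sub; exists 1; rewrite scale1r subrr.
Qed.

(** Go down the filtration. A step with quotient [A / P] is crossed by an element of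
    [S] lying in [P], if there is one; otherwise [m] is killed modulo [K] by some [a]
    outside [P], and [A / P] being a domain, [m] already lies one step below. *)
Lemma prime_filt_kill N s (S : set A) (m : M) :
  prime_filt N s -> S 1 -> (forall a b, S a -> S b -> S (a * b)) -> N m ->
  (forall P, P \in s -> (forall a, S a -> ~ prime_set P a) ->
     exists2 a, ~ prime_set P a & K (a *: m)) ->
  exists2 a, S a & K (a *: m).
Proof.
move=> fN S1 SM; elim: fN m => {N s} [|N x P s fN IH xP] m.
  by move=> Km _; exists 1 => //; rewrite scale1r.
have [[N0 ND NZ] KN] := prime_filt_submod fN; have [_ _ KZ] := subK.
move=> [b /= Nb] kill.
have [[c Sc Pc]|disj] := pselect (exists2 c, S c & prime_set P c).
  have [|Q Qs QS|d Sd Kd] := IH (c *: m).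
  - rewrite -(subrK (c *: (b *: x)) (c *: m)) -scalerBr; apply: ND; first exact: NZ.
    by rewrite scalerA mulrC -scalerA; apply: NZ; apply/xP.
  - have [|a Pa Ka] := kill Q _ QS; first by rewrite inE Qs orbT.
    by exists a => //; rewrite scalerA mulrC -scalerA; apply: KZ.
  - by exists (d * c); [apply: SM | rewrite -scalerA].
apply: (IH m); last by move=> Q Qs; apply: kill; rewrite inE Qs orbT.
have [||a nPa Ka] := kill P; first by rewrite inE eqxx.
  by move=> a Sa Pa; apply: disj; exists a.
have : prime_set P (a * b).
  apply/xP; rewrite -scalerA -[_ *: _](subKr (a *: m)); apply: submodB => //.
    exact: KN.
  by rewrite -scalerBr; apply: NZ.
have [_ _ PM] := primeP P; case/PM => // /xP Nbx.
by rewrite -(subrK (b *: x) m); apply: ND.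
Qed.

(** Whether an element of [M / K] dies in a localization is detected by finitely many
    localizations at primes, which do not depend on the element. *)
Lemma prime_detection : exists s : seq (Spec A), forall (S : set A) (m : M),
  S 1 -> (forall a b, S a -> S b -> S (a * b)) ->
  (forall P, P \in s -> (forall a, S a -> ~ prime_set P a) ->
     exists2 a, ~ prime_set P a & K (a *: m)) ->
  exists2 a, S a & K (a *: m).
Proof.
have [s fs] := prime_filt_ex; exists s => S m S1 SM.
exact: (prime_filt_kill fs).
Qed.

End Filtration.

Lemma ideal_reg (I : set A) : is_ideal I -> @is_submod A A^o I.
Proof. by case. Qed.

(** Detection in [A / I], for the powers of [f]. This description of the radical plays
    the part of the quasi-compactness of the basic open set of [f]. *)
Lemma radical_pow (I : set A) f : is_ideal I ->
  (forall q : Spec A, ~ prime_set q f -> exists2 a, I a & ~ prime_set q a) ->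
  exists e, I (f ^+ e).
Proof.
move=> II nI; have [s sP] := prime_detection noeth_reg (ideal_reg II).
have [||P _ PS|_ [e ->]] := sP [set a | exists e, a = f ^+ e] (1 : A).
- by exists 0.
- by move=> _ _ [i ->] [j ->]; exists (i + j)%N; rewrite exprD.
- have [|a Ia nPa] := nI P; first by apply: PS; exists 1; rewrite expr1.
  by exists a => //; rewrite -[_ *: _]/(a * 1) mulr1.
- by rewrite -[_ *: _]/(f ^+ e * 1) mulr1 => If; exists e.
Qed.

Lemma prime_compl1 (q : Spec A) : ~ prime_set q 1.
Proof. by have [] := primeP q. Qed.

Lemma prime_complM (q : Spec A) a b :
  ~ prime_set q a -> ~ prime_set q b -> ~ prime_set q (a * b).
Proof. by move=> na nb; have [_ _ /[apply]] := primeP q; case. Qed.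

Lemma prime_complMl (q : Spec A) a b : ~ prime_set q (a * b) -> ~ prime_set q a.
Proof. by have [[_ _ qM] _ _] := primeP q => + qa; apply; rewrite mulrC; apply: qM. Qed.

Lemma prime_complMr (q : Spec A) a b : ~ prime_set q (a * b) -> ~ prime_set q b.
Proof. by rewrite mulrC => /prime_complMl. Qed.

Lemma prime_complX (q : Spec A) a e : ~ prime_set q a -> ~ prime_set q (a ^+ e).
Proof.
move=> na; elim: e => [|e IH]; first exact: prime_compl1.
by rewrite exprS; apply: prime_complM.
Qed.

(** Detection for the element [1] of [A / I] and the complement of [q]. *)
Lemma minimal_primes (I : set A) : is_ideal I -> exists s : seq (Spec A),
  forall q : Spec A, I `<=` q <-> exists P, [/\ P \in s, I `<=` P & P `<=` q].
Proof.
move=> II; have [s sP] := prime_detection noeth_reg (ideal_reg II).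
exists s => q; split=> [Iq|[P [_ IP Pq] a /IP /Pq //]]; apply: contrapT => noP.
have [||P Ps PS|a nqa] := sP [set a | ~ prime_set q a] (1 : A).
- exact: prime_compl1.
- by move=> a b; apply: prime_complM.
- apply: contrapT => nIP; apply: noP; exists P; split=> // a.
    move=> Ia; apply: contrapT => nPa; apply: nIP; exists a => //.
    by rewrite -[_ *: _]/(a * 1) mulr1.
  by move=> Pa; apply: contrapT => nqa; apply: (PS a).
- by rewrite -[_ *: _]/(a * 1) mulr1 => /Iq.
Qed.

(** Take a product of elements outside [p], one from each of the primes. The basic open
    set of [h] is a neighbourhood of [p] disjoint from their closures. *)
Lemma avoid_primes (p : Spec A) (s : seq (Spec A)) : exists2 h, ~ prime_set p h &
  forall P, P \in s -> ~ (P `<=` p) -> prime_set P h.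
Proof.
elim: s => [|P s [h nph hP]]; first by exists 1 => //; apply: prime_compl1.
have [Pp|nPp] := pselect (P `<=` p).
  by exists h => // Q; rewrite inE => /predU1P[-> //|]; apply: hP.
have /existsNP[a /not_implyP[Pa npa]] := nPp.
exists (a * h); first exact: prime_complM.
move=> Q; have [[_ _ QM] _ _] := primeP Q; rewrite inE => /predU1P[-> _|Qs nQp].
  by have [[_ _ PM] _ _] := primeP P; rewrite mulrC; apply: PM.
by apply: QM; apply: hP.
Qed.

End Noetherian.


(** * Presented presheaves over a noetherian chart *)

(** A piece of a locally ringed poset which is the poset of primes of a noetherian ring.
    The local rings are only asked to satisfy the axioms of a localization, so that the
    same statements cover stalks of sheaves and rings of fractions. *)
Record chart (P : lrposet) := Chart {
  ch_ring : comPzRingType;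
  ch_noeth : noetherian ch_ring;
  ch_map :> Spec ch_ring -> P;
  ch_le : forall p q, (ch_map p <= ch_map q)%O <-> p `<=` q;
  ch_down : forall x q, (x <= ch_map q)%O -> exists p, ch_map p = x;
  ch_sec : forall p, {rmorphism ch_ring -> lr_ring (ch_map p)};
  ch_nat : forall p q (h : (ch_map p <= ch_map q)%O) a,
    lr_map h (ch_sec q a) = ch_sec p a;
  ch_unit : forall (p : Spec ch_ring) a, ~ prime_set p a ->
    exists b, b * ch_sec p a = 1;
  ch_frac : forall (p : Spec ch_ring) x, exists a s,
    ~ prime_set p s /\ ch_sec p s * x = ch_sec p a;
  ch_ker : forall (p : Spec ch_ring) a, ch_sec p a = 0 ->
    exists2 s, ~ prime_set p s & s * a = 0 }.

Arguments ch_noeth {P} c [I] _ : rename.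
Arguments ch_sec {P} c p : rename.
Arguments ch_le {P} c p q : rename.
Arguments ch_down {P} c [x q] _ : rename.
Arguments ch_unit {P} c [p a] _ : rename.
Arguments ch_frac {P} c p _ : rename.
Arguments ch_ker {P} c [p a] _ : rename.

Section RingPsh.
Variable P : lrposet.

Definition ring_psh_at (x : P) : lmodType (lr_ring x) := (lr_ring x)^o.

Definition ring_psh_map (x y : P) (h : (x <= y)%O) :
  ring_psh_at y -> ring_psh_at x := lr_map h.

Lemma ring_psh_map_is_linear (x y : P) (h : (x <= y)%O) :
  linear_for (lr_map h \; *:%R) (ring_psh_map h).
Proof. by move=> a u v; rewrite /ring_psh_map [LHS]rmorphD rmorphM. Qed.

HB.instance Definition _ x y h := GRing.isLinear.Build (lr_ring y)
  (ring_psh_at y) (ring_psh_at x) (lr_map h \; *:%R) (@ring_psh_map x y h)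
  (ring_psh_map_is_linear h).

Definition ring_psh : psh P := @Psh P ring_psh_at
  (fun x y h => @ring_psh_map x y h) (@lr_map_id P) (@lr_map_comp P).

End RingPsh.

Section Chart.
Variables (P : lrposet) (c : chart P).
Local Notation A := (ch_ring c).
Local Notation sig := (ch_sec c).
Implicit Types (p q : Spec A) (f h s u : A).

(** Sections are indexed by the primes of the chart, and not by the points of [P], so
    that the elements of [A] define sections without being extended off the chart. *)
Definition family (G : psh P) := forall p, G (c p).

Lemma ch_inj : injective c.
Proof.
move=> p q pq; apply: spec_le_anti; apply/spec_specializes; apply: (proj1 (ch_le _ _ _));
  by rewrite pq lexx.
Qed.

Lemma frac_tuple p n (b : 'I_n -> lr_ring (c p)) :
  exists s (a : 'I_n -> A), ~ prime_set p s /\ forall i, sig p s * b i = sig p (a i).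
Proof.
elim: n b => [|n IH] b.
  by exists 1, (fun=> 0); split; [apply: prime_compl1 | case].
have [s [a [ns sa]]] := IH (fun i => b (lift ord0 i)).
have [a0 [s0 [ns0 sa0]]] := ch_frac c p (b ord0).
exists (s0 * s), (fun i => if unlift ord0 i is Some j then s0 * a j else s * a0).
split=> [|i]; first exact: prime_complM.
case: unliftP => [j ->|->]; rewrite !rmorphM; first by rewrite -mulrA sa.
by rewrite mulrAC sa0 mulrC.
Qed.

Lemma ker_tuple p n (a : 'I_n -> A) : (forall i, sig p (a i) = 0) ->
  exists2 s, ~ prime_set p s & forall i, s * a i = 0.
Proof.
elim: n a => [|n IH] a a0; first by exists 1; [apply: prime_compl1 | case].
have [s ns sa] := IH _ (fun i => a0 (lift ord0 i)).
have [s0 ns0 sa0] := ch_ker c (a0 ord0).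
exists (s0 * s) => [|i]; first exact: prime_complM.
case: (unliftP ord0 i) => [j ->|->]; first by rewrite -mulrA sa mulr0.
by rewrite mulrAC sa0 mul0r.
Qed.

Lemma unit_inj p s : ~ prime_set p s -> forall (M : lmodType (lr_ring (c p))),
  injective (fun x : M => sig p s *: x).
Proof.
move=> /(ch_unit c)[b bs] M x y /= e.
by rewrite -(scale1r x) -(scale1r y) -bs -!scalerA e.
Qed.

Lemma unit_kill p s (M : lmodType (lr_ring (c p))) (x : M) :
  ~ prime_set p s -> sig p s *: x = 0 -> x = 0.
Proof. by move=> ns e; apply: (unit_inj ns); rewrite e scaler0. Qed.

Section Families.
Variable G : psh P.
Implicit Types t l : family G.

Definition compat f t := forall p q (h : (c p <= c q)%O),
  ~ prime_set q f -> psh_map G h (t q) = t p.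

Lemma compatB f t l : compat f t -> compat f l -> compat f (fun p => t p - l p).
Proof. by move=> tC lC p q h nq; rewrite raddfB /= tC // lC. Qed.

Lemma compatZ f t a : compat f t -> compat f (fun p => sig p a *: t p).
Proof. by move=> tC p q h nq; rewrite linearZ /= tC // ch_nat. Qed.

Lemma compat_shrink f h t : compat f t -> compat (f * h) t.
Proof. by move=> tC p q k nq; apply: tC => //; apply: prime_complMl nq. Qed.

Section Comb.
Variables (n : nat) (t : 'I_n -> family G).

Definition comb (v : 'rV[A]_n) : family G := fun p => \sum_i sig p (v ord0 i) *: t i p.

Lemma combZ a v p : comb (a *: v) p = sig p a *: comb v p.
Proof.
rewrite scaler_sumr; apply: eq_bigr => i _.
by rewrite mxE rmorphM scalerA.
Qed.

Lemma combD v w p : comb (v + w) p = comb v p + comb w p.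
Proof.
by rewrite -big_split; apply: eq_bigr => i _; rewrite mxE rmorphD scalerDl.
Qed.

Lemma comb0 p : comb 0 p = 0.
Proof. by rewrite /comb big1 // => i _; rewrite mxE rmorph0 scale0r. Qed.

Lemma comb_sum (I : finType) (F : I -> 'rV[A]_n) p :
  comb (\sum_i F i) p = \sum_i comb (F i) p.
Proof. by elim/big_rec2: _ => [|i _ v _ <-]; rewrite ?comb0 ?combD. Qed.

Lemma compat_comb f v : (forall i, compat f (t i)) -> compat f (comb v).
Proof.
move=> tC p q h nq; rewrite /comb raddf_sum /=; apply: eq_bigr => i _.
exact: (compatZ (v ord0 i) (tC i)).
Qed.

End Comb.

(** Over the basic open set of [f], the presheaf [G] is the localization of the
    cokernel [A^n / K], the basis of [A^n] being sent to [t]. *)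
Record presents f n (t : 'I_n -> family G) (K : set 'rV[A]_n) : Prop := Presents {
  pr_sub : is_submod K;
  pr_compat : forall i, compat f (t i);
  pr_gen : forall p, ~ prime_set p f -> forall g : G (c p),
    exists b : 'I_n -> lr_ring (c p), g = \sum_i b i *: t i p;
  pr_rel : forall p, ~ prime_set p f -> forall v,
    comb t v p = 0 <-> exists2 s, ~ prime_set p s & K (s *: v) }.

Lemma presents_shrink f h n (t : 'I_n -> family G) K :
  presents f t K -> presents (f * h) t K.
Proof.
case=> Ks tC gen rel; split=> // [i|p /prime_complMl|p /prime_complMl].
- exact: compat_shrink.
- exact: gen.
- exact: rel.
Qed.

Section Presented.
Variables (f : A) (n : nat) (t : 'I_n -> family G) (K : set 'rV[A]_n).
Hypothesis tK : presents f t K.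

Lemma pr_frac p : ~ prime_set p f -> forall g : G (c p),
  exists v s, ~ prime_set p s /\ sig p s *: g = comb t v p.
Proof.
move=> npf g; have [b ->] := pr_gen tK npf g.
have [s [a [ns sa]]] := frac_tuple b.
exists (\row_i a i), s; split=> //; rewrite scaler_sumr; apply: eq_bigr => i _.
by rewrite mxE scalerA sa.
Qed.

Lemma pr_rel1 p v : ~ prime_set p f -> K v -> comb t v p = 0.
Proof.
move=> npf Kv; apply/(pr_rel tK npf); exists 1; first exact: prime_compl1.
by rewrite scale1r.
Qed.

(** A family vanishing at [p] vanishes at the primes of the filtration below [p];
    near [p] there are no others, and these detect vanishing. *)
Lemma vanish_near l p : compat f l -> ~ prime_set p f -> l p = 0 ->
  exists2 h, ~ prime_set p h &
    forall q, ~ prime_set q f -> ~ prime_set q h -> l q = 0.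
Proof.
move=> lC npf lp0; have noethA := ch_noeth c.
have [s sP] := prime_detection noethA (noeth_row noethA (n := n)) (pr_sub tK).
have [h nph hP] := avoid_primes p s; exists h => // q nqf nqh.
have [v [u [nu uv]]] := pr_frac nqf (l q).
apply: (unit_kill nu); rewrite uv; apply/(pr_rel tK nqf).
apply: (sP [set a | ~ prime_set q a] v).
- exact: prime_compl1.
- by move=> a b; apply: prime_complM.
move=> Q Qs QS.
have Qq : Q `<=` q by move=> a Qa; apply: contrapT => nqa; apply: (QS a).
have Qp : Q `<=` p.
  by apply: contrapT => nQp; apply: nqh; apply: Qq; apply: hP.
have nQf : ~ prime_set Q f by move=> /Qq.
have [QQp QQq] := (proj2 (ch_le c Q p) Qp, proj2 (ch_le c Q q) Qq).
apply/(pr_rel tK nQf); rewrite -(compat_comb v (pr_compat tK) QQq nqf) -uv.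
by rewrite linearZ /= (lC _ _ QQq nqf) -(lC _ _ QQp npf) lp0 raddf0 scaler0.
Qed.

(** Near a prime [q0], with a denominator [u], the family [l] is given by a vector [v].
    At the primes of the filtration lying in that neighbourhood and below [p], the family
    [l] vanishes, so that [v] is killed by the product of an element outside [p] and of a
    power of an equation [f'] of the neighbourhood. The neighbourhoods [f'] on which a
    denominator outside [p] kills [l] form an ideal, to which [radical_pow] applies. *)
Lemma vanish_denom l p : compat f l -> ~ prime_set p f -> l p = 0 ->
  exists2 s, ~ prime_set p s & forall q, ~ prime_set q f -> sig q s *: l q = 0.
Proof.
move=> lC npf lp0; have noethA := ch_noeth c.
have [L LP] := prime_detection noethA (noeth_row noethA (n := n)) (pr_sub tK).
pose I : set A := [set a | exists2 s, ~ prime_set p s &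
  forall q, ~ prime_set q f -> ~ prime_set q a -> sig q s *: l q = 0].
suff [e [s ns sl]] : exists e, I (f ^+ e).
  by exists s => // q nqf; apply: sl => //; apply: prime_complX.
apply: radical_pow => //.
  split.
  - exists 1; first exact: prime_compl1.
    by move=> q _ []; have [[]] := primeP q.
  - move=> a b [s ns sl] [u nu ul]; exists (s * u); first exact: prime_complM.
    move=> q nqf nqab; rewrite rmorphM.
    have [qa|nqa] := pselect (prime_set q a); last by rewrite mulrC -scalerA sl ?scaler0.
    rewrite -scalerA ul ?scaler0 // => qb; apply: nqab.
    by have [[_ + _] _ _] := primeP q; apply.
  - move=> a b [s ns sl]; exists s => // q nqf /prime_complMr; exact: (sl q nqf).
move=> q0 nqf0; have [v [u [nu uv]]] := pr_frac nqf0 (l q0).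
pose l' : family G := fun q => sig q u *: l q - comb t v q.
have l'C : compat f l' := compatB (compatZ u lC) (compat_comb v (pr_compat tK)).
have [|h nqh hl'] := vanish_near l'C nqf0; first by rewrite /l' uv subrr.
pose f' := f * h * u.
exists f'; last by do 2![apply: prime_complM => //].
have [||Q QL QS|_ [s ns [e ->]] Ksf] :=
  LP [set a | exists2 s, ~ prime_set p s & exists e, a = s * f' ^+ e] v.
- by exists 1; [apply: prime_compl1 | exists 0; rewrite mulr1].
- move=> _ _ [s ns [i ->]] [s' ns' [j ->]]; exists (s * s'); first exact: prime_complM.
  by exists (i + j)%N; rewrite exprD; ring.
- have nQf' : ~ prime_set Q f'.
    apply: QS; exists 1; first exact: prime_compl1.
    by exists 1%N; rewrite mul1r expr1.
  have nQfh := prime_complMl nQf'; have nQf := prime_complMl nQfh.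
  have Qp : Q `<=` p.
    move=> a Qa; apply: contrapT => npa; apply: (QS a) => //.
    by exists a => //; exists 0; rewrite mulr1.
  apply/(pr_rel tK nQf).
  have QQp := proj2 (ch_le c Q p) Qp.
  have := hl' Q nQf (prime_complMr nQfh); rewrite /l'.
  by rewrite -(lC _ _ QQp npf) lp0 raddf0 scaler0 sub0r => /eqP; rewrite oppr_eq0 => /eqP.
exists s => // q nqf nqf'.
have nqfh := prime_complMl nqf'; have nqh' := prime_complMr nqfh.
have := pr_rel1 nqf Ksf; rewrite combZ.
have /eqP := hl' q nqf nqh'; rewrite subr_eq0 => /eqP <-.
rewrite rmorphM mulrC -!scalerA => /(unit_kill (prime_complX (e := e) nqf')).
by rewrite scalerA mulrC -scalerA => /(unit_kill (prime_complMr nqf')).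
Qed.

(** The [a] for which [a l] is a combination of [t] form an ideal. By [vanish_denom],
    an expression of [l] as a fraction at a prime outside the zeros of [f] provides an
    element of this ideal outside that prime. *)
Lemma family_frac l : compat f l -> exists e v,
  forall q, ~ prime_set q f -> sig q (f ^+ e) *: l q = comb t v q.
Proof.
move=> lC; have noethA := ch_noeth c.
pose I : set A := [set a | exists v,
  forall q, ~ prime_set q f -> sig q a *: l q = comb t v q].
suff [e [v ev]] : exists e, I (f ^+ e) by exists e, v.
apply: radical_pow => //.
  split.
  - by exists 0 => q _; rewrite rmorph0 scale0r comb0.
  - move=> a b [v av] [w bw]; exists (v + w) => q nqf.
    by rewrite rmorphD scalerDl av // bw // combD.
  - move=> a b [v bv]; exists (a *: v) => q nqf.
    by rewrite rmorphM -scalerA bv // combZ.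
move=> p npf; have [v [u [nu uv]]] := pr_frac npf (l p).
pose l' : family G := fun q => sig q u *: l q - comb t v q.
have l'C : compat f l' := compatB (compatZ u lC) (compat_comb v (pr_compat tK)).
have [|s ns sl'] := vanish_denom l'C npf; first by rewrite /l' uv subrr.
exists (s * u); last exact: prime_complM.
exists (s *: v) => q nqf; have /eqP := sl' q nqf.
by rewrite scalerBr subr_eq0 combZ scalerA -rmorphM => /eqP.
Qed.

End Presented.
End Families.

Definition ring_unit_family : 'I_1 -> family (ring_psh P) := fun _ p => 1.

(** One generator and no relation: what holds for presented modules holds for the
    structure presheaf. *)
Lemma ring_presents f : presents f ring_unit_family [set 0].
Proof.
split; first exact: submod0.
- by move=> i p q h _; apply: rmorph1.
- by move=> p _ g; exists (fun=> g); rewrite big_ord1 /=; apply/esym/mulr1.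
move=> p _ v; rewrite /comb big_ord1 /=.
have -> : sig p (v ord0 ord0) *: (1 : (lr_ring (c p))^o) = sig p (v ord0 ord0).
  exact: mulr1.
split=> [/(ch_ker c)[s ns s0]|[s ns /= sv0]].
  by exists s => //; apply/rowP => i; rewrite ord1 !mxE.
apply: (@unit_kill p s (lr_ring (c p))^o) => //.
transitivity (sig p ((s *: v) ord0 ord0)); first by rewrite mxE rmorphM.
by rewrite sv0 mxE rmorph0.
Qed.

Lemma ring_family_frac f (r : family (ring_psh P)) : compat f r -> exists e a,
  forall q, ~ prime_set q f -> sig q (f ^+ e) * r q = sig q a.
Proof.
move=> /(family_frac (ring_presents f))[e [v ev]].
exists e, (v ord0 ord0) => q /ev; rewrite /comb big_ord1 => E; exact: (etrans E (mulr1 _)).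
Qed.

Lemma compat_sec f a : @compat (ring_psh P) f (fun p => sig p a).
Proof. by move=> p q h _; apply: ch_nat. Qed.

(** Families of relations generating all the relations pointwise may be replaced by
    relations with coefficients in [A], which then define a presentation. *)
Lemma presents_of_germs (G : psh P) f n (t : 'I_n -> family G) m
    (r : 'I_m -> 'I_n -> family (ring_psh P)) :
  (forall i, compat f (t i)) -> (forall j k, compat f (r j k)) ->
  (forall p, ~ prime_set p f -> forall g : G (c p),
    exists b : 'I_n -> lr_ring (c p), g = \sum_i b i *: t i p) ->
  (forall j p, ~ prime_set p f -> \sum_k (r j k p : lr_ring (c p)) *: t k p = 0) ->
  (forall p, ~ prime_set p f -> forall b : 'I_n -> lr_ring (c p),
    \sum_k b k *: t k p = 0 ->
    exists d : 'I_m -> lr_ring (c p), forall k, b k = \sum_j d j * r j k p) ->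
  exists K, presents f t K.
Proof.
move=> tC rC gen rel0 rel.
have /choice[e eP] : forall jk : 'I_m * 'I_n, exists e, exists a,
    forall q, ~ prime_set q f -> sig q (f ^+ e) * r jk.1 jk.2 q = sig q a.
  by move=> [j k]; apply: ring_family_frac.
move/choice: eP => [a aP].
(* A common exponent for the denominators of all the coefficients. *)
pose E := (\sum_jk e jk)%N; pose b j k := f ^+ (E - e (j, k)) * a (j, k).
have bE j k q : ~ prime_set q f -> sig q (f ^+ E) * r j k q = sig q (b j k).
  move=> nqf; rewrite /b rmorphM -(aP (j, k)) //= mulrA -rmorphM -exprD.
  by rewrite subnK // /E (bigD1 (j, k)) //= leq_addr.
pose row_b j : 'rV[A]_n := \row_k b j k.
exists [set v | exists al : 'I_m -> A, v = \sum_j al j *: row_b j].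
split=> //; first exact: span_submod.
move=> p npf v; split=> [/(rel _ npf)[d dE]|[s ns [al vE]]].
  have [s [al [ns sal]]] := frac_tuple d.
  pose w : 'rV[A]_n := (s * f ^+ E) *: v - \sum_j al j *: row_b j.
  have [|u nu uw] := @ker_tuple p n (w ord0).
    move=> k; rewrite !mxE rmorphB summxE rmorph_sum !rmorphM /= dE mulr_sumr.
    apply/eqP; rewrite subr_eq0; apply/eqP; apply: eq_bigr => j _.
    by rewrite !mxE rmorphM -sal -bE //; ring.
  exists (u * (s * f ^+ E)); first by do 2![apply: prime_complM => //]; apply: prime_complX.
  exists (fun j => u * al j).
  transitivity (u *: \sum_j al j *: row_b j); last first.
    by rewrite scaler_sumr; apply: eq_bigr => j _; rewrite scalerA.
  rewrite -scalerA; apply/eqP; rewrite -subr_eq0 -scalerBr; apply/eqP/rowP => k.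
  by rewrite -/w mxE uw mxE.
apply: (unit_kill ns); rewrite -combZ vE comb_sum big1 // => j _.
rewrite combZ; suff -> : comb t (row_b j) p = 0 by rewrite scaler0.
transitivity (sig p (f ^+ E) *: \sum_k (r j k p : lr_ring (c p)) *: t k p).
  rewrite scaler_sumr; apply: eq_bigr => k _.
  by rewrite mxE -bE // scalerA.
by rewrite rel0 // scaler0.
Qed.

End Chart.


(** * Affine open subschemes are charts *)

Section SpecValues.
Variables (A : comPzRingType) (U : opens (Spec A)).
Implicit Types (f g : spec_presheaf A U).

Lemma spec_valM f g z : val (f * g) z = val f z * val g z.
Proof. by rewrite [val (f * g)](rmorphM (val : spec_sec U -> loc_fun U)). Qed.

Lemma spec_valB f g z : val (f - g) z = val f z - val g z.
Proof. by rewrite [val (f - g)](raddfB (val : spec_sec U -> loc_fun U)). Qed.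

End SpecValues.

Section AffineChart.
Variables (X : scheme) (W : affine_open (sch_sheaf X)).
Local Notation A := (aff_ring W).
Local Notation phi := (aff_map W).
Local Notation O := (sch_sheaf X).
Implicit Types (p q : Spec A) (a b f : A) (U V : opens X).

Lemma basic_openP f : open [set p : Spec A | ~ prime_set p f].
Proof.
exists [set f]; apply/seteqP; split=> p /= npf; first by move=> /(_ f erefl).
by move=> pf; apply: npf => _ ->.
Qed.

Definition basic f : opens X := Opens (aff_openmap W (basic_openP f)).

Lemma basicP f p : opens_set (basic f) (phi p) <-> ~ prime_set p f.
Proof. by split=> [[q /= nqf /aff_inj <-]|npf] //; exists p. Qed.

Lemma basic_nbhd V p : opens_set V (phi p) -> exists2 f, ~ prime_set p f & basic f `<=` V.
Proof.
move=> Vp; have [E VE] : open (phi @^-1` V).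
  by apply: open_comp (opensP V) => x _; apply: aff_continuous.
have : (phi @^-1` V) p by [].
rewrite VE => /existsNP[f /not_implyP[Ef npf]]; exists f => // _ [q /= nqf <-].
by suff : (phi @^-1` V) q by []; rewrite VE => /(_ f Ef).
Qed.

Definition aff_range : opens X := Opens (aff_openmap W openT).

Lemma aff_rangeP p : opens_set aff_range (phi p). Proof. by exists p. Qed.

Lemma aff_range_sub : aff_range `<=` range phi. Proof. by []. Qed.

Lemma basic_range f : basic f `<=` aff_range.
Proof. by move=> _ [p _ <-]; apply: aff_rangeP. Qed.

Lemma aff_le p q : ((phi p : sch_point X) <= phi q)%O <-> p `<=` q.
Proof.
split=> [/sch_leP/specializesP pq a pa|/spec_specializes/specializesP pq].
  apply: contrapT => nqa; have /basicP := nqa.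
  by move=> /(pq (basic a))/basicP.
apply/asboolP/specializesP => U Uq.
exact: (pq (opens_preimage (@aff_continuous _ _ W) U)).
Qed.

Lemma aff_down (x : sch_point X) q : (x <= phi q)%O -> exists p, phi p = x.
Proof.
move=> /sch_leP/specializesP xq.
by have [p _ <-] := xq aff_range (aff_rangeP q); exists p.
Qed.

Section Values.
Variables (V : opens X) (VW : V `<=` range phi).
Local Notation pre V := (opens_preimage (@aff_continuous _ _ W) V).

Definition pre_pt p (Vp : opens_set V (phi p)) : opens_set (pre V) :=
  exist _ p (mem_set Vp).

(** The element of [A_p] which [s] becomes on the affine chart. *)
Definition value (s : O V) p (Vp : opens_set V (phi p)) : loc p :=
  val (aff_iso W VW s) (pre_pt Vp).

Lemma value_inj (s t : O V) : (forall p Vp, @value s p Vp = @value t p Vp) -> s = t.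
Proof.
move=> st; apply: (bij_inj (aff_iso_bij VW)); apply/val_inj.
apply: functional_extensionality_dep => -[p pV].
have Vp : opens_set V (phi p) by move: (pV); rewrite inE.
have -> : exist _ p pV = pre_pt Vp by congr exist; apply: bool_irrelevance.
exact: st.
Qed.

Lemma valueM (s t : O V) p (Vp : opens_set V (phi p)) : value (s * t) Vp = value s Vp * value t Vp.
Proof.
rewrite /value (rmorphM (aff_iso W VW) s t).
exact: (@spec_valM _ (pre V) (aff_iso W VW s) (aff_iso W VW t) (pre_pt Vp)).
Qed.

Lemma valueB (s t : O V) p (Vp : opens_set V (phi p)) : value (s - t) Vp = value s Vp - value t Vp.
Proof.
rewrite /value (raddfB (aff_iso W VW) s t).
exact: (@spec_valB _ (pre V) (aff_iso W VW s) (aff_iso W VW t) (pre_pt Vp)).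
Qed.

Lemma value1 p (Vp : opens_set V (phi p)) : value 1 Vp = 1.
Proof. by rewrite /value rmorph1. Qed.

Lemma value0 p (Vp : opens_set V (phi p)) : value 0 Vp = 0.
Proof. by rewrite /value rmorph0. Qed.

Lemma value_frac a b (nb : forall p, opens_set V (phi p) -> ~ prime_set p b) :
  exists s : O V, forall p (Vp : opens_set V (phi p)), value s Vp = frac a (Denom (nb p Vp)).
Proof.
have preV (p : opens_set (pre V)) : opens_set V (phi (val p)) by have := valP p; rewrite inE.
pose g : loc_fun (pre V) := fun z => frac a (Denom (nb _ (preV z))).
have gP : g \in @locally_fraction A (pre V).
  rewrite inE => z; exists (pre V), a, b; split; first exact: preV.
  by move=> y Vy; exists (nb _ (preV y)).
have [j _ jK] := aff_iso_bij VW.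
exists (j (exist _ g gP)) => p Vp; rewrite /value jK /= /g.
by apply/eq_frac; exists (denom1 p).
Qed.

(** Sections over [V] are locally fractions, by definition of the structure sheaf. *)
Lemma value_local (s : O V) p (Vp : opens_set V (phi p)) : exists a b f,
  [/\ ~ prime_set p b, ~ prime_set p f, basic f `<=` V &
   forall q (Vq : opens_set V (phi q)), opens_set (basic f) (phi q) ->
     exists nb : ~ prime_set q b, value s Vq = frac a (Denom nb)].
Proof.
have := valP (aff_iso W VW s); rewrite inE => /(_ (pre_pt Vp)).
move=> [V0 [a [b [V0p sE]]]].
pose V1 := opensI V (Opens (aff_openmap W (opensP V0))).
have [|f npf fV1] := @basic_nbhd V1 p; first by split=> //; exists p.
have [nb _] := sE (pre_pt Vp) V0p.
exists a, b, f; split=> // [x /fV1[]//|q Vq /fV1[_ [q' V0q /aff_inj e]]].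
by rewrite e in V0q; exact: (sE (pre_pt Vq) V0q).
Qed.

End Values.

Lemma value_res U V (UV : U `<=` V) (UW : U `<=` range phi) (VW : V `<=` range phi)
    (s : O V) p (Up : opens_set U (phi p)) (Vp : opens_set V (phi p)) :
  value UW (rp_res O UV s) Up = value VW s Vp.
Proof.
rewrite /value aff_iso_res /=; congr (val _ (exist _ _ _)); exact: bool_irrelevance.
Qed.

Lemma aff_sec_ex a : exists s : O aff_range, forall p (Vp : opens_set aff_range (phi p)),
  value aff_range_sub s Vp = frac a (denom1 p).
Proof.
have [s sE] := @value_frac _ aff_range_sub a 1 (fun p _ => @prime_compl1 _ p).
by exists s => p Vp; rewrite sE; apply/eq_frac; exists (denom1 p).
Qed.

Definition aff_sec a : O aff_range := sval (cid (aff_sec_ex a)).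

Lemma aff_secE a p (Vp : opens_set aff_range (phi p)) :
  value aff_range_sub (aff_sec a) Vp = frac a (denom1 p).
Proof. exact: (svalP (cid (aff_sec_ex a))). Qed.

Lemma aff_sec_is_additive : zmod_morphism aff_sec.
Proof.
move=> a b; apply: (value_inj (VW := aff_range_sub)) => p Vp.
rewrite valueB !aff_secE fracN fracD.
by apply/eq_frac; exists (denom1 p) => /=; ring.
Qed.
Lemma aff_sec_is_multiplicative : monoid_morphism aff_sec.
Proof.
split=> [|a b]; apply: (value_inj (VW := aff_range_sub)) => p Vp.
  by rewrite value1 aff_secE.
rewrite valueM !aff_secE fracM.
by apply/eq_frac; exists (denom1 p) => /=; ring.
Qed.
HB.instance Definition _ := GRing.isZmodMorphism.Build A (O aff_range)
  aff_sec aff_sec_is_additive.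
HB.instance Definition _ := GRing.isMonoidMorphism.Build A (O aff_range)
  aff_sec aff_sec_is_multiplicative.

Definition aff_germ p a : ring_stalk O (phi p) := rgerm (aff_rangeP p) (aff_sec a).

Lemma aff_germ_is_additive p : zmod_morphism (aff_germ p).
Proof. by move=> a b; rewrite /aff_germ rmorphB rgermN rgermD. Qed.
Lemma aff_germ_is_multiplicative p : monoid_morphism (aff_germ p).
Proof.
by split=> [|a b]; rewrite /aff_germ ?rmorph1 -?rgerm1 // rmorphM rgermM.
Qed.
HB.instance Definition _ p := GRing.isZmodMorphism.Build A (ring_stalk O (phi p))
  (aff_germ p) (aff_germ_is_additive p).
HB.instance Definition _ p := GRing.isMonoidMorphism.Build A (ring_stalk O (phi p))
  (aff_germ p) (aff_germ_is_multiplicative p).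

Lemma aff_germ_nat p q (h : ((phi p : sch_point X) <= phi q)%O) a :
  ring_stalk_map (sch_leP h) (aff_germ q a) = aff_germ p a.
Proof. by rewrite ring_stalk_mapE; congr rgerm; apply: Prop_irrelevance. Qed.

Lemma value_sec V (VR : V `<=` aff_range) (VW : V `<=` range phi) a p (Vp : opens_set V (phi p)) :
  value VW (rp_res O VR (aff_sec a)) Vp = frac a (denom1 p).
Proof. by rewrite (value_res VR VW aff_range_sub _ _ (aff_rangeP p)) aff_secE. Qed.

Lemma aff_germ_unit p a : ~ prime_set p a -> exists x, x * aff_germ p a = 1.
Proof.
move=> npa; have bW : basic a `<=` range phi := @basic_range a.
have nb q : opens_set (basic a) (phi q) -> ~ prime_set q a by move/basicP.
have [s sE] := @value_frac _ bW 1 a nb.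
have ap : opens_set (basic a) (phi p) by apply/basicP.
exists (rgerm ap s); rewrite /aff_germ -(rgerm_res (@basic_range a) _ ap) rgermM.
rewrite (rgerm1 O ap); congr rgerm; apply: (value_inj (VW := bW)) => q Vq.
rewrite valueM value1 sE value_sec fracM.
by apply/eq_frac; exists (denom1 q) => /=; ring.
Qed.

(** Near [p] a section is a fraction [a / s], so that [s] times it and [a] have the same
    values; hence they are equal, the chart being an isomorphism on sections. *)
Lemma aff_germ_frac p (x : ring_stalk O (phi p)) : exists a s,
  ~ prime_set p s /\ aff_germ p s * x = aff_germ p a.
Proof.
case: (rgermP x) => U Up s; pose V := opensI U aff_range.
have Vp : opens_set V (phi p) by split; [|apply: aff_rangeP].
rewrite -(rgerm_res (@opensIl _ U aff_range) Up Vp).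
set s' := rp_res _ _ s.
have VW : V `<=` range phi := @opensIr _ U aff_range.
have [a [b [f [npb npf fV sE]]]] := value_local VW s' Vp.
exists a, b; split=> //; have fp : opens_set (basic f) (phi p) by apply/basicP.
rewrite /aff_germ -!(rgerm_res (@basic_range f) _ fp) -(rgerm_res fV Vp fp) rgermM.
congr rgerm; apply: (value_inj (VW := @basic_range f)) => q fq.
have [nb e] := sE q (fV _ fq) fq.
rewrite valueM !value_sec (value_res fV _ VW _ _ (fV _ fq)) e fracM.
by apply/eq_frac; exists (denom1 q) => /=; ring.
Qed.

Lemma aff_germ_ker p a : aff_germ p a = 0 -> exists2 s, ~ prime_set p s & s * a = 0.
Proof.
rewrite (germ0 (ab_of_ring O) (aff_rangeP p)) => /eq_germ[V [VR [VR' [Vp /= e]]]].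
rewrite (Prop_irrelevance VR' VR) in e.
have := value_sec VR (VR : V `<=` range phi) a Vp.
rewrite e rmorph0 value0 frac0 => /eq_frac[u] /=.
rewrite !mulr1 mulr0 => ua; exists (dval u) => //.
exact: denomP.
Qed.

Hypothesis noethA : noetherian A.

Definition aff_chart : chart (sch_lrposet X) :=
  @Chart (sch_lrposet X) A noethA phi aff_le aff_down aff_germ
    aff_germ_nat aff_germ_unit aff_germ_frac aff_germ_ker.

End AffineChart.

Arguments basic {X} W f.
Arguments aff_range {X} W.


(** * Limits over basic open subsets of a chart *)

Lemma inj_surj_bij (S T : Type) (g : S -> T) :
  injective g -> (forall y, exists x, g x = y) -> bijective g.
Proof. by move=> gi /choice[k kP]; exists k => // x; apply: gi; rewrite kP. Qed.

Section Inverse.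
Variable R : comPzRingType.
Implicit Types a b : R.

Definition invertible a := exists b, b * a = 1.

(** The rings at hand may be zero and carry no inverse operation. *)
Definition uinv a : R :=
  if pselect (invertible a) is left e then sval (cid e) else 0.

Lemma uinvK a : invertible a -> uinv a * a = 1.
Proof. by rewrite /uinv; case: pselect => // e _; exact: (svalP (cid e)). Qed.

Lemma uinv_uniq a b : b * a = 1 -> uinv a = b.
Proof.
move=> ba; have ia : uinv a * a = 1 by apply: uinvK; exists b.
by rewrite -[LHS]mulr1 -ba mulrCA ia mulr1.
Qed.

Lemma uinvM a b : invertible a -> invertible b -> uinv (a * b) = uinv a * uinv b.
Proof.
move=> ua ub; apply: uinv_uniq.
by rewrite mulrACA !uinvK // mulr1.
Qed.

Lemma invertible1 : invertible 1.
Proof. by exists 1; rewrite mulr1. Qed.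

Lemma invertibleM a b : invertible (a * b) <-> invertible a /\ invertible b.
Proof.
split=> [[d dab]|[[d da] [e eb]]]; last by exists (d * e); rewrite mulrACA da eb mulr1.
by split; [exists (d * b); rewrite -mulrA (mulrC b) | exists (d * a); rewrite -mulrA].
Qed.

End Inverse.

Lemma invertible_morph (R S : comPzRingType) (g : {rmorphism R -> S}) a :
  invertible a -> invertible (g a).
Proof. by case=> b ba; exists (g b); rewrite -rmorphM ba rmorph1. Qed.

Lemma uinv_morph (R S : comPzRingType) (g : {rmorphism R -> S}) a :
  invertible a -> g (uinv a) = uinv (g a).
Proof. by move=> ua; apply/esym/uinv_uniq; rewrite -rmorphM uinvK // rmorph1. Qed.

Section ChartLimits.
Variables (P : lrposet) (c : chart P).
Local Notation A := (ch_ring c).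
Local Notation sig := (ch_sec c).
Implicit Types (p q : Spec A) (f h s u : A).

Lemma sec_invertible p a : invertible (sig p a) <-> ~ prime_set p a.
Proof.
split=> [[b ba] pa|/(ch_unit c)//].
have [d [s [ns sb]]] := ch_frac c p b.
have [|u nu uz] := @ch_ker _ c p (s - d * a).
  by rewrite rmorphB rmorphM -sb -mulrA ba mulr1 subrr.
apply: (prime_complM nu ns).
have -> : u * s = u * d * a by apply/eqP; rewrite -subr_eq0 -mulrA -mulrBr uz.
by have [[_ _ pM] _ _] := primeP p; apply: pM.
Qed.

Section Spread.
Variables (T : P -> Type) (d : forall x, T x) (t : forall p, T (c p)).

(** Extension by the default [d] from the image of the chart to the whole poset. *)
Definition spread (x : P) : T x :=
  if pselect (exists p, c p = x) is left e
  then let: exist p ep := cid e in eq_rect _ T (t p) _ ep else d x.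

Lemma spreadE p : spread (c p) = t p.
Proof.
rewrite /spread; case: pselect => [e|[]]; last by exists p.
case: (cid e) => q /= qp; have {e}e := ch_inj qp; subst q.
by rewrite (Prop_irrelevance qp erefl).
Qed.

End Spread.

Section AtPoint.
Variable U : set P.

Definition at_pt p (Up : U (c p)) : sub_lrposet U := exist _ (c p) (mem_set Up).

Section Restricted.
Variable G : psh P.

Definition mod_fam (m : lim_mod (psh_restrict U G)) : family c G :=
  fun p => if pselect (U (c p)) is left Up then val m (at_pt Up) else 0.

Lemma mod_famE m p (Up : U (c p)) : mod_fam m p = val m (at_pt Up).
Proof.
by rewrite /mod_fam; case: pselect => // Up'; rewrite (Prop_irrelevance Up' Up).
Qed.

Lemma mod_fam_compat f m : (forall p, ~ prime_set p f -> U (c p)) -> compat f (mod_fam m).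
Proof.
move=> fU p q h nq.
have np : ~ prime_set p f by move=> /(proj1 (ch_le c p q) h).
rewrite (mod_famE m (fU _ nq)) (mod_famE m (fU _ np)).
have hU : (at_pt (fU p np) <= at_pt (fU q nq))%O := h.
rewrite (Prop_irrelevance h (sub_leP hU)).
by have := valP m; rewrite inE => /(_ _ _ hU).
Qed.

End Restricted.

Definition ring_fam (r : lim_ring (sub_lrposet U)) : family c (ring_psh P) :=
  fun p => if pselect (U (c p)) is left Up then val r (at_pt Up) else 0.

Lemma ring_famE r p (Up : U (c p)) : ring_fam r p = val r (at_pt Up).
Proof.
by rewrite /ring_fam; case: pselect => // Up'; rewrite (Prop_irrelevance Up' Up).
Qed.

Lemma ring_fam_compat f r : (forall p, ~ prime_set p f -> U (c p)) -> compat f (ring_fam r).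
Proof.
move=> fU p q h nq.
have np : ~ prime_set p f by move=> /(proj1 (ch_le c p q) h).
rewrite (ring_famE r (fU _ nq)) (ring_famE r (fU _ np)).
have hU : (at_pt (fU p np) <= at_pt (fU q nq))%O := h.
rewrite (Prop_irrelevance h (sub_leP hU)).
by have := valP r; rewrite inE => /(_ _ _ hU).
Qed.

End AtPoint.

Section Basic.
Variable f : A.

Definition ch_basic : set P := [set x | exists2 p, ~ prime_set p f & c p = x].

Local Notation U := ch_basic.
Local Notation R := (lim_ring (sub_lrposet U)).

Lemma ch_basicP p : U (c p) <-> ~ prime_set p f.
Proof. by split=> [[q nqf /ch_inj <-]|npf] //; exists p. Qed.

Lemma in_basic p : ~ prime_set p f -> U (c p).
Proof. by move/ch_basicP. Qed.

Variant at_pt_spec : sub_lrposet U -> Type :=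
  AtPt p (npf : ~ prime_set p f) : at_pt_spec (at_pt (in_basic npf)).

Lemma at_ptP z : at_pt_spec z.
Proof.
case: z => x Ux.
have /cid2[p npf cp] : exists2 p, ~ prime_set p f & c p = x.
  by move: (Ux); rewrite inE.
subst x; have -> : exist _ (c p) Ux = at_pt (in_basic npf) :> sub_lrposet U.
  by congr exist; apply: bool_irrelevance.
by constructor.
Qed.

Lemma lim_ring_ext (r r' : R) :
  (forall p, ~ prime_set p f -> ring_fam r p = ring_fam r' p) -> r = r'.
Proof.
move=> rr'; apply/val_inj; apply: functional_extensionality_dep => z.
by case: (at_ptP z) => p npf; rewrite -!ring_famE; apply: rr'.
Qed.

Lemma lim_ring_of (l : family c (ring_psh P)) : compat f l ->
  exists r : R, forall p, ~ prime_set p f -> ring_fam r p = l p.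
Proof.
move=> lC; pose s : dprod (@lr_ring (sub_lrposet U)) :=
  fun z => @spread (@lr_ring P) (fun=> 0) l (val z).
have sC : s \in @compatible_ring (sub_lrposet U).
  rewrite inE => z w; case: (at_ptP z) => p npf; case: (at_ptP w) => q nqf h.
  by rewrite /s /= !spreadE; apply: lC.
exists (exist _ s sC) => p npf.
by rewrite (ring_famE _ (in_basic npf)) /= /s /= spreadE.
Qed.

Lemma ring_famM (r r' : R) p : ring_fam (r * r') p =
  (ring_fam r p : lr_ring (c p)) * ring_fam r' p.
Proof.
by rewrite /ring_fam; case: pselect => // _; rewrite mulr0.
Qed.

Lemma ring_famD (r r' : R) p : ring_fam (r + r') p = ring_fam r p + ring_fam r' p.
Proof.
by rewrite /ring_fam; case: pselect => // _; rewrite addr0.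
Qed.

Lemma ring_fam1 p : ~ prime_set p f -> ring_fam (1 : R) p = 1.
Proof. by move=> npf; rewrite (ring_famE _ (in_basic npf)). Qed.

Lemma ring_fam0 p : ring_fam (0 : R) p = 0.
Proof. by rewrite /ring_fam; case: pselect. Qed.

Definition const_sec (a : A) : R := sval (cid (lim_ring_of (@compat_sec P c f a))).

Lemma const_secE a p : ~ prime_set p f -> ring_fam (const_sec a) p = sig p a.
Proof. exact: (svalP (cid (lim_ring_of (@compat_sec P c f a)))). Qed.

Lemma inv_sec_ex : exists r : R, forall p, ~ prime_set p f -> ring_fam r p = uinv (sig p f).
Proof.
apply: (lim_ring_of (l := fun p => uinv (sig p f))) => p q h nq.
transitivity (lr_map h (uinv (sig q f))); first by [].
by rewrite uinv_morph ?ch_nat //; apply/sec_invertible.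
Qed.

Definition inv_sec : R := sval (cid inv_sec_ex).

Lemma inv_secE : inv_sec * const_sec f = 1.
Proof.
apply: lim_ring_ext => p npf; rewrite ring_famM const_secE // ring_fam1 //.
by rewrite (svalP (cid inv_sec_ex)) // uinvK //; apply/sec_invertible.
Qed.

Lemma const_secM a b : const_sec (a * b) = const_sec a * const_sec b.
Proof. by apply: lim_ring_ext => p npf; rewrite ring_famM !const_secE // rmorphM. Qed.

Lemma const_secD a b : const_sec (a + b) = const_sec a + const_sec b.
Proof. by apply: lim_ring_ext => p npf; rewrite ring_famD !const_secE // rmorphD. Qed.

Lemma const_sec0 : const_sec 0 = 0.
Proof. by apply: lim_ring_ext => p npf; rewrite ring_fam0 const_secE // rmorph0. Qed.

Lemma const_sec1 : const_sec 1 = 1.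
Proof. by apply: lim_ring_ext => p npf; rewrite ring_fam1 // const_secE // rmorph1. Qed.

Lemma const_secX a e : const_sec (a ^+ e) = const_sec a ^+ e.
Proof. by elim: e => [|e IH]; rewrite ?const_sec1 // !exprS const_secM IH. Qed.

Lemma inv_secX e : inv_sec ^+ e * const_sec (f ^+ e) = 1.
Proof. by rewrite const_secX -exprMn inv_secE expr1n. Qed.

(** With [inv_secE], this makes the limit ring the localization of [A] at [f]. *)
Lemma lim_ring_frac (r : R) : exists e a, const_sec (f ^+ e) * r = const_sec a.
Proof.
have [e [a ea]] := ring_family_frac (ring_fam_compat r (fun p => @in_basic p)).
exists e, a; apply: lim_ring_ext => p npf.
by rewrite ring_famM !const_secE // ea.
Qed.

Lemma lim_ring_frac_inv (r : R) : exists e a, r = inv_sec ^+ e * const_sec a.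
Proof.
have [e [a ea]] := lim_ring_frac r; exists e, a.
by rewrite -ea mulrA inv_secX mul1r.
Qed.

Lemma lim_ring_noetherian : noetherian R.
Proof.
move=> J [J0 JD JM].
have JI : is_ideal [set a | J (const_sec a)].
  split=> [|a b|a b] /=; rewrite ?const_sec0 // ?const_secD ?const_secM; [exact: JD|exact: JM].
have [n [g [Jg gen]]] := ideal_fg (ch_noeth c) JI.
exists n, (fun i => const_sec (g i)) => r; split=> [Jr|[d ->]]; last first.
  by elim/big_ind: _ => // i _; apply: JM; apply: Jg.
have [e [a rE]] := lim_ring_frac_inv r.
have [|d dE] := gen a.
  suff ea : const_sec (f ^+ e) * r = const_sec a by rewrite /= -ea; apply: JM.
  by rewrite rE mulrA (mulrC (const_sec _)) inv_secX mul1r.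
exists (fun i => inv_sec ^+ e * const_sec (d i)); rewrite rE dE.
transitivity (inv_sec ^+ e * \sum_i const_sec (d i) * const_sec (g i)).
  congr (_ * _); elim/big_rec2: _ => [|i y z _ <-]; first exact: const_sec0.
  by rewrite const_secD const_secM.
by rewrite mulr_sumr; apply: eq_bigr => i _; rewrite mulrA.
Qed.

Section LimModules.
Variable G : psh P.
Local Notation L := (lim_mod (psh_restrict U G)).

Lemma lim_mod_ext (m m' : L) :
  (forall p, ~ prime_set p f -> mod_fam m p = mod_fam m' p) -> m = m'.
Proof.
move=> mm'; apply/val_inj; apply: functional_extensionality_dep => z.
by case: (at_ptP z) => p npf; rewrite -!mod_famE; apply: mm'.
Qed.

Lemma lim_mod_of (l : family c G) : compat f l ->
  exists m : L, forall p, ~ prime_set p f -> mod_fam m p = l p.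
Proof.
move=> lC; pose s : dprod (psh_at (psh_restrict U G)) :=
  fun z => @spread (psh_at G) (fun=> 0) l (val z).
have sC : s \in @compatible_mod _ (psh_restrict U G).
  rewrite inE => z w; case: (at_ptP z) => p npf; case: (at_ptP w) => q nqf h.
  by rewrite /s /= !spreadE; apply: lC.
exists (exist _ s sC) => p npf.
by rewrite (mod_famE _ (in_basic npf)) /= /s /= spreadE.
Qed.

Lemma mod_famZ (r : R) (m : L) p : mod_fam (r *: m) p =
  (ring_fam r p : lr_ring (c p)) *: mod_fam m p.
Proof.
rewrite /mod_fam /ring_fam; case: pselect => // _; by rewrite scaler0.
Qed.

Lemma mod_famD (m m' : L) p : mod_fam (m + m') p = mod_fam m p + mod_fam m' p.
Proof. by rewrite /mod_fam; case: pselect => // _; rewrite addr0. Qed.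

Lemma mod_fam0 p : mod_fam (0 : L) p = 0.
Proof. by rewrite /mod_fam; case: pselect. Qed.

Lemma mod_fam_sum (I : finType) (F : I -> L) p :
  mod_fam (\sum_i F i) p = \sum_i mod_fam (F i) p.
Proof. by elim/big_rec2: _ => [|i _ v _ <-]; rewrite ?mod_fam0 ?mod_famD. Qed.

Section Presented.
Variables (n : nat) (t : 'I_n -> family c G) (K : set 'rV[A]_n).
Hypothesis tK : presents f t K.

Lemma lim_gens : exists T : 'I_n -> L,
  forall i p, ~ prime_set p f -> mod_fam (T i) p = t i p.
Proof.
have /choice[T TP] : forall i, exists m : L,
    forall p, ~ prime_set p f -> mod_fam m p = t i p.
  by move=> i; apply: lim_mod_of; apply: (pr_compat tK).
by exists T.
Qed.

(** The denominators provided by [family_frac] are powers of [f], which is invertible in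
    the limit ring. *)
Lemma lim_mod_fg : finitely_generated L.
Proof.
have [T TE] := lim_gens; exists n, T => m.
have [e [v ev]] := family_frac tK (mod_fam_compat m (fun p => @in_basic p)).
exists (fun i => inv_sec ^+ e * const_sec (v ord0 i)); apply: lim_mod_ext => p npf.
rewrite mod_fam_sum; transitivity ((ring_fam (inv_sec ^+ e) p : lr_ring (c p)) *: comb t v p).
  rewrite -ev // scalerA -(const_secE (f ^+ e) npf) -ring_famM inv_secX.
  by rewrite ring_fam1 // scale1r.
rewrite scaler_sumr; apply: eq_bigr => i _.
by rewrite mod_famZ ring_famM TE // const_secE // scalerA.
Qed.

End Presented.
End LimModules.
End Basic.
End ChartLimits.


(** * Basic open subsets are affine noetherian *)

Section PureTensors.
Variables (R S : comPzRingType) (g : {rmorphism R -> S}) (M : lmodType R).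
Implicit Types (m : M) (b : S).

Definition pure m b : tensor g M := tclass g [:: (m, b)].

Lemma pureD m m' b : pure (m + m') b = pure m b + pure m' b.
Proof. by rewrite /pure tclassD; apply/eq_tclass/TAddl. Qed.

Lemma pure0 b : pure 0 b = 0.
Proof. exact/eq_tclass/TZero. Qed.

Lemma pureZ a m b : pure (a *: m) b = pure m (g a * b).
Proof. exact/eq_tclass/TScale. Qed.

Lemma scale_pure a m b : a *: pure m b = pure m (a * b).
Proof. exact: tensor_scaleE. Qed.

Lemma tclass_cons m b u : tclass g ((m, b) :: u) = pure m b + tclass g u.
Proof. by rewrite tclassD. Qed.

End PureTensors.

Section ChartAdmissible.
Variables (P : lrposet) (c : chart P) (f : ch_ring c).
Local Notation A := (ch_ring c).
Local Notation sig := (ch_sec c).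
Local Notation U := (ch_basic f).
Local Notation R := (lim_ring (sub_lrposet U)).
Implicit Types (p q : Spec A) (h s u : A).

Section Module.
Variables (G : psh P) (n : nat) (t : 'I_n -> family c G) (K : set 'rV[A]_n).
Hypothesis tK : presents f t K.
Local Notation L := (lim_mod (psh_restrict U G)).

Lemma proj_const p (npf : ~ prime_set p f) a :
  lim_ring_proj (at_pt (in_basic npf)) (const_sec f a) = sig p a.
Proof. by rewrite -(const_secE a npf) (ring_famE _ (in_basic npf)). Qed.

(** Over a localization all tensors have a common denominator. *)
Lemma tensor_frac p (npf : ~ prime_set p f)
    (z : tensor (@lim_ring_proj (sub_lrposet U) (at_pt (in_basic npf))) L) :
  exists (m : L) s, ~ prime_set p s /\ (sig p s : lr_ring (at_pt (in_basic npf))) *: z = pure _ m 1.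
Proof.
rewrite -(tclass_repr z); elim: (repr z) => [|[m b] w [m' [s [ns sw]]]].
  exists 0, 1; split; first exact: prime_compl1.
  by rewrite pure0; apply: scaler0.
have [a [s0 [ns0 sa0]]] := ch_frac c p b.
exists (const_sec f (s * a) *: m + const_sec f s0 *: m'), (s0 * s).
split; first exact: prime_complM.
rewrite tclass_cons scalerDr pureD !pureZ /= !proj_const !mulr1; congr (_ + _).
  rewrite scale_pure; congr pure.
  by rewrite !rmorphM -sa0 [RHS]mulrA (mulrC (sig p s)).
rewrite rmorphM -scalerA sw scale_pure mulr1; congr pure.
Qed.

(** Surjective because [t] generates the stalk. Injective because a tensor is, up to a
    unit, of the form [m (x) 1]; if [m] vanishes at [p] then a denominator at [p], which
    becomes a unit in the stalk, kills [m] by [vanish_denom]. *)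
Lemma basic_T_can_iso : T_can_iso G U.
Proof.
move=> z; case: (at_ptP z) => p npf; apply: inj_surj_bij; last first.
  have [T TE] := lim_gens tK.
  move=> g; have [b ->] := pr_gen tK npf g.
  exists (tclass _ [seq (T i, b i) | i <- enum 'I_n]).
  rewrite /T_can tensor_liftE /tsum_lift big_map big_enum /=.
  by apply: eq_bigr => i _; rewrite -(TE i) // (mod_famE _ (in_basic npf)).
suff inj0 (y : T_at (psh_restrict U G) (at_pt (in_basic npf))) :
    T_can (psh_restrict U G) _ y = 0 -> y = 0.
  move=> y y' e; apply/eqP; rewrite -subr_eq0; apply/eqP; apply: inj0.
  by rewrite /T_can raddfB /=; apply/eqP; rewrite subr_eq0; apply/eqP.
move=> y0; have [m [s [ns sy]]] := tensor_frac y.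
have m0 : mod_fam m p = 0.
  rewrite (mod_famE _ (in_basic npf)).
  transitivity (T_can (psh_restrict U G) _ (pure (@lim_ring_proj _ (at_pt (in_basic npf))) m 1)).
    rewrite /T_can tensor_liftE /tsum_lift big_seq1 /=; exact/esym/scale1r.
  by rewrite -sy /T_can linearZ /= [tensor_lift _ _]y0 scaler0.
have [s' ns' s'm] := vanish_denom tK (mod_fam_compat m (fun p => @in_basic _ _ _ p)) npf m0.
apply: (@unit_kill _ c p (s' * s) (T_at (psh_restrict U G) (at_pt (in_basic npf))) y).
  exact: prime_complM.
rewrite rmorphM -scalerA [_ *: y]sy scale_pure mulr1.
have -> : sig p s' = lim_ring_proj (at_pt (in_basic npf)) (const_sec f s') * 1.
  by rewrite proj_const mulr1.
rewrite -pureZ; have -> : const_sec f s' *: m = 0; last exact: pure0.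
by apply: lim_mod_ext => q nqf; rewrite mod_famZ const_secE // mod_fam0 s'm.
Qed.

End Module.

Section Points.
Implicit Types (x y : sub_lrposet U) (r : R).

Definition nonunits x : set R := [set r | ~ invertible (lim_ring_proj x r)].

Lemma ring_fam_frac r p : ~ prime_set p f -> exists a s,
  [/\ ~ prime_set p s, sig p s * ring_fam r p = sig p a &
   invertible (ring_fam r p : lr_ring (c p)) <-> ~ prime_set p a].
Proof.
move=> npf; have [a [s [ns sa]]] := ch_frac c p (ring_fam r p).
exists a, s; split=> //; rewrite -sec_invertible -sa.
by split=> [ur|/invertibleM[]//]; apply/invertibleM; split=> //; apply/sec_invertible.
Qed.

Lemma nonunitsE p (npf : ~ prime_set p f) r :
  nonunits (at_pt (in_basic npf)) r <-> ~ invertible (ring_fam r p : lr_ring (c p)).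
Proof. by rewrite (ring_famE _ (in_basic npf)). Qed.

Lemma nonunits_prime x : is_prime_ideal (nonunits x).
Proof.
case: (at_ptP x) => p npf; have [[p0 pD pM] _ _] := primeP p.
split; first split.
- by apply/nonunitsE; rewrite ring_fam0 -(rmorph0 (sig p)) => /sec_invertible.
- move=> r r' /nonunitsE nr /nonunitsE nr'; apply/nonunitsE.
  have [a [s [ns sa ua]]] := ring_fam_frac r npf.
  have [a' [s' [ns' sa' ua']]] := ring_fam_frac r' npf.
  have pa : prime_set p a by apply: contrapT => /ua.
  have pa' : prime_set p a' by apply: contrapT => /ua'.
  rewrite ring_famD => ud.
  have : invertible (sig p (s * s') * (ring_fam r p + ring_fam r' p)).
    by apply/invertibleM; split=> //; apply/sec_invertible/prime_complM.
  have -> : sig p (s * s') * (ring_fam r p + ring_fam r' p) = sig p (s' * a + s * a').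
    by rewrite rmorphD !rmorphM -sa -sa'; ring.
  by move/sec_invertible; apply; apply: pD; apply: pM.
- by move=> r r' nr'; rewrite /nonunits /= rmorphM => /invertibleM[].
- by apply; rewrite rmorph1; apply: invertible1.
move=> r r'; rewrite /nonunits /= rmorphM => nrr'.
apply: contrapT => /not_orP[/contrapT ur /contrapT ur'].
by apply: nrr'; apply/invertibleM.
Qed.

Definition point_ideal x : Spec R := PrimeIdeal (nonunits_prime x).

Lemma point_ideal_const p (npf : ~ prime_set p f) a :
  prime_set (point_ideal (at_pt (in_basic npf))) (const_sec f a) <-> prime_set p a.
Proof.
rewrite [prime_set _ _]/(nonunits (at_pt (in_basic npf)) (const_sec f a)).
rewrite /nonunits /= proj_const sec_invertible.
by split=> [/contrapT|pa]; last by apply.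
Qed.

Lemma point_ideal_le x y : (x <= y)%O <-> point_ideal x `<=` point_ideal y.
Proof.
case: (at_ptP x) => p npf; case: (at_ptP y) => q nqf.
split=> [h r nr ur|xy].
  apply: nr; have := invertible_morph (lr_map (sub_leP h)) ur.
  suff -> : lr_map (sub_leP h) (lim_ring_proj (at_pt (in_basic nqf)) r) =
     lim_ring_proj (at_pt (in_basic npf)) r by [].
  by have := valP r; rewrite inE => /(_ _ _ h).
rewrite [(_ <= _)%O]/(c p <= c q)%O; apply/ch_le => a pa.
by apply/(point_ideal_const nqf)/xy/point_ideal_const.
Qed.

(** The point is the prime of [A] below [Q]; two primes of the limit ring with the same
    trace on [A] agree since every element is a fraction with denominator a power of
    [f]. *)
Lemma point_ideal_surj (Q : Spec R) : exists x, point_ideal x = Q.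
Proof.
have [[Q0 QD QM] Q1 Qp] := primeP Q.
pose q0 : set A := [set a | prime_set Q (const_sec f a)].
have q0P : is_prime_ideal q0.
  rewrite /q0; split; first split=> [|a b|a b] /=.
  - by rewrite const_sec0.
  - by rewrite const_secD; apply: QD.
  - by rewrite const_secM; apply: QM.
  - by rewrite /= const_sec1.
  - by move=> a b /=; rewrite const_secM => /Qp.
have nqf : ~ prime_set (PrimeIdeal q0P) f.
  by rewrite /= /q0 /= => Qf; apply: Q1; rewrite -(inv_secE f); apply: QM.
exists (at_pt (in_basic nqf)).
have e r : exists e a, const_sec f (f ^+ e) * r = const_sec f a := lim_ring_frac r.
have main r : prime_set (point_ideal (at_pt (in_basic nqf))) r <-> prime_set Q r.
  have [i [a ia]] := e r.
  have [[_ _ PM] _ PP] := primeP (point_ideal (at_pt (in_basic nqf))).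
  have npi : ~ prime_set (point_ideal (at_pt (in_basic nqf))) (const_sec f (f ^+ i)).
    by rewrite point_ideal_const; apply: prime_complX.
  have nQi : ~ prime_set Q (const_sec f (f ^+ i)).
    by move=> Qi; apply: Q1; rewrite -(inv_secX f i); apply: QM.
  split=> [Pr|Qr].
    have : prime_set (point_ideal (at_pt (in_basic nqf))) (const_sec f a).
      by rewrite -ia; apply: PM.
    by move=> /point_ideal_const /=; rewrite /q0 /= -ia => /Qp[].
  have : prime_set (point_ideal (at_pt (in_basic nqf))) (const_sec f a).
    by apply/point_ideal_const; rewrite /= /q0 /= -ia; apply: QM.
  by rewrite -ia => /PP[].
by apply: spec_le_anti; apply/spec_specializes => r /main.
Qed.

Lemma point_ideal_bij : bijective point_ideal.
Proof.
apply: inj_surj_bij; last exact: point_ideal_surj.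
by move=> x y xy; apply/le_anti/andP; split; apply/point_ideal_le; rewrite xy.
Qed.

Lemma point_ideal_mono : {mono (point_ideal : sub_lrposet U -> spec_lrposet R) : x y / (x <= y)%O}.
Proof.
move=> x y; apply/idP/idP => [/spec_leP|] /point_ideal_le // xy.
exact/asboolP/spec_specializes.
Qed.

Section LocalRing.
Variable x : sub_lrposet U.
Local Notation Q := (point_ideal x).
Local Notation proj := (@lim_ring_proj (sub_lrposet U) x).

Lemma denom_invertible (s : denom Q) : invertible (proj (dval s)).
Proof. exact: (contrapT (denomP s)). Qed.

Definition loc_eval (z : loc Q) : lr_ring x :=
  proj (repr z).1 * uinv (proj (dval (repr z).2)).

Lemma loc_evalE r (s : denom Q) : loc_eval (frac r s) = proj r * uinv (proj (dval s)).
Proof.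
rewrite /loc_eval; have [u /=] := frac_repr r s.
set y := repr _ => e.
have ux := denom_invertible u; have us := denom_invertible s.
have uy := denom_invertible y.2.
have {e} : proj y.1 * proj (dval s) = proj r * proj (dval y.2).
  have := congr1 (fun r => uinv (proj (dval u)) * proj r) e.
  by rewrite !rmorphM /= !mulrA uinvK // !mul1r.
move=> /(congr1 (fun b => uinv (proj (dval s)) * uinv (proj (dval y.2)) * b)) e.
transitivity (uinv (proj (dval s)) * proj (dval s) * (proj y.1 * uinv (proj (dval y.2)))).
  by rewrite uinvK // mul1r.
transitivity (uinv (proj (dval y.2)) * proj (dval y.2) * (proj r * uinv (proj (dval s)))).
  by move: e; rewrite /= => e; transitivity (uinv (proj (dval s)) *
   uinv (proj (dval y.2)) * (proj y.1 * proj (dval s))); [ring | rewrite e; ring].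
by rewrite uinvK // mul1r.
Qed.

Lemma loc_eval_is_additive : zmod_morphism loc_eval.
Proof.
move=> y z; case: (fracP y) (fracP z) => a s [b t].
rewrite fracN fracD !loc_evalE /= rmorphD !rmorphM rmorphN.
have us := denom_invertible s; have ut := denom_invertible t.
rewrite uinvM //=.
transitivity (proj a * uinv (proj (dval s)) * (uinv (proj (dval t)) * proj (dval t)) -
   proj b * uinv (proj (dval t)) * (uinv (proj (dval s)) * proj (dval s))); first by ring.
by rewrite !uinvK // !mulr1.
Qed.
Lemma loc_eval_is_multiplicative : monoid_morphism loc_eval.
Proof.
split=> [|y z].
  by rewrite frac1 loc_evalE /= rmorph1 mul1r; apply: uinv_uniq; rewrite mulr1.
case: (fracP y) (fracP z) => a s [b t].
have us := denom_invertible s; have ut := denom_invertible t.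
by rewrite fracM !loc_evalE /= !rmorphM uinvM //=; ring.
Qed.
HB.instance Definition _ := GRing.isZmodMorphism.Build (loc Q) (lr_ring x)
  loc_eval loc_eval_is_additive.
HB.instance Definition _ := GRing.isMonoidMorphism.Build (loc Q) (lr_ring x)
  loc_eval loc_eval_is_multiplicative.

End LocalRing.

(** Injectivity is [vanish_denom] for the structure presheaf. *)
Lemma loc_eval_bij x : bijective (@loc_eval x).
Proof.
apply: inj_surj_bij; last first.
  case: (at_ptP x) => p npf y; have [a [s [ns sa]]] := ch_frac c p y.
  have nQs : ~ prime_set (point_ideal (at_pt (in_basic npf))) (const_sec f s).
    by rewrite point_ideal_const.
  exists (frac (const_sec f a) (Denom nQs)); rewrite loc_evalE /= !proj_const -sa.
  rewrite mulrC mulrA uinvK ?mul1r //; exact/sec_invertible.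
suff inj0 (z : loc (point_ideal x)) : loc_eval z = 0 -> z = 0.
  move=> y z e; apply/eqP; rewrite -subr_eq0; apply/eqP; apply: inj0.
  by rewrite raddfB /= e subrr.
case: (fracP z) => r s; rewrite loc_evalE => rs0.
have us := denom_invertible s.
have r0 : lim_ring_proj x r = 0.
  transitivity (lim_ring_proj x r * uinv (lim_ring_proj x (dval s)) *
     lim_ring_proj x (dval s)); first by rewrite -mulrA uinvK // mulr1.
  by rewrite rs0 mul0r.
move: s us rs0 r0; case: (at_ptP x) => p npf s us _ r0.
have [|s' ns' s'r] := vanish_denom (ring_presents f)
   (ring_fam_compat r (fun p => @in_basic _ _ _ p)) npf.
  by rewrite (ring_famE _ (in_basic npf)).
rewrite frac0; apply/eq_frac.
have nQs : ~ prime_set (point_ideal (at_pt (in_basic npf))) (const_sec f s').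
  by rewrite point_ideal_const.
exists (Denom nQs) => /=; rewrite mulr1 mul0r mulr0.
apply: lim_ring_ext => q nqf; rewrite ring_famM const_secE // ring_fam0.
exact: s'r.
Qed.

Lemma loc_eval_natural x y (h : (x <= y)%O) (k : point_ideal x `<=` point_ideal y) z :
  loc_eval (loc_map k z) = lr_map h (loc_eval z).
Proof.
case: (fracP z) => r s; rewrite loc_mapE !loc_evalE /= rmorphM.
have us := denom_invertible s.
have E r' : lr_map h (lim_ring_proj y r') = lim_ring_proj x r'.
  by have := valP r'; rewrite inE => /(_ _ _ h).
by rewrite uinv_morph // !E.
Qed.

Definition point_iso : lr_iso (sub_lrposet U) (spec_lrposet R) :=
  @LRIso (sub_lrposet U) (spec_lrposet R) point_ideal point_ideal_bij
    point_ideal_mono (fun x => @loc_eval x) loc_eval_bij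
    (fun x y xy k => loc_eval_natural xy (spec_leP k)).

End Points.

Lemma basic_affine_noetherian : affine_noetherian (sub_lrposet U).
Proof.
split; first exact: lim_ring_noetherian.
exact: (inhabits point_iso).
Qed.

End ChartAdmissible.


(** * Locally presented presheaves are admissible *)

(** The primes of the chart outside [V] are those containing an ideal, that is, those
    above one of its finitely many minimal primes. *)
Lemma opens_sub_closed (X : scheme) (W : affine_open (sch_sheaf X)) (V : opens X) :
  noetherian (aff_ring W) -> exists s : seq (sch_point X),
    (forall y, y \in s -> ~ opens_set V y) /\
    forall q, ~ opens_set V (aff_map W q) ->
      exists2 y : sch_point X, y \in s & (y <= aff_map W q)%O.
Proof.
move=> nA.
have [E VE] : open (aff_map W @^-1` V).
  by apply: open_comp (opensP V) => x _; apply: aff_continuous.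
have VEP q : ~ opens_set V (aff_map W q) <-> E `<=` q.
  have -> : opens_set V (aff_map W q) = (aff_map W @^-1` V) q by [].
  by rewrite VE; split=> [/contrapT|Eq]; last by apply.
pose I : set (aff_ring W) := [set a | forall q : Spec _, E `<=` q -> prime_set q a].
have II : is_ideal I.
  split=> [q Eq|a b Ia Ib q Eq|a b Ib q Eq]; have [[q0 qD qM] _ _] := primeP q => //.
  - by apply: qD; [apply: Ia | apply: Ib].
  - by apply: qM; apply: Ib.
have [s sP] := minimal_primes nA II.
exists [seq (aff_map W P : sch_point X) | P : Spec (aff_ring W) <- s & `[< I `<=` P >]]; split.
  move=> y /mapP[P]; rewrite mem_filter => /andP[/asboolP IP _] ->.
  by apply/VEP => a Ea; apply: IP => q; apply.
move=> q /VEP Eq; have /sP[P [Ps IP Pq]] : I `<=` q by move=> a; apply.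
exists (aff_map W P); last exact/aff_le.
by apply/mapP; exists P => //; rewrite mem_filter Ps andbT; apply/asboolP.
Qed.

Lemma opens_poset_open (X : scheme) (V : opens X) : noetherian_scheme X ->
  @poset_open (sch_lrposet X) V.
Proof.
move=> [Xc Xn].
have /choice[s sP] : forall x : X, exists s : seq (sch_point X),
    exists W : affine_open (sch_sheaf X),
    [/\ range (aff_map W) x, (forall y, y \in s -> ~ opens_set V y) &
    forall q, ~ opens_set V (aff_map W q) ->
      exists2 y : sch_point X, y \in s & (y <= aff_map W q)%O].
  move=> x; have [W [nA Wx]] := Xn x.
  by have [s [sV sE]] := opens_sub_closed V nA; exists s, W.
have /choice[W WP] := sP.
have [||D _ cov] := Xc X setT (fun x => range (aff_map (W x))).
- by move=> x _; apply: aff_openmap; apply: openT.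
- by move=> x _; exists x => //; have [] := WP x.
exists (flatten [seq s x | x <- finmap.enum_fset D]).
apply/seteqP; split=> [y nVy|y [x /flattenP[_ /mapP[z zD ->] xz] xy] Vy].
  have [z zD [q _ qy]] := cov y I; have [_ _ sE] := WP z.
  have [|x xs xq] := sE q; first by rewrite qy.
  exists x; last by rewrite -qy.
  by apply/flattenP; exists (s z) => //; apply/mapP; exists z.
have [_ /(_ x xz) nVx _] := WP z; apply: nVx.
by have /specializesP := sch_leP xy; apply.
Qed.

(** Near every point, [G] is the presheaf of localizations of a finitely presented module
    over the ring of a noetherian affine chart. *)
Definition locally_presented (X : scheme) (G : psh (sch_lrposet X)) : Prop :=
  forall x : X, exists (W : affine_open (sch_sheaf X)) (nA : noetherian (aff_ring W))
    (p : Spec (aff_ring W)) f n (t : 'I_n -> family (aff_chart nA) G) K,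
    [/\ aff_map W p = x, ~ prime_set p f & @presents _ (aff_chart nA) G f n t K].

Lemma ch_basicE (X : scheme) (W : affine_open (sch_sheaf X)) (nA : noetherian (aff_ring W)) f :
  @ch_basic _ (aff_chart nA) f = basic W f.
Proof. by apply/seteqP; split=> [x [p npf <-]|x [p npf <-]]; exists p. Qed.

Lemma presented_admissible (X : scheme) (G : psh (sch_lrposet X)) :
  noetherian_scheme X -> locally_presented G -> admissible G.
Proof.
move=> hX GP.
have /choice[U UP] : forall x : sch_lrposet X, exists U : set (sch_lrposet X),
    [/\ poset_open U /\ U x, T_can_iso G U, affine_noetherian (sub_lrposet U) &
        finitely_generated (lim_mod (psh_restrict U G))].
  move=> x; have [W [nA [p [f [n [t [K [px npf tK]]]]]]]] := GP x.
  exists (@ch_basic _ (aff_chart nA) f); split.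
  - split; first by rewrite ch_basicE; apply: opens_poset_open.
    by exists p.
  - exact: basic_T_can_iso tK.
  - exact: basic_affine_noetherian.
  - exact: lim_mod_fg tK.
exists (sch_lrposet X), U; split=> [|x|x|x]; try by have [] := UP x.
by split=> x; [|exists x]; have [[]] := UP x.
Qed.

(** * Coherence on germs *)

Section FiniteNeighbourhoods.
Variables (X : topologicalType) (x : X).

Lemma finite_nbhd m (Q : 'I_m -> opens X -> Prop) (V : opens X) : opens_set V x ->
  (forall i (U U' : opens X), U `<=` U' -> Q i U' -> Q i U) ->
  (forall i, exists2 U : opens X, opens_set U x & Q i U) ->
  exists U : opens X, [/\ U `<=` V, opens_set U x & forall i, Q i U].
Proof.
elim: m Q V => [|m IH] Q V Vx mon ex; first by exists V; split=> // -[].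
have [U0 U0x Q0] := ex ord0.
have V0x : opens_set (opensI V U0) x by split.
have [U [UV Ux QU]] := IH (fun i => Q (lift ord0 i)) _ V0x (fun i => mon _) (fun i => ex _).
exists U; split=> // [|i]; first by apply: subset_trans UV _; apply: opensIl.
case: (unliftP ord0 i) => [j ->|->]; first exact: QU.
by apply: mon Q0; apply: subset_trans UV _; apply: opensIr.
Qed.

End FiniteNeighbourhoods.

Section Germs.
Variables (X : topologicalType) (O : ring_presheaf X) (F : mod_presheaf O).

Lemma mgerm_sum x (V : opens X) (Vx : opens_set V x) (I : finType) (s : I -> F V) :
  mgerm Vx (\sum_i s i) = \sum_i mgerm Vx (s i).
Proof.
elim/big_rec2: _ => [|i y z _ <-]; last by rewrite mgermD.
exact/esym/(@germ0 _ (ab_of_mod F)).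
Qed.

Lemma rgerm_sum x (V : opens X) (Vx : opens_set V x) (I : finType) (s : I -> O V) :
  rgerm Vx (\sum_i s i) = \sum_i rgerm Vx (s i).
Proof.
elim/big_rec2: _ => [|i y z _ <-]; last by rewrite rgermD.
exact/esym/(@germ0 _ (ab_of_ring O)).
Qed.

Lemma mgerm_irr x (V : opens X) (Vx Vx' : opens_set V x) (s : F V) :
  mgerm Vx s = mgerm Vx' s.
Proof. by rewrite (Prop_irrelevance Vx Vx'). Qed.

(** Finitely many germs are defined on a common neighbourhood. *)
Lemma germ_tuple x n (b : 'I_n -> ring_stalk O x) (V : opens X) : opens_set V x ->
  exists (U : opens X) (UV : U `<=` V) (Ux : opens_set U x) (a : 'I_n -> O U),
    forall i, b i = rgerm Ux (a i).
Proof.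
move=> Vx; have [||U [UV Ux bU]] := @finite_nbhd X x n
   (fun i U => forall Ux : opens_set U x, exists a : O U, b i = rgerm Ux a) V Vx.
- move=> i U U' UU' bU' Ux; have [a ->] := bU' (UU' _ Ux).
  by exists (rp_res O UU' a); rewrite (rgerm_res UU' (UU' _ Ux)).
- move=> i; case: (rgermP (b i)) => U Ux a; exists U => // Ux'.
  by exists a; rewrite (Prop_irrelevance Ux Ux').
have /choice[a aP] := fun i => bU i Ux.
by exists U, UV, Ux, a.
Qed.

Lemma rgerm_eq_tuple x n (V : opens X) (Vx : opens_set V x) (a b : 'I_n -> O V) :
  (forall i, rgerm Vx (a i) = rgerm Vx (b i)) ->
  exists (U : opens X) (UV : U `<=` V), opens_set U x /\
    forall i, rp_res O UV (a i) = rp_res O UV (b i).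
Proof.
move=> ab; have [||U [UV Ux abU]] := @finite_nbhd X x n
   (fun i U => exists UV : U `<=` V, rp_res O UV (a i) = rp_res O UV (b i)) V Vx.
- move=> i U U' UU' [U'V e]; exists (subset_trans UU' U'V).
  by rewrite -!(rp_res_comp UU' U'V) e.
- move=> i; have /eq_germ[U [UV [UV' [Ux e]]]] := ab i; exists U => //.
  by exists UV; rewrite /= in e *; rewrite e (Prop_irrelevance UV' UV).
exists U, UV; split=> // i; have [UV' e] := abU i.
by rewrite (Prop_irrelevance UV UV').
Qed.

End Germs.


Section GermCombinations.
Variables (X : topologicalType) (O : ring_presheaf X) (F : mod_presheaf O) (x : X).

Lemma mgerm0 (V : opens X) (Vx : opens_set V x) : mgerm (F := F) Vx 0 = 0.
Proof. exact/esym/(@germ0 _ (ab_of_mod F)). Qed.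

Lemma mgerm_comb (U V : opens X) (VU : V `<=` U) (Ux : opens_set U x)
    (Vx : opens_set V x) n (a : 'I_n -> O V) (t : 'I_n -> F U) :
  mgerm Vx (\sum_i a i *: mp_res F VU (t i)) =
  \sum_i rgerm Vx (a i) *: mgerm Ux (t i).
Proof.
rewrite mgerm_sum; apply: eq_bigr => i _.
by rewrite -mgermZ (mgerm_res VU Ux).
Qed.

Lemma mgerm_eq0 (V : opens X) (Vx : opens_set V x) (s : F V) : mgerm Vx s = 0 ->
  exists (U : opens X) (UV : U `<=` V), opens_set U x /\ mp_res F UV s = 0.
Proof.
rewrite -(mgerm0 Vx) => /eq_germ[U [UV [UV' [Ux e]]]]; exists U, UV; split=> //.
by move: e => /= ->; rewrite raddf0.
Qed.

End GermCombinations.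

Section Coherent.
Variables (X : scheme) (F : coherent_sheaf X) (G : psh (sch_lrposet X)).

(** Local generators and local generators of their relations induce, on germs, generators
    and generators of the relations. *)
Lemma coherent_presented : noetherian_scheme X ->
  psh_isomorphic (specialization F) G -> locally_presented G.
Proof.
move=> [_ Xn] [fm [gm [fg gf]]] x.
have [ft kft] := coh_coherent F.
have [U [n [t [Ux gen]]]] := ft x.
have [V [VU [m [r [Vx rel0 rel]]]]] := kft U n t x Ux.
have [W [nA [p _ px]]] := Xn x.
have [|f npf fV] := @basic_nbhd X W V p; first by rewrite px.
have inV q : ~ prime_set q f -> opens_set V (aff_map W q).
  by move=> nqf; apply: fV; apply/basicP.
have inU q : ~ prime_set q f -> opens_set U (aff_map W q) by move=> /inV/VU.
pose c := aff_chart nA.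
pose T i : family c G := fun q => if pselect (opens_set U (aff_map W q)) is left Uq
  then fm (aff_map W q) (mgerm Uq (t i)) else 0.
have TE i q (Uq : opens_set U (aff_map W q)) : T i q = fm (aff_map W q) (mgerm Uq (t i)).
  by rewrite /T; case: pselect => // Uq'; rewrite (Prop_irrelevance Uq' Uq).
pose S j k : family c (ring_psh (sch_lrposet X)) := fun q =>
  if pselect (opens_set V (aff_map W q)) is left Vq then rgerm Vq (r j k) else 0.
have SE j k q (Vq : opens_set V (aff_map W q)) : S j k q = rgerm Vq (r j k).
  by rewrite /S; case: pselect => // Vq'; rewrite (Prop_irrelevance Vq' Vq).
have [K TK] : exists K, @presents _ c G f n T K.
  apply: (presents_of_germs (r := S)).
  - move=> i q1 q2 h nq2.
    have nq1 : ~ prime_set q1 f by move=> /(proj1 (ch_le c q1 q2) h).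
    rewrite (TE i _ (inU _ nq2)) (TE i _ (inU _ nq1)) -mor_natural.
    congr (fm _ _); rewrite [LHS]mod_stalk_mapE; exact: mgerm_irr.
  - move=> j k q1 q2 h nq2.
    have nq1 : ~ prime_set q1 f by move=> /(proj1 (ch_le c q1 q2) h).
    rewrite (SE j k _ (inV _ nq2)) (SE j k _ (inV _ nq1)).
    by rewrite [LHS]ring_stalk_mapE; congr rgerm; apply: Prop_irrelevance.
  - move=> q nqf g; have {}gf := gf (aff_map W q) g.
    move: gf; case: (mgermP (gm (aff_map W q) g)) => U1 U1q s <-.
    have Iq : opens_set (opensI U1 U) (aff_map W q) by split=> //; apply: inU.
    have [W1 [W1U [W1q [a e]]]] := gen _ (@opensIr _ U1 U)
      (mp_res F (@opensIl _ U1 U) s) _ Iq.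
    exists (fun i => rgerm W1q (a i)).
    rewrite -(mgerm_res (@opensIl _ U1 U) U1q Iq) -(mgerm_res W1U Iq W1q) e.
    rewrite (mgerm_comb _ (inU _ nqf)) raddf_sum; apply: eq_bigr => i _.
    by rewrite /= linearZ (TE i _ (inU _ nqf)).
  - move=> j q nqf.
    transitivity (fm (aff_map W q) (mgerm (inV _ nqf) (\sum_i r j i *: mp_res F VU (t i)))).
      rewrite (mgerm_comb _ (inU _ nqf)) raddf_sum; apply: eq_bigr => i _.
      by rewrite /= linearZ (TE i _ (inU _ nqf)) (SE j i _ (inV _ nqf)).
    by rewrite [\sum_i _](rel0 j) mgerm0 raddf0.
  move=> q nqf b bT0.
  have [U1 [U1V [U1q [a bE]]]] := germ_tuple b (inV _ nqf).
  have rel1 : mgerm U1q (\sum_i a i *: mp_res F (subset_trans U1V VU) (t i)) = 0.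
    apply: (can_inj (fg (aff_map W q))); rewrite raddf0 -bT0.
    rewrite (mgerm_comb _ (inU _ nqf)) raddf_sum; apply: eq_bigr => i _.
    by rewrite /= linearZ (TE i _ (inU _ nqf)) bE.
  have [W1 [W1U1 [W1q e]]] := mgerm_eq0 rel1.
  have [|W2 [W2W1 [W2q [d dE]]]] := rel W1 (subset_trans W1U1 U1V)
      (fun i => rp_res (sch_sheaf X) W1U1 (a i)) (aff_map W q) _ W1q.
    rewrite /is_relation -[RHS]e raddf_sum; apply: eq_bigr => i _.
    by rewrite /= linearZ /= (mp_res_comp _ _ (subset_trans (subset_trans W1U1 U1V) VU)).
  exists (fun j => rgerm W2q (d j)) => k.
  rewrite bE -(rgerm_res W1U1 U1q W1q) -(rgerm_res W2W1 W1q W2q) dE rgerm_sum.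
  apply: eq_bigr => j _; rewrite -rgermM (SE j k _ (inV _ nqf)).
  by rewrite (rgerm_res _ (inV _ nqf)).
by exists W, nA, p, f, n, T, K.
Qed.

End Coherent.


(** * Admissible presheaves are locally presented *)

Section RightExact.
Variables (R S : comPzRingType) (phi : {rmorphism R -> S}) (M : lmodType R).
Variables (n : nat) (g : 'I_n -> M) (m : nat) (rho : 'I_m -> 'rV[R]_n).

Definition eval_row (v : 'rV[R]_n) : M := \sum_i v ord0 i *: g i.

Hypothesis gen : forall x, exists v, x = eval_row v.
Hypothesis rel : forall v, eval_row v = 0 -> exists a : 'I_m -> R, v = \sum_j a j *: rho j.

Let N : set 'rV[S]_n := [set w | exists d : 'I_m -> S, w = \sum_j d j *: map_mx phi (rho j)].

Lemma eval_rowD v w : eval_row (v + w) = eval_row v + eval_row w.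
Proof. by rewrite -big_split; apply: eq_bigr => i _; rewrite mxE scalerDl. Qed.

Lemma eval_rowZ a v : eval_row (a *: v) = a *: eval_row v.
Proof. by rewrite scaler_sumr; apply: eq_bigr => i _; rewrite mxE scalerA. Qed.

Lemma eval_rowB v w : eval_row (v - w) = eval_row v - eval_row w.
Proof. by rewrite -!scaleN1r eval_rowD eval_rowZ. Qed.

Lemma map_relation v w : eval_row v = eval_row w -> N (map_mx phi v - map_mx phi w).
Proof.
move=> e; have [|a aE] := rel (v := v - w); first by rewrite eval_rowB e subrr.
exists (fun j => phi (a j)); rewrite -map_mxB aE; apply/rowP => k.
rewrite mxE !summxE raddf_sum; apply: eq_bigr => j _.
by rewrite !mxE /= rmorphM.
Qed.

(** Base change is right exact: lifting each element of [M] to the free module, a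
    formal sum of tensors gets a vector over [S], well defined modulo the relations. *)
Lemma tensor_relations (b : 'I_n -> S) :
  tclass phi [seq (g i, b i) | i <- enum 'I_n] = 0 ->
  exists d : 'I_m -> S, forall k, b k = \sum_j d j * phi (rho j ord0 k).
Proof.
have /choice[kap kapE] := gen.
pose Phi (u : tsum S M) : 'rV[S]_n := \sum_(x <- u) x.2 *: map_mx phi (kap x.1).
have NS : is_submod N := span_submod _.
have [N0 ND NZ] := NS.
have PhiE u v : tensor_rel phi u v -> N (Phi u - Phi v).
  rewrite /Phi; elim=> {u v}.
  - by move=> u; rewrite subrr.
  - by move=> u v _ uv; rewrite -opprB -scaleN1r; apply: NZ.
  - move=> u v w _ uv _ vw.
    by rewrite -[_ - _](subrKA (\sum_(x <- v) x.2 *: map_mx phi (kap x.1))); apply: ND.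
  - by move=> u u' v v' _ uu' _ vv'; rewrite !big_cat /= opprD addrACA; apply: ND.
  - by move=> u v; rewrite !big_cat /= [X in X - _]addrC subrr.
  - move=> s; rewrite big_seq1 big_nil /= subr0; apply: NZ.
    have := @map_relation (kap 0) 0; rewrite map_mx0 subr0; apply.
    by rewrite -kapE /eval_row big1 // => i _; rewrite mxE scale0r.
  - move=> x y s; rewrite !big_cons !big_nil /= !addr0.
    rewrite -scalerDr -scalerBr; apply: NZ; rewrite -map_mxD; apply: map_relation.
    by rewrite eval_rowD -!kapE.
  - move=> x s t; by rewrite !big_cons !big_nil /= !addr0 -scalerDl subrr.
  - move=> r x s; rewrite !big_seq1 /= mulrC -scalerA -scalerBr; apply: NZ.
    rewrite -map_mxZ; apply: map_relation.
    by rewrite eval_rowZ -!kapE.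
move=> /(@eq_tclass _ _ phi M _ [::])/PhiE; rewrite /Phi big_nil subr0 big_map big_enum /=.
set w := \sum_i _ => Nw; pose B : 'rV[S]_n := \row_k b k.
suff [d dE] : N B.
  exists d => k; have := congr1 (fun v : 'rV_n => v ord0 k) dE.
  by rewrite mxE summxE => ->; apply: eq_bigr => j _; rewrite !mxE.
have -> : B = w + \sum_i b i *: (map_mx phi (delta_mx ord0 i) - map_mx phi (kap (g i))).
  rewrite /w -big_split /=; apply/rowP => k.
  rewrite summxE mxE (bigD1 k) //= big1 => [|i ik].
    by rewrite addr0 -scalerDr addrC subrK !mxE !eqxx rmorph1 mulr1.
  rewrite -scalerDr addrC subrK !mxE eqxx /= eq_sym (negbTE ik).
  by rewrite rmorph0 mulr0.
apply: ND => //; apply: submod_sum => // i; apply: NZ; apply: map_relation.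
rewrite -kapE /eval_row (bigD1 i) //= big1 => [|k ki].
  by rewrite mxE !eqxx scale1r addr0.
by rewrite mxE eqxx /= (negbTE ki) scale0r.
Qed.

End RightExact.

Section LimitPresentation.
Variables (Q : lrposet) (H : psh Q) (z : Q) (n : nat) (g : 'I_n -> lim_mod H).
Hypothesis isoz : bijective (T_can H z).
Hypothesis gen : forall x, exists v, x = eval_row g v.

Lemma lim_proj_eval v : lim_proj z (eval_row g v) =
  \sum_i lim_ring_proj z (v ord0 i) *: lim_proj z (g i).
Proof. by rewrite /eval_row raddf_sum; apply: eq_bigr => i _; rewrite /= linearZ. Qed.

Lemma stalk_gen (y : H z) :
  exists b : 'I_n -> lr_ring z, y = \sum_i b i *: lim_proj z (g i).
Proof.
have [k _ kK] := isoz.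
rewrite -(kK y) -(tclass_repr (k y)) /T_can tensor_liftE /tsum_lift.
have [S0 SD SZ] := @span_submod _ (H z) _ (fun i => lim_proj z (g i)).
elim/big_ind: _ => // [[l b]] _ /=; apply: SZ.
by have [v ->] := gen l; rewrite lim_proj_eval; exists (fun i => lim_ring_proj z (v ord0 i)).
Qed.

Lemma stalk_rel m (rho : 'I_m -> 'rV[lim_ring Q]_n) :
  (forall v, eval_row g v = 0 -> exists a : 'I_m -> lim_ring Q, v = \sum_j a j *: rho j) ->
  forall b : 'I_n -> lr_ring z, \sum_i b i *: lim_proj z (g i) = 0 ->
  exists d : 'I_m -> lr_ring z, forall k, b k = \sum_j d j * lim_ring_proj z (rho j ord0 k).
Proof.
move=> rel b b0.
apply: (@tensor_relations _ _ (@lim_ring_proj Q z) _ n g m rho gen rel b).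
apply: (bij_inj isoz).
by rewrite /T_can raddf0 tensor_liftE /tsum_lift big_map big_enum.
Qed.

End LimitPresentation.

(** Upsets of points are closures of points. *)
Lemma poset_open_open (X : scheme) (U : set (sch_lrposet X)) :
  poset_open U -> open (U : set X).
Proof.
move=> [s Us]; rewrite -closedC.
have -> : ~` (U : set X) = [set y | exists2 x : sch_point X, x \in s & (x <= y :> sch_point X)%O].
  exact: Us.
elim: s {Us} => [|x s IH].
  have -> : [set y | exists2 x : sch_point X, x \in [::] & (x <= y :> sch_point X)%O] = set0.
    by apply/seteqP; split=> y // [].
  exact: closed0.
have -> : [set y | exists2 z : sch_point X, z \in x :: s & (z <= y :> sch_point X)%O] =
   closure [set x : X] `|` [set y | exists2 z : sch_point X, z \in s & (z <= y :> sch_point X)%O].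
  apply/seteqP; split=> y.
    move=> [z]; rewrite inE => /predU1P[->|zs] zy; last by right; exists z.
    by left; apply: sch_leP zy.
  move=> [xy|[z zs zy]]; last by exists z; rewrite // inE zs orbT.
  by exists x; [rewrite inE eqxx | apply/asboolP].
by apply: closedU => //; apply: closed_closure.
Qed.

(** A finitely generated limit over a noetherian limit ring has finitely many
    generators and relations; where it localizes to the stalks, they restrict to
    generators and relations of the stalks. *)
Lemma limit_presented (P : lrposet) (c : chart P) (G : psh P) (U : set P) f :
  (forall q, ~ prime_set q f -> U (c q)) -> T_can_iso G U ->
  noetherian (lim_ring (sub_lrposet U)) ->
  finitely_generated (lim_mod (psh_restrict U G)) ->
  exists n (t : 'I_n -> family c G) K, presents f t K.
Proof.
move=> inU isoU noethR [n [g gen]].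
pose K : set 'rV[lim_ring (sub_lrposet U)]_n := [set v | eval_row g v = 0].
have KS : is_submod K.
  split=> [|v w|a v]; rewrite /K /=.
  - by rewrite /eval_row big1 // => i _; rewrite mxE scale0r.
  - by rewrite eval_rowD => -> ->; rewrite addr0.
  - by rewrite eval_rowZ => ->; rewrite scaler0.
have [m [rho [Krho rel]]] := noeth_row noethR KS.
have gen' y : exists v, y = eval_row g v.
  have [a ->] := gen y; exists (\row_i a i).
  by apply: eq_bigr => i _; rewrite mxE.
pose t i : family c G := mod_fam (g i).
pose r j k : family c (ring_psh P) := ring_fam (rho j ord0 k).
exists n, t; apply: (presents_of_germs (r := r)).
- by move=> i; apply: mod_fam_compat.
- by move=> j k; apply: ring_fam_compat.
- move=> q nqf y; have Uq := inU q nqf.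
  have [b ->] := stalk_gen (isoU (at_pt Uq)) gen' y.
  by exists b; apply: eq_bigr => i _; rewrite /t (mod_famE _ Uq).
- move=> j q nqf; have Uq := inU q nqf.
  transitivity (lim_proj (at_pt Uq) (eval_row g (rho j))).
    rewrite lim_proj_eval; apply: eq_bigr => k _.
    by rewrite /t /r (mod_famE _ Uq) (ring_famE _ Uq).
  by rewrite [eval_row _ _](Krho j) raddf0.
move=> q nqf b bt0; have Uq := inU q nqf.
have [|d dE] := stalk_rel (isoU (at_pt Uq)) gen' rel (b := b).
  by rewrite -[RHS]bt0; apply: eq_bigr => i _; rewrite /t (mod_famE _ Uq).
exists d => k; rewrite dE; apply: eq_bigr => j _.
by rewrite /r (ring_famE _ Uq).
Qed.

Lemma admissible_presented (X : scheme) (G : psh (sch_lrposet X)) :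
  noetherian_scheme X -> admissible G -> locally_presented G.
Proof.
move=> [_ Xn] [I [U [[opU cov] isoU affU fgU]]] x.
have [i Ux] := cov x; have [noethR _] := affU i.
pose V : opens X := Opens (poset_open_open (opU i)).
have [W [nA [p _ px]]] := Xn x.
have [|f npf fV] := @basic_nbhd X W V p; first by rewrite px.
have inU q : ~ prime_set q f -> U i (aff_chart nA q).
  by move=> nqf; apply: fV; apply/basicP.
have [n [t [K tK]]] := limit_presented (c := aff_chart nA) inU (isoU i) noethR (fgU i).
by exists W, nA, p, f, n, t, K.
Qed.


(** * The sheaf of compatible families *)

Section InverseMorphism.
Variables (P : lrposet) (G H : psh P) (m : psh_mor G H).
Hypothesis bij : forall x, bijective (m x).

Lemma inv_at_ex x (y : H x) : exists z, m x z = y.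
Proof. by have [k _ mk] := bij x; exists (k y). Qed.

Definition inv_at x (y : H x) : G x := sval (cid (inv_at_ex y)).

Lemma inv_atKV x : cancel (@inv_at x) (m x).
Proof. by move=> y; exact: (svalP (cid (inv_at_ex y))). Qed.

Lemma inv_atK x : cancel (m x) (@inv_at x).
Proof. by move=> z; apply: (bij_inj (bij x)); rewrite inv_atKV. Qed.

Lemma inv_at_is_linear x : linear (@inv_at x).
Proof.
by move=> a u v; apply: (bij_inj (bij x)); rewrite linearP !inv_atKV.
Qed.
HB.instance Definition _ x := GRing.isLinear.Build (lr_ring x) (H x) (G x) *:%R
  (@inv_at x) (@inv_at_is_linear x).

Lemma inv_at_natural (x y : P) (h : (x <= y)%O) u :
  inv_at (psh_map H h u) = psh_map G h (inv_at u).
Proof.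
by apply: (bij_inj (bij x)); rewrite inv_atKV mor_natural inv_atKV.
Qed.

Lemma bij_psh_isomorphic : psh_isomorphic G H.
Proof.
exists m, (@PshMor P H G (fun x => @inv_at x) inv_at_natural).
by split=> x; [apply: inv_atK | apply: inv_atKV].
Qed.

End InverseMorphism.

Section SheafOfFamilies.
Variables (X : scheme) (G : psh (sch_lrposet X)).
Local Notation O := (sch_sheaf X).
Implicit Types (U V W : opens X).

Definition sub_opens V : set (sch_lrposet X) := V.

Definition pt V (x : sch_lrposet X) (Vx : opens_set V x) : sub_lrposet (sub_opens V) :=
  exist _ x (mem_set Vx).

Lemma pt_in V (x : sub_lrposet (sub_opens V)) : opens_set V (val x).
Proof. by have := valP x; rewrite inE. Qed.

Lemma pt_val V (x : sub_lrposet (sub_opens V)) : pt (pt_in x) = x.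
Proof. by apply/val_inj. Qed.

Lemma opens_down V (x y : sch_lrposet X) : (x <= y)%O -> opens_set V y -> opens_set V x.
Proof. by move=> xy; apply: (specialize_in (sch_leP xy)). Qed.

Definition germ_fam V (a : O V) : dprod (@lr_ring (sub_lrposet (sub_opens V))) :=
  fun x => rgerm (pt_in x) a.

Lemma germ_fam_compat V (a : O V) : germ_fam a \in @compatible_ring (sub_lrposet (sub_opens V)).
Proof.
rewrite inE => x y h; rewrite [LHS]ring_stalk_mapE; congr rgerm.
exact: Prop_irrelevance.
Qed.

Definition germ_lim V (a : O V) : lim_ring (sub_lrposet (sub_opens V)) :=
  exist _ (germ_fam a) (germ_fam_compat a).

Lemma germ_lim_is_additive V : zmod_morphism (@germ_lim V).
Proof.
move=> a b; apply/val_inj; apply: functional_extensionality_dep => x /=.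
by rewrite /germ_fam -rgermD -rgermN.
Qed.
Lemma germ_lim_is_multiplicative V : monoid_morphism (@germ_lim V).
Proof.
split=> [|a b]; apply/val_inj; apply: functional_extensionality_dep => x /=.
  by rewrite /germ_fam -rgerm1.
by rewrite /germ_fam -rgermM.
Qed.
HB.instance Definition _ V := GRing.isZmodMorphism.Build (O V)
  (lim_ring (sub_lrposet (sub_opens V))) (@germ_lim V) (@germ_lim_is_additive V).
HB.instance Definition _ V := GRing.isMonoidMorphism.Build (O V)
  (lim_ring (sub_lrposet (sub_opens V))) (@germ_lim V) (@germ_lim_is_multiplicative V).

(** The sections over [V] are all the compatible families on [V], with no condition of
    local nature; functions act through their germs. *)
Definition fam_sec V : Type := lim_mod (psh_restrict (sub_opens V) G).
HB.instance Definition _ V := GRing.Zmodule.on (fam_sec V).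

Definition fam_scale V (a : O V) (s : fam_sec V) : fam_sec V :=
  germ_lim a *: (s : lim_mod (psh_restrict (sub_opens V) G)).

Lemma fam_scaleA V (a b : O V) s : fam_scale a (fam_scale b s) = fam_scale (a * b) s.
Proof. by rewrite /fam_scale scalerA -rmorphM. Qed.
Lemma fam_scale1 V : left_id 1 (@fam_scale V).
Proof. by move=> s; rewrite /fam_scale rmorph1 scale1r. Qed.
Lemma fam_scaleDr V : right_distributive (@fam_scale V) +%R.
Proof. by move=> a s t; rewrite /fam_scale scalerDr. Qed.
Lemma fam_scaleDl V s : {morph (@fam_scale V)^~ s : a b / a + b}.
Proof. by move=> a b; rewrite /fam_scale rmorphD scalerDl. Qed.
HB.instance Definition _ V := GRing.Zmodule_isLmodule.Build (O V) (fam_sec V)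
  (@fam_scaleA V) (@fam_scale1 V) (@fam_scaleDr V) (@fam_scaleDl V).

(** The member at [x] of the family [s]. *)
Definition fib V (s : fam_sec V) (x : sch_lrposet X) (Vx : opens_set V x) : G x :=
  val (s : lim_mod (psh_restrict (sub_opens V) G)) (pt Vx).

Lemma fib_ext V (s t : fam_sec V) : (forall x Vx, @fib V s x Vx = fib t Vx) -> s = t.
Proof.
move=> st; apply/val_inj; apply: functional_extensionality_dep => x.
by rewrite -(pt_val x); apply: st.
Qed.

Lemma fib_irr V (s : fam_sec V) (x : sch_lrposet X) (Vx Vx' : opens_set V x) : fib s Vx = fib s Vx'.
Proof. by rewrite (Prop_irrelevance Vx Vx'). Qed.

Lemma fibD V (s t : fam_sec V) (x : sch_lrposet X) (Vx : opens_set V x) :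
  fib (s + t) Vx = fib s Vx + fib t Vx.
Proof. by []. Qed.

Lemma fibB V (s t : fam_sec V) (x : sch_lrposet X) (Vx : opens_set V x) :
  fib (s - t) Vx = fib s Vx - fib t Vx.
Proof. by []. Qed.

Lemma fib0 V (x : sch_lrposet X) (Vx : opens_set V x) : fib (0 : fam_sec V) Vx = 0.
Proof. by []. Qed.

Lemma fib_sum V (I : finType) (s : I -> fam_sec V) (x : sch_lrposet X) (Vx : opens_set V x) :
  fib (\sum_i s i) Vx = \sum_i fib (s i) Vx.
Proof. by elim/big_rec2: _ => [|i y z _ <-]; rewrite ?fib0 ?fibD. Qed.

Lemma fibZ V (a : O V) (s : fam_sec V) (x : sch_lrposet X) (Vx : opens_set V x) :
  fib (a *: s) Vx = (rgerm Vx a : lr_ring x) *: fib s Vx.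
Proof.
transitivity ((rgerm (pt_in (pt Vx)) a : lr_ring x) *: fib s Vx); first by [].
by congr (_ *: _); congr rgerm; apply: Prop_irrelevance.
Qed.

Lemma fib_map V (s : fam_sec V) (x y : sch_lrposet X) (h : (x <= y)%O)
    (Vx : opens_set V x) (Vy : opens_set V y) : psh_map G h (fib s Vy) = fib s Vx.
Proof.
have := valP (s : lim_mod (psh_restrict (sub_opens V) G)); rewrite inE => sC.
have hV : (pt Vx <= pt Vy)%O := h.
by rewrite (Prop_irrelevance h (sub_leP hV)); apply: (sC _ _ hV).
Qed.

Lemma fam_of V (d : forall x : sch_lrposet X, opens_set V x -> G x) :
  (forall x y (h : (x <= y)%O) Vx Vy, psh_map G h (d y Vy) = d x Vx) ->
  exists s : fam_sec V, forall x Vx, fib s Vx = d x Vx.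
Proof.
move=> dC; pose e : dprod (psh_at (psh_restrict (sub_opens V) G)) :=
  fun x => d (val x) (pt_in x).
have eC : e \in @compatible_mod _ (psh_restrict (sub_opens V) G).
  by rewrite inE => x y h; apply: dC.
exists (exist _ e eC) => x Vx; rewrite /fib /= /e.
by rewrite (Prop_irrelevance (pt_in (pt Vx)) Vx).
Qed.

Section Restriction.
Variables (U V : opens X) (UV : U `<=` V).

Lemma fam_res_ex (s : fam_sec V) :
  exists t : fam_sec U, forall x Ux, fib t Ux = fib s (UV Ux) :> G x.
Proof. by apply: fam_of => x y h Ux Uy; apply: fib_map. Qed.

Definition fam_res (s : fam_sec V) : fam_sec U := sval (cid (fam_res_ex s)).

Lemma fam_resE s (x : sch_lrposet X) (Ux : opens_set U x) (Vx : opens_set V x) :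
  fib (fam_res s) Ux = fib s Vx.
Proof. by rewrite (svalP (cid (fam_res_ex s))); apply: fib_irr. Qed.

Lemma fam_res_is_linear : linear_for (rp_res O UV \; *:%R) fam_res.
Proof.
move=> a s t; apply: fib_ext => x Ux.
rewrite fibD fibZ !(fam_resE _ Ux (UV Ux)) fibD fibZ.
by rewrite (rgerm_res UV (UV Ux)).
Qed.
HB.instance Definition _ := GRing.isLinear.Build (O V) (fam_sec V) (fam_sec U)
  (rp_res O UV \; *:%R) fam_res fam_res_is_linear.

End Restriction.

Lemma fam_res_id U (h : U `<=` U) s : fam_res h s = s.
Proof. by apply: fib_ext => x Ux; rewrite (fam_resE _ _ _ Ux). Qed.

Lemma fam_res_comp U V W (h : U `<=` V) (k : V `<=` W) (l : U `<=` W) s :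
  fam_res h (fam_res k s) = fam_res l s.
Proof.
by apply: fib_ext => x Ux; rewrite (fam_resE _ _ _ (h _ Ux)) !(fam_resE _ _ _ (l _ Ux)).
Qed.

Definition fam_sheaf : mod_presheaf O :=
  @ModPresheaf X O (fun U => fam_sec U) (fun U V h => @fam_res U V h)
    fam_res_id fam_res_comp.

(** Opens are stable under generization, so that compatible families glue. *)
Lemma fam_is_sheaf : is_sheaf (ab_of_mod fam_sheaf).
Proof.
move=> U I V VU cov s agree.
have ag i j x (Vi : opens_set (V i) x) (Vj : opens_set (V j) x) :
    fib (s i : fam_sec (V i)) Vi = fib (s j : fam_sec (V j)) Vj.
  have Vij : opens_set (opensI (V i) (V j)) x by split.
  have := congr1 (fun t : fam_sec (opensI (V i) (V j)) => fib t Vij) (agree i j).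
  by rewrite /= (fam_resE _ _ _ Vi) (fam_resE _ _ _ Vj).
have idx (x : sch_lrposet X) (Ux : opens_set U x) : {i | opens_set (V i) x}.
  by apply/cid; have [i _ Vix] := cov x Ux; exists i.
have [|t tE] := @fam_of U (fun x Ux => fib (s (sval (idx x Ux)) : fam_sec _) (svalP (idx x Ux))).
  move=> x y h Ux Uy; rewrite (fib_map _ h (opens_down h (svalP (idx y Uy)))).
  exact: ag.
exists t; split=> [i|t' t'E].
  by apply: fib_ext => x Vx; rewrite (fam_resE _ _ _ (VU i _ Vx)) tE; apply: ag.
apply: fib_ext => x Ux; rewrite tE; set i := sval _; set Vx := svalP _.
by rewrite -(t'E i) /= (fam_resE _ _ _ Ux).
Qed.

(** * Stalks and coherence of the sheaf of compatible families *)

Hypothesis presG : locally_presented G.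

(** This is [vanish_near], and the reason why a family is determined near [x] by its
    value at [x]. *)
Lemma fib_vanish V (s : fam_sec V) (x : sch_lrposet X) (Vx : opens_set V x) : fib s Vx = 0 ->
  exists U (UV : U `<=` V), opens_set U x /\ fam_res UV s = 0.
Proof.
move=> s0; have [W [nA [p [f [n [t [K [px npf tK]]]]]]]] := presG x.
move: Vx s0; rewrite -{x}px => Vx s0.
have [h nph hV] := basic_nbhd Vx.
pose c := aff_chart nA.
have inV q : ~ prime_set q (f * h) -> sub_opens V (c q).
  by move=> /prime_complMr nqh; apply: hV; apply/basicP.
have [||h' nph' h'0] := vanish_near (presents_shrink (c := c) h tK)
    (mod_fam_compat (c := c) (s : lim_mod _) inV) (p := p).
- exact: prime_complM.
- by rewrite (mod_famE _ (Vx : sub_opens V (c p))).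
have UV : basic W (f * h * h') `<=` V.
  by move=> _ [q nq <-]; apply: inV; apply: prime_complMl nq.
exists (basic W (f * h * h')), UV; split.
  by apply/basicP/prime_complM => //; apply: prime_complM.
apply: fib_ext => z Uz; have [q nq qz] := Uz; subst z.
rewrite (fam_resE _ _ _ (UV _ Uz)) fib0.
have := h'0 q (prime_complMl nq) (prime_complMr nq).
by rewrite (mod_famE _ (inV q (prime_complMl nq))) => <-; apply: fib_irr.
Qed.

Lemma fib_eq V (s t : fam_sec V) (x : sch_lrposet X) (Vx : opens_set V x) : fib s Vx = fib t Vx ->
  exists U (UV : U `<=` V), opens_set U x /\ fam_res UV s = fam_res UV t.
Proof.
move=> st; have [|U [UV [Ux e]]] := @fib_vanish V (s - t) x Vx.
  by rewrite fibB st subrr.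
exists U, UV; split=> //; apply/eqP; rewrite -subr_eq0; apply/eqP.
by rewrite -e raddfB.
Qed.

Section Chart.
Variables (W : affine_open O) (nA : noetherian (aff_ring W)).
Local Notation c := (aff_chart nA).

Lemma fam_of_family f (l : family c G) : compat f l ->
  exists s : fam_sec (basic W f), forall q (Uq : opens_set (basic W f) (c q)), fib s Uq = l q.
Proof.
move=> lC.
have [|s sE] := @fam_of (basic W f) (fun x _ => @spread _ c (psh_at G) (fun=> 0) l x).
  move=> x y h [p npf px] [q nqf qy]; subst x; subst y.
  by rewrite !(spreadE (c := c)); apply: lC.
by exists s => q Uq; rewrite sE spreadE.
Qed.

Lemma fib_gen f n (t : 'I_n -> family c G)
    (K : set 'rV[aff_ring W]_n) (T : 'I_n -> fam_sec (basic W f)) :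
  @presents _ c G f n t K ->
  (forall i q (Uq : opens_set (basic W f) (c q)), fib (T i) Uq = t i q) ->
  forall V (VU : V `<=` basic W f) (x : sch_lrposet X) (Vx : opens_set V x) (y : G x),
  exists U (UV : U `<=` V) (Ux : opens_set U x) (a : 'I_n -> O U),
    fib (\sum_i a i *: fam_res (subset_trans UV VU) (T i)) Ux = y.
Proof.
move=> tK TE V VU x Vx y; have Ux := VU _ Vx; have [q nqf qx] := Ux.
move: Vx y Ux; rewrite -{x}qx => Vx y Ux.
have [b ->] := pr_gen tK nqf y.
have [U [UV [Uq [a aE]]]] := germ_tuple b Vx.
exists U, UV, Uq, a; rewrite fib_sum; apply: eq_bigr => i _.
by rewrite fibZ (fam_resE _ _ _ Ux) TE aE.
Qed.

End Chart.

Section StalkValue.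
Variable x : sch_lrposet X.

Definition stalk_val (z : mod_stalk fam_sheaf x) : G x :=
  fib (sec_val (repr z) : fam_sec _) (sec_dom_in (repr z)).

Lemma stalk_valE V (Vx : opens_set V x) (s : fam_sheaf V) :
  stalk_val (mgerm Vx s) = fib (s : fam_sec V) Vx.
Proof.
have /eq_germ[U [Uz [UV [Ux /= ze]]]] := germ_repr (mgerm Vx s).
by rewrite /stalk_val -(fam_resE Uz _ Ux) -(fam_resE UV _ Ux) ze.
Qed.

Lemma stalk_val_is_linear : linear stalk_val.
Proof.
move=> a z w; case: (rmmgermP a z w) => U Ux b s t.
by rewrite mgermZ mgermD !stalk_valE fibD fibZ.
Qed.
HB.instance Definition _ := GRing.isLinear.Build (ring_stalk O x)
  (mod_stalk fam_sheaf x) (G x) *:%R stalk_val stalk_val_is_linear.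

(** A family is determined near [x] by its value at [x], and the combinations of the
    local generators, whose coefficients are germs of functions, take all values. *)
Lemma stalk_val_bij : bijective stalk_val.
Proof.
apply: inj_surj_bij => [z w|y].
  case: (mgerm2P z w) => V Vx s t; rewrite !stalk_valE => /fib_eq[U [UV [Ux e]]].
  by rewrite -(mgerm_res UV Vx Ux) -(mgerm_res UV Vx Ux) /= e.
have [W [nA [p [f [n [t [K [px npf tK]]]]]]]] := presG x.
have Ux : opens_set (basic W f) x by rewrite -px; apply/basicP.
have /choice[T TE] : forall i, exists s : fam_sec (basic W f),
    forall q (Uq : opens_set (basic W f) (aff_chart nA q)), fib s Uq = t i q.
  by move=> i; apply: fam_of_family; apply: (pr_compat tK).
have [V [VU [Vx [a <-]]]] := fib_gen tK TE (@subset_refl _ _) Ux y.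
by eexists (mgerm Vx _); rewrite stalk_valE.
Qed.

End StalkValue.

Lemma stalk_val_natural (x y : sch_lrposet X) (h : (x <= y)%O)
    (z : specialization fam_sheaf y) :
  stalk_val (psh_map (specialization fam_sheaf) h z) = psh_map G h (stalk_val z).
Proof.
case: (mgermP z) => V Vy s; rewrite [psh_map (specialization _) _ _]mod_stalk_mapE.
by rewrite !stalk_valE; apply/esym/fib_map.
Qed.

Lemma fam_specialization : psh_isomorphic (specialization fam_sheaf) G.
Proof.
apply: (@bij_psh_isomorphic _ _ _ (@PshMor _ (specialization fam_sheaf) G
  (fun x => @stalk_val x) stalk_val_natural)).
exact: stalk_val_bij.
Qed.

Lemma fam_finite_type : finite_type fam_sheaf.
Proof.
move=> x; have [W [nA [p [f [n [t [K [px npf tK]]]]]]]] := presG x.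
have /choice[T TE] : forall i, exists s : fam_sec (basic W f),
    forall q (Uq : opens_set (basic W f) (aff_chart nA q)), fib s Uq = t i q.
  by move=> i; apply: fam_of_family; apply: (pr_compat tK).
exists (basic W f), n, T; split; first by rewrite -px; apply/basicP.
move=> V VU s y Vy.
have [U1 [U1V [U1y [a aE]]]] := fib_gen tK TE VU Vy (fib (s : fam_sec V) Vy).
have [|U2 [U2U1 [U2y e]]] := @fib_eq U1 (\sum_i a i *: fam_res (subset_trans U1V VU) (T i))
   (fam_res U1V s) y U1y.
  by rewrite aE (fam_resE _ _ _ Vy).
exists U2, (subset_trans U2U1 U1V); split=> //.
exists (fun i => rp_res O U2U1 (a i)).
rewrite /= -(fam_res_comp U2U1 U1V) -e raddf_sum; apply: eq_bigr => i _.
by rewrite /= linearZ /= (fam_res_comp _ _ (subset_trans (subset_trans U2U1 U1V) VU)).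
Qed.

(** On a small basic open set, a power of the invertible [f'] times [s i] is the
    combination of the generators [t] given by a vector [w i]. Hence the relations between
    the [s i] are generated by the [a] in [A^n] such that [\sum_i a_i w_i] lies in [K],
    and these are finitely generated since [A] is noetherian. *)
Lemma fam_kernel_finite_type U n (s : 'I_n -> fam_sheaf U) : kernel_finite_type s.
Proof.
move=> x Ux; have [W [nA [p [f [k [t [K [px npf tK]]]]]]]] := presG x.
rewrite -px in Ux; have [h nph hU] := basic_nbhd Ux.
pose c := aff_chart nA; pose f' := f * h.
have tK' : @presents _ c G f' k t K := presents_shrink (c := c) h tK.
have inU q : ~ prime_set q f' -> sub_opens U (c q).
  by move=> /prime_complMr nqh; apply: hU; apply/basicP.
pose l i : family c G := mod_fam (s i : fam_sec U).
have /choice[e eP] : forall i, exists e, exists v,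
    forall q, ~ prime_set q f' -> ch_sec c q (f' ^+ e) *: l i q = comb t v q.
  by move=> i; apply: (family_frac tK'); apply: mod_fam_compat.
move/choice: eP => [v vP].
(* A common exponent for the denominators of all the [s i]. *)
pose E := (\sum_i e i)%N; pose w i := f' ^+ (E - e i) *: v i.
have wE i q : ~ prime_set q f' -> ch_sec c q (f' ^+ E) *: l i q = comb t (w i) q.
  move=> nqf; rewrite /w combZ -vP // scalerA -rmorphM -exprD subnK //.
  by rewrite /E (bigD1 i) //= leq_addr.
have lE (a : 'rV[aff_ring W]_n) q : ~ prime_set q f' ->
    ch_sec c q (f' ^+ E) *: (\sum_i ch_sec c q (a ord0 i) *: l i q) =
    comb t (\sum_i a ord0 i *: w i) q.
  move=> nqf; rewrite comb_sum scaler_sumr; apply: eq_bigr => i _.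
  by rewrite combZ -wE // !scalerA mulrC.
have [K0 KD KZ] := pr_sub tK.
pose N : set 'rV[aff_ring W]_n := [set a | K (\sum_i a ord0 i *: w i)].
have NS : is_submod N.
  rewrite /N; split=> [|a b Na Nb|a b Nb] /=.
  - by rewrite big1 // => i _; rewrite mxE scale0r.
  - have -> : \sum_i (a + b) ord0 i *: w i = \sum_i a ord0 i *: w i + \sum_i b ord0 i *: w i.
      by rewrite -big_split; apply: eq_bigr => i _; rewrite mxE scalerDl.
    exact: KD.
  - have -> : \sum_i (a *: b) ord0 i *: w i = a *: \sum_i b ord0 i *: w i.
      by rewrite scaler_sumr; apply: eq_bigr => i _; rewrite mxE scalerA.
    exact: KZ.
have [m [rho [Nrho genN]]] := noeth_row nA NS.
have VU : basic W f' `<=` U by move=> _ [q nq <-]; apply: inU.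
exists (basic W f'), VU, m, (fun j i => rp_res O (@basic_range X W f') (aff_sec (rho j ord0 i))).
have germ_rho j i q (Vq : opens_set (basic W f') (aff_map W q)) :
    rgerm Vq (rp_res O (@basic_range X W f') (aff_sec (rho j ord0 i))) = aff_germ q (rho j ord0 i).
  by rewrite (rgerm_res _ (aff_rangeP q)).
have fibl i q (Uq : opens_set U (aff_map W q)) : fib (s i : fam_sec U) Uq = l i q.
  by rewrite /l (mod_famE _ (Uq : sub_opens U (c q))).
split; first by rewrite -px; apply/basicP/prime_complM.
  move=> j; apply: fib_ext => z Vz; have [q nq qz] := Vz; subst z.
  rewrite fib_sum fib0.
  apply: (@unit_kill _ c q (f' ^+ E) (G (c q))); first exact: prime_complX.
  rewrite -[RHS](pr_rel1 tK' nq (Nrho j)) -lE //; congr (_ *: _).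
  apply: eq_bigr => i _; rewrite fibZ germ_rho.
  by rewrite (fam_resE _ _ _ (inU q nq)) fibl.
move=> V VU' b y rel Vy; have [q nq qy] := VU' _ Vy.
move: Vy; rewrite -{y}qy => Vq.
have [u [a [nu ua]]] := @frac_tuple _ c q n (fun i => rgerm Vq (b i)).
have a0 : comb t (\sum_i (\row_i a i) ord0 i *: w i) q = 0.
  rewrite -lE //.
  have rel0 : \sum_i (rgerm Vq (b i) : lr_ring (c q)) *: l i q = 0.
    transitivity (fib (\sum_i b i *: fam_res (subset_trans VU' VU) (s i)) Vq).
      rewrite fib_sum; apply: eq_bigr => i _.
      by rewrite fibZ (fam_resE _ _ _ (inU q nq)) fibl.
    by rewrite [\sum_i _]rel.
  have -> : \sum_i ch_sec c q ((\row_i a i) ord0 i) *: l i q =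
      ch_sec c q u *: \sum_i (rgerm Vq (b i) : lr_ring (c q)) *: l i q.
    rewrite scaler_sumr; apply: eq_bigr => i _.
    by rewrite mxE -ua scalerA.
  by rewrite rel0 !scaler0.
have [u' nu' Ku'] := proj1 (pr_rel tK' nq _) a0.
have [|d dE] := genN (u' *: \row_i a i).
  rewrite /N /=; have -> : \sum_i (u' *: \row_i a i) ord0 i *: w i =
      u' *: \sum_i (\row_i a i) ord0 i *: w i.
    by rewrite scaler_sumr; apply: eq_bigr => i _; rewrite !mxE scalerA.
  by [].
have nuu : invertible (aff_germ q (u' * u)).
  by apply: aff_germ_unit; apply: prime_complM.
(* The coefficients [d] over [A] express [u' u] times the germs of [b]. *)
have [V1 [V1V [V1q [al alE]]]] := germ_tuple
  (fun j => uinv (aff_germ q (u' * u)) * aff_germ q (d j)) Vq.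
pose V1U := subset_trans V1V VU'.
have [|V2 [V2V1 [V2q e2]]] := @rgerm_eq_tuple _ O _ n V1 V1q (fun i => rp_res O V1V (b i))
  (fun i => \sum_j al j * rp_res O V1U (rp_res O (@basic_range X W f') (aff_sec (rho j ord0 i)))).
  move=> i; rewrite (rgerm_res V1V Vq) rgerm_sum.
  transitivity (uinv (aff_germ q (u' * u)) * (aff_germ q (u' * u) * rgerm Vq (b i))).
    by rewrite mulrA uinvK // mul1r.
  have -> : aff_germ q (u' * u) * rgerm Vq (b i) =
      \sum_j aff_germ q (d j) * aff_germ q (rho j ord0 i).
    transitivity (aff_germ q (u' * a i)).
      by rewrite !rmorphM /= -[aff_germ q (a i)](ua i) mulrA.
    transitivity (aff_germ q ((u' *: \row_i a i) ord0 i)); first by rewrite !mxE.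
    rewrite dE summxE raddf_sum; apply: eq_bigr => j _.
    by rewrite mxE /= rmorphM.
  rewrite mulr_sumr; apply: eq_bigr => j _.
  by rewrite -rgermM -alE (rgerm_res V1U (VU' _ Vq)) germ_rho mulrA.
exists V2, (subset_trans V2V1 V1V); split=> //.
exists (fun j => rp_res O V2V1 (al j)) => i.
rewrite -(rp_res_comp V2V1 V1V) e2 raddf_sum; apply: eq_bigr => j _.
by rewrite /= rmorphM (rp_res_comp _ _ (subset_trans (subset_trans V2V1 V1V) VU')).
Qed.

Definition fam_coherent : coherent_sheaf X :=
  CoherentSheaf fam_is_sheaf (conj fam_finite_type fam_kernel_finite_type).

End SheafOfFamilies.

Theorem claim5p5 (X : scheme) (hX : noetherian_scheme X)
    (G : psh (sch_lrposet X)) :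
  (exists F : coherent_sheaf X, psh_isomorphic (specialization F) G) <->
  admissible G.
Proof.
split=> [[F FG]|/(admissible_presented hX) GP].
  exact/(presented_admissible hX)/(coherent_presented hX FG).
by exists (fam_coherent GP); apply: fam_specialization.
Qed.
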